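(* Let $k$ be a positive integer and let $\vec p=(p_1,\dots,p_k)$ with $p_i>0$ and $\sum_i p_i=1$. For each $n\ge1$ let $\alpha_n$ be a mixed strategy for $n$-token competitive Knock 'em Down with die probabilities $\vec p$ (regarded as a probability measure on the set $A_n$ of normalized allocations). If $\alpha_n$ converges weakly to $\alpha_0$ as $n\to\infty$, where $\alpha_0$ is an optimal strategy for the continuous game with parameter $\vec p$, then $(\alpha_n)$ is asymptotically optimal for the $n$-token games, in the sense that $$\kappa_n:=\min_{\vec y\in A_n}K_n(\alpha_n,\vec y)\to0\quad\text{as }n\to\infty.$$
   Context: Continuous game: a (pure) allocation is $\vec x\in\mathbb R^k$ with $\sum_i x_i=0$. Let $Z_1,\dots,Z_k$ be independent standard normals (the same for both players), and let $T_{\vec x}=\max_i\left(\frac{x_i}{p_i}+\frac{Z_i}{\sqrt{p_i}}\right)$. Set $\Pr[\vec x\text{ beats }\vec y]=\Pr[T_{\vec x}<T_{\vec y}]+\frac12\Pr[T_{\vec x}=T_{\vec y}]$ and $K(\vec x,\vec y)=\frac12\left(\Pr[\vec x\text{ beats }\vec y]-\Pr[\vec y\text{ beats }\vec x]\right)$. Mixed strategies are Borel probability measures on allocations, with $K(\alpha,\beta)=\iint K(\vec x,\vec y)\,\alpha(d\vec x)\,\beta(d\vec y)$. A mixed strategy $\alpha$ is optimal if no mixed strategy $\beta$ (equivalently, no pure strategy) satisfies $K(\beta,\alpha)>0$. $n$-token game: a token allocation is a vector $\vec\xi$ of nonnegative integers with $\sum_i\xi_i=n$. Its normalized form is $\vec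 x$ with $x_i=(\xi_i-p_in)/\sqrt n$, so $\sum_i x_i=0$. $A_n$ is the finite set of normalized allocations. Let $Y_{i,t}$, $1\le i\le k$, be independent Poisson processes with rates $p_i$ (counting die throws showing side $i$; the same for both players). The clearance time of $\vec\xi$ is $\max_i\inf\{t\ge0:Y_{i,t}\ge\xi_i\}$. For $\vec x,\vec y\in A_n$, $\Pr[\vec x\text{ beats }\vec y]$ is the probability that the clearance time of $\vec x$ is strictly smaller than that of $\vec y$ plus half the probability that they are equal, and $K_n(\vec x,\vec y)=\frac12\left(\Pr[\vec x\text{ beats }\vec y]-\Pr[\vec y\text{ beats }\vec x]\right)$. A mixed strategy $\alpha_n$ is a probability measure on $A_n$, with $K_n(\alpha_n,\vec y)=\int K_n(\vec x,\vec y)\,\alpha_n(d\vec x)$. Weak convergence means weak convergence of probability measures on $\mathbb R^k$. *)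

(* Defs.v *)
From HB Require Import structures.
From mathcomp Require Import all_boot all_order all_algebra.
From mathcomp Require Import all_classical all_reals all_analysis.

Set Implicit Arguments.
Unset Strict Implicit.
Unset Printing Implicit Defensive.

Import Order.TTheory GRing.Theory Num.Theory.
Import numFieldNormedType.Exports.

Local Open Scope classical_set_scope.
Local Open Scope ring_scope.

(* R^k with its Borel sigma-algebra *)
Definition borel_rV (R : realType) (k : nat) :=
  g_sigma_algebraType (@open 'rV[R]_k).

Section independence.
Context d (T : measurableType d) (R : realType) (P : probability T R).

(* The product rule over every finite subfamily; F i is meant to be a
   sigma-algebra. *)
Definition mutually_independent (I : finType) (F : I -> set_system T) : Prop :=
  forall (J : {set I}) (A : I -> set T),
    (forall i, i \in J -> F i (A i)) ->
    P (\bigcap_(i in [set` J]) A i) = (\prod_(i in J) fine (P (A i)))%:E.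

Definition sigma_of d' (T' : measurableType d') (X : T -> T') : set_system T :=
  preimage_set_system [set: T] X measurable.

End independence.

Section poisson_process.
Context d (T : measurableType d) (R : realType) (P : probability T R).

(* Only the values at times t >= 0 are relevant. *)
Record poisson_process (lambda : R) (Y : R -> T -> nat) : Prop := {
  pp_measurable : forall t, 0 <= t -> measurable_fun [set: T] (Y t) ;
  pp_start : forall w, Y 0 w = 0%N ;
  pp_nondecreasing : forall w s t, 0 <= s -> s <= t -> (Y s w <= Y t w)%N ;
  (* right continuity, for integer-valued paths *)
  pp_right_continuous : forall w t, 0 <= t ->
    \forall s \near t^'+, Y s w = Y t w ;
  pp_increments : forall s t, 0 <= s -> s < t -> forall j : nat,
    P [set w | Y t w = (Y s w + j)%N] =
      (poisson_pmf (lambda * (t - s)) j)%:E ;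
  pp_independent : forall (m : nat) (t : nat -> R), 0 <= t 0%N ->
    {homo t : i j / (i <= j)%N >-> i <= j} ->
    mutually_independent P
      (fun j : 'I_m => sigma_of (fun w => (Y (t j.+1) w - Y (t j) w)%N))
}.

Definition sigma_process (Y : R -> T -> nat) : set_system T :=
  <<s \bigcup_(t in [set t : R | 0 <= t]) sigma_of (Y t) >>.

End poisson_process.

(* Payoffs of a zero-sum race between two random times S and S' (smaller wins) *)
Section race.
Context d (T : measurableType d) (R : realType) (P : probability T R).

Definition pr_beats (S S' : T -> \bar R) : R :=
  fine (P [set w | (S w < S' w)%E]) + 2^-1 * fine (P [set w | S w = S' w]).

Definition race_payoff (S S' : T -> \bar R) : R :=
  2^-1 * (pr_beats S S' - pr_beats S' S).

End race.

Section weak_convergence.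
Context (R : realType) (k : nat).

Definition weakly_converges (mu : nat -> probability (borel_rV R k) R)
    (nu : probability (borel_rV R k) R) : Prop :=
  forall f : 'rV[R]_k -> R, continuous f ->
    (exists M, forall x, `|f x| <= M) ->
    \int[mu n]_x f x @[n --> \oo] --> \int[nu]_x f x.

End weak_convergence.

Section continuous_game.
Context (R : realType) (k : nat) (p : 'I_k -> R).
Context d (T : measurableType d) (P : probability T R).
Variable Z : 'I_k -> T -> R.

Definition allocation : set 'rV[R]_k := [set x | \sum_(i < k) x 0 i = 0].

(* The maximum of finitely many reals, computed in \bar R; the neutral element
   -oo is only reached for k = 0. *)
Definition limit_time (x : 'rV[R]_k) (w : T) : \bar R :=
  \big[maxe/-oo%E]_(i < k) (x 0 i / p i + Z i w / Num.sqrt (p i))%:E.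

Definition K_pure (x y : 'rV[R]_k) : R :=
  race_payoff P (limit_time x) (limit_time y).

Definition mixed_strategy (alpha : probability (borel_rV R k) R) : Prop :=
  alpha allocation = 1%E.

Definition K_mixed (alpha beta : probability (borel_rV R k) R) : R :=
  \int[beta]_y \int[alpha]_x K_pure x y.

Definition optimal (alpha : probability (borel_rV R k) R) : Prop :=
  mixed_strategy alpha /\
  ~ exists2 beta, mixed_strategy beta & 0 < K_mixed beta alpha.

End continuous_game.

Section token_game.
Context (R : realType) (k : nat) (p : 'I_k -> R).
Context d (T : measurableType d) (P : probability T R).
Variable Y : 'I_k -> R -> T -> nat.

Definition token_allocation (n : nat) : set ('I_k -> nat) :=
  [set xi | (\sum_(i < k) xi i)%N = n].

Definition normalize (n : nat) (xi : 'I_k -> nat) : 'rV[R]_k :=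
  \row_i (((xi i)%:R - p i * n%:R) / Num.sqrt n%:R).

Definition A_ (n : nat) : set 'rV[R]_k := normalize n @` token_allocation n.

(* inverse of normalize for n > 0, see normalizeK *)
Definition tokens (n : nat) (x : 'rV[R]_k) : 'I_k -> nat :=
  fun i => Num.truncn (p i * n%:R + x 0 i * Num.sqrt n%:R).

Lemma normalizeK (n : nat) : (0 < n)%N -> cancel (normalize n) (tokens n).
Proof.
move=> n0 xi; apply/funext => i; rewrite /tokens mxE divfK; last first.
  by rewrite gt_eqF// sqrtr_gt0 ltr0n.
by rewrite addrC subrK Num.Theory.natrK.
Qed.

Definition clearance_time (xi : 'I_k -> nat) (w : T) : \bar R :=
  \big[maxe/-oo%E]_(i < k)
    ereal_inf [set t%:E | t in [set t : R | 0 <= t /\ (xi i <= Y i t w)%N]].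

(* meaningful for x, y \in A_ n *)
Definition Kn_pure (n : nat) (x y : 'rV[R]_k) : R :=
  race_payoff P (clearance_time (tokens n x)) (clearance_time (tokens n y)).

(* mixed strategies of the n-token game, as Borel measures carried by the
   finite set A_ n *)
Definition token_mixed_strategy (n : nat)
  (alpha : probability (borel_rV R k) R) : Prop := alpha (A_ n) = 1%E.

Definition Kn_mixed (n : nat) (alpha : probability (borel_rV R k) R)
    (y : 'rV[R]_k) : R :=
  \int[alpha]_(x in A_ n) Kn_pure n x y.

(* A_ n is finite and nonempty for k > 0, so that this infimum is a minimum,
   see kappa_min *)
Definition kappa (n : nat) (alpha : probability (borel_rV R k) R) : R :=
  inf [set Kn_mixed n alpha y | y in A_ n].

Lemma finite_A_ (n : nat) : finite_set (A_ n).
Proof.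
apply: finite_image.
apply: (@sub_finite_set _ _
  ((fun f : {ffun 'I_k -> 'I_n.+1} => (fun i => f i : nat)) @` setT)).
  move=> xi /= xin.
  have le_xi i : (xi i < n.+1)%N.
    by rewrite ltnS -xin (bigD1 i)//= leq_addr.
  exists [ffun i => Ordinal (le_xi i)] => //.
  by apply/funext => i; rewrite ffunE.
exact/finite_image/finite_finset.
Qed.

Lemma A_neq0 (n : nat) : (0 < k)%N -> A_ n !=set0.
Proof.
move=> k0; pose i0 := Ordinal k0.
exists (normalize n (fun i => if i == i0 then n else 0%N)).
exists (fun i => if i == i0 then n else 0%N) => //=.
by rewrite /token_allocation /= -big_mkcond/= big_pred1_eq.
Qed.

Lemma kappa_min (n : nat) (alpha : probability (borel_rV R k) R) :
  (0 < k)%N ->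
  exists2 y, A_ n y & kappa n alpha = Kn_mixed n alpha y /\
    forall z, A_ n z -> Kn_mixed n alpha y <= Kn_mixed n alpha z.
Proof.
move=> k0; have [x0 Ax0] := A_neq0 n k0.
have [s As] := (finite_seqP (A_ n)).1 (finite_A_ n).
have sx0 : x0 \in s by move: Ax0; rewrite As.
suff [y sy ymin] : exists2 y, y \in s &
    forall z, z \in s -> Kn_mixed n alpha y <= Kn_mixed n alpha z.
  have Ay : A_ n y by rewrite As.
  have Amin z : A_ n z -> Kn_mixed n alpha y <= Kn_mixed n alpha z.
    by rewrite As => /ymin.
  exists y => //; split => //; apply/eqP; rewrite eq_le; apply/andP; split.
    apply: ge_inf; last by exists y.
    by exists (Kn_mixed n alpha y) => _ [z /Amin ? <-].
  apply: lb_le_inf; first by exists (Kn_mixed n alpha y), y.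
  by move=> _ [z /Amin ? <-].
elim: s {As Ax0} x0 sx0 => // a [|b s] IH x0 _.
  by exists a; rewrite ?mem_head// => z; rewrite inE => /eqP ->.
have [y sy ymin] := IH b (mem_head b s).
have [aley|ylta] := leP (Kn_mixed n alpha a) (Kn_mixed n alpha y).
  exists a; rewrite ?mem_head// => z; rewrite inE => /predU1P[->//|/ymin].
  exact: le_trans.
exists y; first by rewrite inE sy orbT.
by move=> z; rewrite inE => /predU1P[->|/ymin//]; exact: ltW.
Qed.

End token_game.

(* Main.v *)
(* Let M = max(x, y) be the coordinatewise maximum of two allocations. The race
   between x and y is decided at the side i which is the last one to finish
   under M: whoever placed fewer tokens there wins. Hence 2 K(x, y) is the sum
   of sgn(y_i - x_i) q_i(M), where q_i(M) is the probability that i finishes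
   last, up to the probability of a tie. The central limit theorem for the
   gamma-distributed finishing times shows that the q_i of the n-token game
   converge to those of the Gaussian game, so that K_n(x_n, y_n) is
   asymptotically at least K(x, y) as soon as coincidences x_i = y_i cannot lower
   the payoff; if some coordinate of y_n is unbounded, y_n loses.

   Coincidences are harmless for almost all x under an optimal alpha_0. By
   antisymmetry K(alpha_0, y) = 0 for almost every y, and moving such a y
   infinitesimally cannot make the payoff negative. For k > 2 this forces the
   marginals of alpha_0 to be atomless; for k <= 2, x_i = y_i implies x = y, and
   the first-order condition at an atom y is what is needed.

   A Fatou lemma for weak convergence then bounds K_n(alpha_n, y) from below near
   each y and near infinity, compactness makes the bound uniform in y, and
   kappa_n <= 0 by antisymmetry. *)
Require Import Defs.
From HB Require Import structures.
From mathcomp Require Import all_boot all_order all_algebra.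
From mathcomp Require Import all_classical all_reals all_analysis.
From mathcomp Require Import measurable_realfun.
From mathcomp Require Import ring lra zify.

Set Implicit Arguments.
Unset Strict Implicit.
Unset Printing Implicit Defensive.

Import Order.TTheory GRing.Theory Num.Theory.
Import numFieldNormedType.Exports.

Local Open Scope classical_set_scope.
Local Open Scope ring_scope.

(** * Poisson and gamma asymptotics *)

(** The convergence of the last-finisher probabilities uses neither joint laws nor densities of
    vectors. A finite time grid bounds each [q i] from below by a finite sum of products of
    one-dimensional distribution functions. For the Gaussian limits these sums, added over [i], come
    arbitrarily close to 1, while the [q i] add up to at most 1: lower bounds for all sides are
    therefore upper bounds too. The deficit [1 - sum q i] also controls ties; it is 0 in the
    Gaussian game and tends to 0 in the token games. Races reduce to the maximum [M] because both
    players share the same noise: on each side the later of two finishing times is that of the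
    larger allocation.

    The payoff jumps where coordinates coincide, and [Kn_pure] is meaningful only on a lattice that
    changes with [n], so weak convergence cannot be applied to it directly. It is applied to a
    Lipschitz minorant common to all pairs [(n, y)] under consideration. This asks for
    semicontinuity from below only, which is why coincidences have to be harmless in one direction
    only. *)

Section log_bounds.
Variable R : realType.
Implicit Types x y u : R.

Let nondecreasing_ge0 (f df : R -> R) : (forall y, is_derive y 1 f (df y)) ->
  (forall y, 0 <= df y) -> {homo f : x y / x <= y}.
Proof.
move=> fd df0 x y xy.
apply: (@ger0_derive1_ndecr _ f x y) => //.
- by move=> z _; rewrite derive1E; have := fd z; move=> [_ ->].
- apply: derivable_within_continuous => z _.
  by have [+ _] := fd z.
Qed.

Definition sinhB y := expR y - expR (- y) - 2 * y.

Lemma sinhB_nondecreasing : {homo sinhB : x y / x <= y}.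
Proof.
apply: (@nondecreasing_ge0 _ (fun y => expR y + expR (- y) - 2)).
  move=> y; rewrite /sinhB.
  apply: is_derive_eq.
  rewrite /GRing.scale/=; ring.
move=> y.
rewrite expRN.
have := expR_gt0 y; set e := expR y => e0.
rewrite (_ : _ - _ = (e - 1)^+2 / e) ; last first.
  by field; rewrite gt_eqF.
by rewrite divr_ge0// ?sqr_ge0// ltW.
Qed.

Definition quadB y := y - expR y + 1 + (expR y - 1) ^+ 2 / 2.

Lemma quadB_nondecreasing : {homo quadB : x y / x <= y}.
Proof.
apply: (@nondecreasing_ge0 _ (fun y => (expR y - 1) ^+ 2)).
  move=> y; rewrite /quadB.
  apply: is_derive_eq.
  by rewrite /GRing.scale/=; field.
by move=> y; exact: sqr_ge0.
Qed.

(* Both bounds are the monotonicity, in [y = ln (1 + x)], of an elementary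
   function vanishing at 0; for the first one it is [sinh y - y]. *)
Lemma ln1Dx_ge0_bounds x : 0 <= x ->
  x - x ^+ 2 / 2 <= ln (1 + x) <= x - x ^+ 2 / (2 * (1 + x)).
Proof.
move=> x0; have x1 : 0 < 1 + x by rewrite ltr_pwDl.
have ly : 0 <= ln (1 + x) by rewrite ln_ge0// lerDl.
have ey : expR (ln (1 + x)) = 1 + x by rewrite lnK.
have := sinhB_nondecreasing ly; have := quadB_nondecreasing ly.
rewrite /quadB /sinhB !expRN expR0 ey invr1 => h1 h2.
apply/andP; split; first by lra.
have -> : x - x ^+ 2 / (2 * (1 + x)) = (1 + x - (1 + x)^-1) / 2.
  by field; rewrite gt_eqF.
lra.
Qed.

Lemma ln1Dx_le0_bounds x : -1 < x <= 0 ->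
  x - x ^+ 2 / (2 * (1 + x)) <= ln (1 + x) <= x - x ^+ 2 / 2.
Proof.
move=> /andP[x1' x0]; have x1 : 0 < 1 + x by lra.
have ly : ln (1 + x) <= 0 by rewrite ln_le0// gerDl.
have ey : expR (ln (1 + x)) = 1 + x by rewrite lnK.
have := sinhB_nondecreasing ly; have := quadB_nondecreasing ly.
rewrite /quadB /sinhB !expRN expR0 ey invr1 => h1 h2.
apply/andP; split; last by lra.
have -> : x - x ^+ 2 / (2 * (1 + x)) = (1 + x - (1 + x)^-1) / 2.
  by field; rewrite gt_eqF.
lra.
Qed.

End log_bounds.

(** * Poisson distribution functions as gamma integrals *)

Section poisson_tail.
Variable R : realType.
Implicit Types (l u z : R) (m : nat).
Notation mu := (@lebesgue_measure R).

Definition poisson_cdf l m : R := \sum_(j < m.+1) l ^+ j / j`!%:R * expR (- l).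

(** The sum telescopes under differentiation in the mean [l] and leaves minus the density of the
    gamma law of shape [m + 1]: at unit rate, the arrival number [m + 1] comes after time [l]
    exactly when at most [m] have come by then. *)
Lemma is_derive_poisson_cdf l m :
  is_derive l 1 (poisson_cdf ^~ m) (- (l ^+ m / m`!%:R * expR (- l))).
Proof.
elim: m => [|m IH].
  rewrite [X in is_derive _ _ X _](_ : _ = fun l => expR (- l)).
    apply: is_derive_eq; rewrite /GRing.scale/= expr0 fact0 invr1; ring.
  by apply/funext => x; rewrite /poisson_cdf big_ord1 expr0 fact0 invr1 !mul1r.
pose c : R := (m.+1)`!%:R^-1.
rewrite [X in is_derive _ _ X _](_ : _ =
  (poisson_cdf ^~ m) + (fun x => x ^+ m.+1) * (fun x => c * expR (- x))); last first.
  by apply/funext => x; rewrite /poisson_cdf big_ord_recr/= mulrA.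
have dX : is_derive l 1 (fun x : R => x ^+ m.+1) (m.+1%:R * l ^+ m).
  have := @is_deriveX _ R id m.+1 l 1 1 (is_derive_id _ _).
  by rewrite fctE /GRing.scale/= mulr1.
have dE : is_derive l 1 (fun x : R => c * expR (- x)) (c * - expR (- l)).
  by apply: is_derive_eq; rewrite /GRing.scale/= mulrN1.
apply: is_derive_eq; rewrite /GRing.scale/= exprS /c factS natrM.
have : m`!%:R != 0 :> R by rewrite pnatr_eq0 -lt0n fact_gt0.
have : m.+1%:R != 0 :> R by [].
move: (m.+1%:R : R) (m`!%:R : R) (l ^+ m) => a b L a0 b0.
by field; rewrite b0 a0.
Qed.

End poisson_tail.

Section poisson_tail_integral.
Variable R : realType.
Implicit Types (l u z : R) (m : nat).
Notation mu := (@lebesgue_measure R).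

Lemma poisson_cdf_ge0 l m : 0 <= l -> 0 <= poisson_cdf l m.
Proof.
by move=> l0; apply: sumr_ge0 => j _; rewrite !mulr_ge0 ?invr_ge0 ?exprn_ge0 ?expR_ge0.
Qed.

(** One Taylor term of the exponential bounds each summand. The estimate is crude; its purpose is
    the limit 0 for [l] tending to infinity with [m] fixed. *)
Lemma poisson_cdf_le l m : 0 < l -> poisson_cdf l m <= m.+1%:R ^+ 2 / l.
Proof.
move=> l0.
have le_term (j : 'I_m.+1) : l ^+ j / j`!%:R * expR (- l) <= m.+1%:R / l.
  rewrite expRN ler_pdivrMr ?expR_gt0// mulrAC ler_pdivlMr//.
  apply: (@le_trans _ _ (j.+1%:R * (1 + l ^+ j.+1 / j.+1`!%:R))).
    rewrite mulrDr mulr1 (_ : j.+1%:R * _ = l ^+ j / j`!%:R * l); last first.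
      rewrite factS natrM exprSr.
      have : j`!%:R != 0 :> R by rewrite pnatr_eq0 -lt0n fact_gt0.
      have : j.+1%:R != 0 :> R by [].
      by move: (j.+1%:R : R) (j`!%:R : R) => a b a0 b0; field; rewrite b0 a0.
    by rewrite lerDr.
  apply: ler_pM => //.
  - by rewrite addr_ge0// divr_ge0// exprn_ge0// ltW.
  - by rewrite ler_nat ltn_ord.
  - by rewrite expR_ge1Dxn// ltW.
apply: (le_trans (ler_sum _ (fun j _ => le_term j))).
by rewrite sumr_const card_ord -[leLHS]mulr_natr expr2 mulrAC.
Qed.

(** On [u >= - sqrt m], the density of [(G - m) / sqrt m] for [G] gamma distributed of shape
    [m + 1]; [m] is the mode of [G]. *)
Definition gamma_pdf m u : R :=
  Num.sqrt m%:R * ((m%:R + u * Num.sqrt m%:R) ^+ m / m`!%:R *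
  expR (- (m%:R + u * Num.sqrt m%:R))).

Lemma is_derive_gamma m u :
  is_derive u 1 (fun u => - poisson_cdf (m%:R + u * Num.sqrt m%:R) m)
    (gamma_pdf m u).
Proof.
set s := Num.sqrt _.
have dl : is_derive u 1 (fun u => m%:R + u * s) s.
  by apply: is_derive_eq; rewrite /GRing.scale/=; ring.
have := @is_derive1_comp R (fun l => @poisson_cdf R l m) (fun u => m%:R + u * s) u _ _
  (is_derive_poisson_cdf _ m) dl.
move=> dc; have := is_deriveN dc => /is_derive_eq; apply.
rewrite /gamma_pdf -/s; ring.
Qed.

Lemma continuous_gamma_pdf m : continuous (gamma_pdf m).
Proof.
move=> u; rewrite /gamma_pdf.
set s := Num.sqrt _.
have cl : (fun u : R => m%:R + u * s) @ u --> m%:R + u * s.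
  by apply: cvgD; [exact: cvg_cst|apply: cvgM; [exact: cvg_id|exact: cvg_cst]].
apply: cvgM; first exact: cvg_cst.
apply: cvgM.
  apply: cvgM; last exact: cvg_cst.
  apply: (cvg_comp _ (fun x : R => x ^+ m) cl).
  exact: exprn_continuous.
apply: (cvg_comp _ expR); last exact: continuous_expR.
exact: cvgN.
Qed.

Lemma integral_gamma_pdf m z : (0 < m)%N -> - Num.sqrt m%:R <= z ->
  (\int[mu]_(u in `[z, +oo[) (gamma_pdf m u)%:E =
   (poisson_cdf (m%:R + z * Num.sqrt m%:R) m)%:E)%E.
Proof.
move=> m0 zs; set s := Num.sqrt m%:R.
have s0 : 0 < s by rewrite sqrtr_gt0 ltr0n.
have ss : s * s = m%:R by rewrite -expr2 sqr_sqrtr.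
have l_ge0 x : z <= x -> 0 <= m%:R + x * s.
  move=> zx; have sx : - s <= x by exact: le_trans zx.
  by rewrite -ss -mulrDl mulr_ge0// ?(ltW s0)// -lerBlDl sub0r.
have dF x := is_derive_gamma m x.
pose F u := - poisson_cdf (m%:R + u * s) m.
have -> : poisson_cdf (m%:R + z * s) m = 0 - F z by rewrite /F sub0r opprK.
rewrite EFinB.
apply: ge0_continuous_FTC2y.
- move=> x zx; rewrite /gamma_pdf -/s mulr_ge0 ?(ltW s0)//.
  by rewrite !mulr_ge0 ?invr_ge0 ?expR_ge0// exprn_ge0// l_ge0.
- exact/continuous_subspaceT/continuous_gamma_pdf.
- apply/cvgrPdist_le => e e0; near=> u.
  have u0 : 0 < u by near: u; exact: nbhs_pinfty_gt.
  have l0 : 0 < m%:R + u * s by rewrite ltr_wpDl ?mulr_gt0.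
  rewrite sub0r opprK ger0_norm ?poisson_cdf_ge0 ?ltW//.
  apply: (le_lt_trans (poisson_cdf_le _ l0)).
  rewrite ltr_pdivrMr// mulrC -ltr_pdivrMr//.
  apply: (@lt_le_trans _ _ (u * s)); last by rewrite lerDr.
  rewrite -ltr_pdivrMr//.
  by near: u; apply: nbhs_pinfty_gt; rewrite num_real.
- by move=> x _; have [] := dF x.
- apply: cvg_at_right_filter.
  apply: differentiable_continuous; apply/derivable1_diffP.
  by have [] := dF z.
- by move=> x _; rewrite derive1E; have [] := dF x.
Unshelve. all: end_near. Qed.

End poisson_tail_integral.

(** * Pointwise limit and domination of the rescaled gamma density *)

Section poisson_clt.
Variable R : realType.
Implicit Types (l u z : R) (m : nat).
Notation mu := (@lebesgue_measure R).

(* The gamma density [gamma_pdf m], restricted to its support and rescaled to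
   take the value 1 at 0. *)
Definition gamma_fun m u : R :=
  if - Num.sqrt m%:R <= u then
    (1 + u / Num.sqrt m%:R) ^+ m * expR (- (u * Num.sqrt m%:R)) else 0.

(** The value of [gamma_pdf m] at 0, whose limit amounts to Stirling's formula. *)
Definition gamma_scale m : R :=
  Num.sqrt m%:R * (m%:R ^+ m / m`!%:R * expR (- m%:R)).

Lemma gamma_pdfE m u : (0 < m)%N -> - Num.sqrt m%:R <= u ->
  gamma_pdf m u = gamma_scale m * gamma_fun m u.
Proof.
move=> m0 su; rewrite /gamma_pdf /gamma_scale /gamma_fun su.
set s := Num.sqrt _.
have s0 : 0 < s by rewrite sqrtr_gt0 ltr0n.
have ss : s * s = m%:R by rewrite -expr2 sqr_sqrtr.
have -> : m%:R + u * s = m%:R * (1 + u / s).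
  by rewrite -ss; field; rewrite gt_eqF.
rewrite exprMn -/s.
have -> : m%:R * (1 + u / s) = m%:R + u * s.
  by rewrite -ss; field; rewrite gt_eqF.
rewrite opprD expRD; ring.
Qed.

Lemma gamma_funE m u : (0 < m)%N -> - Num.sqrt m%:R < u ->
  gamma_fun m u =
    expR (m%:R * (ln (1 + u / Num.sqrt m%:R) - u / Num.sqrt m%:R)).
Proof.
move=> m0 su; rewrite /gamma_fun (ltW su).
set s := Num.sqrt _.
have s0 : 0 < s by rewrite sqrtr_gt0 ltr0n.
have ss : s * s = m%:R by rewrite -expr2 sqr_sqrtr.
rewrite mulrBr expRD expRM_natl lnK; last first.
  by rewrite posrE -ltrBlDl sub0r ltr_pdivlMr// mulN1r.
by congr (_ * expR (- _)); rewrite -ss; field; rewrite gt_eqF.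
Qed.

Lemma gamma_fun_ge0 m u : 0 <= gamma_fun m u.
Proof.
rewrite /gamma_fun; case: ifPn => // su.
have [->|m0] := posnP m.
  by rewrite expr0 mul1r expR_ge0.
have s0 : 0 < Num.sqrt m%:R :> R by rewrite sqrtr_gt0 ltr0n.
rewrite mulr_ge0 ?expR_ge0// exprn_ge0// -lerBlDl sub0r.
by rewrite ler_pdivlMr// mulN1r.
Qed.

(** A majorant independent of [m], for dominated convergence. On the right the logarithm gives the
    exponent [- u ^ 2 / (2 * (1 + u))], and [(1 - u) / 2] comes from [- u ^ 2 <= (1 - u) * (1 + u)];
    on the left a Gaussian exponent is available. *)
Lemma gamma_fun_le m u : (0 < m)%N -> gamma_fun m u <= expR ((1 - `|u|) / 2).
Proof.
move=> m0; have := @gamma_funE m u m0; rewrite /gamma_fun.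
set s := Num.sqrt _.
have s0 : 0 < s by rewrite sqrtr_gt0 ltr0n.
have s1 : 1 <= s by rewrite -(@sqrtr1 R) ler_psqrt ?qualifE/= ?ler1n.
have ss : s * s = m%:R by rewrite -expr2 sqr_sqrtr.
case: ifPn => [|_ _]; last exact: expR_ge0.
rewrite le_eqVlt => /predU1P[<- _|su /(_ su) ->].
  by rewrite mulNr divff ?gt_eqF// subrr expr0n gtn_eqF//= mul0r expR_ge0.
rewrite ler_expR.
set x := u / s; have ux : u = x * s by rewrite /x divfK// gt_eqF.
have x1 : -1 < x by rewrite /x ltr_pdivlMr// mulN1r.
have [u0|u0] := leP 0 u.
  have x0 : 0 <= x by rewrite divr_ge0// ltW.
  rewrite ger0_norm//.
  have /andP[_ lnx] := ln1Dx_ge0_bounds x0.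
  apply: (@le_trans _ _ (- (u ^+ 2 / (2 * (1 + u))))).
    apply: (@le_trans _ _ (- (m%:R * (x ^+ 2 / (2 * (1 + x)))))).
      by rewrite -[leRHS]mulrN ler_wpM2l//; lra.
    rewrite lerN2 ux -ss (_ : s * s * _ = (x * s) ^+ 2 / (2 * (1 + x))); last first.
      by field; rewrite gt_eqF//; lra.
    apply: ler_wpM2l; first exact: sqr_ge0.
    rewrite lef_pV2 ?posrE ?mulr_gt0//; [|by nra|by nra].
    by rewrite ler_pM2l// lerD2l ler_peMr.
  rewrite -mulNr ler_pdivrMr; last by lra.
  nra.
rewrite ltr0_norm// opprK.
have x0 : -1 < x <= 0 by rewrite x1/= /x pmulr_lle0 ?invr_gt0// ltW.
have /andP[_ lnx] := ln1Dx_le0_bounds x0.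
apply: (@le_trans _ _ (- (u ^+ 2 / 2))); last by nra.
apply: (@le_trans _ _ (- (m%:R * (x ^+ 2 / 2)))).
  by rewrite -[leRHS]mulrN ler_wpM2l//; lra.
by rewrite lerN2 ux -ss; lra.
Qed.

Lemma cvg_sqrtr_natr : Num.sqrt m%:R @[m --> \oo] --> (+oo : set_system R).
Proof.
apply/cvgryPge => A; near=> m.
rewrite (le_trans (ler_norm A))// -sqrtr_sqr ler_psqrt ?qualifE/= ?sqr_ge0//.
by near: m; apply: nbhs_infty_ger.
Unshelve. all: end_near. Qed.

(** With [x = u / sqrt m] one has [m * x ^ 2 = u ^ 2], so the two bounds for [ln (1 + x)] put the
    exponent as close to its limit as [u ^ 2 / (2 * (1 + x))] is to [u ^ 2 / 2]. *)
Lemma cvg_gamma_fun u : gamma_fun m u @[m --> \oo] --> expR (- (u ^+ 2 / 2)).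
Proof.
pose s m : R := Num.sqrt m%:R.
have xc : 1 + u / s m @[m --> \oo] --> (1 : R).
  rewrite -[X in _ --> X]addr0; apply: cvgD; first exact: cvg_cst.
  rewrite -(mulr0 u); apply: cvgM; first exact: cvg_cst.
  by apply/gtr0_cvgV0; [near=> m; rewrite sqrtr_gt0 ltr0n; near: m;
    exact: nbhs_infty_gt|exact: cvg_sqrtr_natr].
have su : \forall m \near \oo, - s m < u.
  near=> m; rewrite ltrNl.
  by near: m; have /cvgryPgt := cvg_sqrtr_natr; apply.
have ec : m%:R * (ln (1 + u / s m) - u / s m) @[m --> \oo] --> - (u ^+ 2 / 2).
  have Dc : u ^+ 2 / 2 - u ^+ 2 / (2 * (1 + u / s m)) @[m --> \oo] --> (0 : R).
    rewrite [X in _ --> X](_ : _ = u ^+ 2 / 2 - u ^+ 2 / (2 * 1)); last by lra.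
    apply: cvgB; first exact: cvg_cst.
    apply: cvgM; first exact: cvg_cst.
    apply: cvgV; first by rewrite mulr1.
    by apply: cvgM; first exact: cvg_cst.
  apply/subr_cvg0/cvgr0Pnorm_le => e e0; near=> m.
  apply: (@le_trans _ _ `|u ^+ 2 / 2 - u ^+ 2 / (2 * (1 + u / s m))|); last first.
    by near: m; apply: cvgr0_norm_le.
  have m0 : (0 < m)%N by near: m; exact: nbhs_infty_gt.
  have sm : - s m < u by near: m.
  have s0 : 0 < s m by rewrite sqrtr_gt0 ltr0n.
  have ss : s m * s m = m%:R by rewrite -expr2 sqr_sqrtr.
  set x := u / s m; have ux : u = x * s m by rewrite /x divfK// gt_eqF.
  have x1 : -1 < x by rewrite /x ltr_pdivlMr// mulN1r.
  have -> : u ^+ 2 / 2 - u ^+ 2 / (2 * (1 + x)) =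
      m%:R * (x ^+ 2 / 2 - x ^+ 2 / (2 * (1 + x))).
    by rewrite ux -ss; field; rewrite gt_eqF//; lra.
  have -> : m%:R * (ln (1 + x) - x) - - (u ^+ 2 / 2) =
      m%:R * (ln (1 + x) - x + x ^+ 2 / 2).
    by rewrite ux -ss; field.
  rewrite !normrM ler_wpM2l//.
  have [x0|/ltW x0] := leP 0 x.
    have /andP[l1 l2] := ln1Dx_ge0_bounds x0.
    by rewrite !ger0_norm; lra.
  have x10 : -1 < x <= 0 by rewrite x1.
  have /andP[l1 l2] := ln1Dx_le0_bounds x10.
  by rewrite !ler0_norm; lra.
have := cvg_comp _ _ ec (@continuous_expR R _).
apply: cvg_trans.
apply: near_eq_cvg; near=> m.
rewrite /= gamma_funE//; first by near: m; exact: nbhs_infty_gt.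
by near: m.
Unshelve. all: end_near. Qed.

End poisson_clt.

(** * The central limit theorem by dominated convergence *)

Section poisson_clt_normal.
Variable R : realType.
Implicit Types (l u z : R) (m : nat).
Notation mu := (@lebesgue_measure R).

Let dom u : R := expR ((1 - `|u|) / 2).

Let continuous_dom : continuous dom.
Proof.
move=> u; apply: (cvg_comp _ expR); last exact: continuous_expR.
apply: cvgM; last exact: cvg_cst.
by apply: cvgB; [exact: cvg_cst|exact: norm_continuous].
Qed.

Let integrable_dom : mu.-integrable setT (EFin \o dom).
Proof.
apply/integrableP; split.
  by apply/measurable_EFinP; exact: continuous_measurable_fun.
under eq_integral do rewrite /= ger0_norm ?expR_ge0//.
rewrite (@ge0_symfun_integralT _ dom) //; last 2 first.
  by move=> x; exact: expR_ge0.
  by move=> x; rewrite /dom /= normrN.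
rewrite -set_itvcy.
rewrite [X in (_ * X)%E](_ : _ =
  \int[mu]_(x in `[0%R, +oo[) (expR ((1 - x) / 2))%:E)%E; last first.
  by apply: eq_integral => x; rewrite inE/= in_itv/= andbT => x0; rewrite /dom ger0_norm.
have dF (x : R) : is_derive x 1 (fun x : R => - 2 * expR ((1 - x) / 2))
    (expR ((1 - x) / 2)).
  by apply: is_derive_eq; rewrite /GRing.scale/=; field.
have cF (x : R) : (fun x : R => expR ((1 - x) / 2)) @ x --> expR ((1 - x) / 2).
  apply: (cvg_comp _ expR); last exact: continuous_expR.
  apply: cvgM; last exact: cvg_cst.
  by apply: cvgB; [exact: cvg_cst|exact: cvg_id].
rewrite (@ge0_continuous_FTC2y _ _ (fun x : R => - 2 * expR ((1 - x) / 2)) 0 0).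
- by rewrite -EFinB -EFinM ltry.
- by move=> x _; exact: expR_ge0.
- exact: continuous_subspaceT.
- rewrite -(mulr0 (- 2)); apply: cvgM; first exact: cvg_cst.
  rewrite (_ : (fun x : R => _) = (fun x : R => expR (- ((x - 1) / 2)))); last first.
    by apply/funext => x; rewrite -mulNr opprB.
  apply: (@cvg_comp _ _ _ (fun x : R => (x - 1) / 2) (fun y => expR (- y))
    _ +oo) => //; last exact: cvgr_expR.
  + apply/cvgryPge => A; near=> x.
    rewrite ler_pdivlMr// lerBrDr; near: x.
    by apply: nbhs_pinfty_ge; rewrite num_real.
- by move=> x _; have [] := dF x.
- by apply: cvg_at_right_filter; apply: cvgM; [exact: cvg_cst|exact: cF].
- by move=> x _; rewrite derive1E; have [] := dF x.
Unshelve. all: end_near. Qed.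

Let measurable_gamma_fun m : measurable_fun setT (gamma_fun m : R -> R).
Proof.
apply: measurable_fun_if => //.
- exact: measurable_fun_ler.
- apply: measurable_funTS; apply: measurable_funM; last first.
    by apply: measurableT_comp => //; apply: measurableT_comp => //; exact: measurable_funM.
  by apply: measurable_funX; apply: measurable_funD => //; exact: measurable_funM.
Qed.

Let gauss u : R := expR (- (u ^+ 2 / 2)).

Let integrable_gauss D : measurable D -> mu.-integrable D (EFin \o gauss).
Proof.
move=> mD; apply: (integrableS measurableT) => //.
apply: (@le_integrable _ _ _ mu _ _ _ (EFin \o dom)) => //.
- apply/measurable_EFinP/measurable_funTS.
  apply: measurableT_comp => //; apply: measurableT_comp => //.
  by apply: measurable_funM => //; exact: measurable_funX.
- move=> u _; rewrite /= lee_fin !ger0_norm ?expR_ge0// ler_expR.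
  rewrite -real_normK ?num_real//; have := normr_ge0 u; nra.
Qed.

Let integral_gamma_fun_fin_num m D : measurable D ->
  (\int[mu]_(u in D) (gamma_fun m.+1 u)%:E)%E \is a fin_num.
Proof.
move=> mD; apply: integrable_fin_num => //.
apply: (integrableS measurableT) => //.
apply: (@le_integrable _ _ _ mu _ _ _ (EFin \o dom)) => //.
- by apply/measurable_EFinP/measurable_funTS; exact: measurable_gamma_fun.
- move=> u _; rewrite /= lee_fin !ger0_norm ?expR_ge0 ?gamma_fun_ge0//.
  exact: gamma_fun_le.
Qed.

Let integralZgamma m z : - Num.sqrt m.+1%:R <= z ->
  (\int[mu]_(u in `[z, +oo[) (gamma_pdf m.+1 u)%:E =
  (gamma_scale R m.+1)%:E * \int[mu]_(u in `[z, +oo[) (gamma_fun m.+1 u)%:E)%E.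
Proof.
move=> sz; rewrite -ge0_integralZl//.
- apply: eq_integral => u; rewrite inE/= in_itv/= andbT => zu.
  by rewrite -EFinM gamma_pdfE// (le_trans sz).
- by apply/measurable_EFinP/measurable_funTS; exact: measurable_gamma_fun.
- by move=> u _; rewrite lee_fin gamma_fun_ge0.
- by rewrite lee_fin /gamma_scale !mulr_ge0 ?expR_ge0.
Qed.

Let cvg_integral_gamma_fun D : measurable D ->
  fine (\int[mu]_(u in D) (gamma_fun m.+1 u)%:E) @[m --> \oo] -->
  fine (\int[mu]_(u in D) (gauss u)%:E).
Proof.
move=> mD.
have [| | | | |ig _] := @dominated_convergence _ _ R mu D mD
  (fun m u => (gamma_fun m.+1 u)%:E) (fun u => (gauss u)%:E) (EFin \o dom).
- by move=> m; apply/measurable_EFinP/measurable_funTS; exact: measurable_gamma_fun.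
- apply/measurable_EFinP/measurable_funTS.
  apply: measurableT_comp => //; apply: measurableT_comp => //.
  by apply: measurable_funM => //; exact: measurable_funX.
- apply: aeW => u _; apply: cvg_EFin; first exact: nearW.
  have := @cvg_gamma_fun R u; rewrite -(cvg_shiftS).
  exact.
- exact: (integrableS measurableT).
- apply: aeW => u m _ /=.
  by rewrite lee_fin ger0_norm ?gamma_fun_ge0 ?gamma_fun_le.
- move=> h; apply: fine_cvg; rewrite fineK //.
  exact: integrable_fin_num.
Qed.

(** Dominated convergence gives the limits of the integrals of [gamma_fun] over the half-line and
    over the whole line. The latter, times [gamma_scale], is a total mass equal to 1, so
    [gamma_scale] tends to [normal_peak 1] without any estimate of factorials. *)
Lemma cvg_poisson_cdf z :
  poisson_cdf (m.+1%:R + z * Num.sqrt m.+1%:R) m.+1 @[m --> \oo] -->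
  fine (normal_prob 0 1 `[z, +oo[).
Proof.
have pk0 : 0 < normal_peak 1 :> R by exact: normal_peak_gt0.
have gaussE D : measurable D ->
    fine (\int[mu]_(u in D) (gauss u)%:E) = fine (normal_prob 0 1 D) / normal_peak 1.
  move=> mD; rewrite /normal_prob normal_pdfE//.
  under [in RHS]eq_integral do rewrite EFinM.
  rewrite ge0_integralZl//=; last 3 first.
  - apply/measurable_EFinP; apply: measurable_funTS; exact: measurable_normal_fun.
  - by move=> x _; rewrite lee_fin normal_fun_ge0.
  - by rewrite lee_fin ltW.
  rewrite [X in fine (_ * X)%E](_ : _ = \int[mu]_(u in D) (gauss u)%:E)%E; last first.
    by apply: eq_integral => x _; rewrite /normal_fun /gauss subr0 expr1n mulNr.
  have : mu.-integrable D (fun u => (gauss u)%:E) by exact: integrable_gauss.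
  move=> /(integrable_fin_num mD) fg.
  by rewrite fineM//= mulrAC divff ?mul1r ?gt_eqF.
have cz := cvg_integral_gamma_fun (measurable_itv `[z, +oo[).
have cT := cvg_integral_gamma_fun measurableT.
rewrite !gaussE// in cz cT.
have PT : fine (@normal_prob R 0 1 setT) = 1.
  by have := @probability_setT _ _ R (@normal_prob R 0 1) => ->.
rewrite PT mul1r in cT.
have cc : gamma_scale R m.+1 @[m --> \oo] --> normal_peak (1 : R).
  rewrite -[X in _ --> X]invrK.
  have nz : (normal_peak 1 : R)^-1 != 0 by rewrite invr_eq0 gt_eqF.
  have := cvgV nz cT; move=> /(_ _).
  apply: cvg_trans; apply: near_eq_cvg; near=> m => /=.
  pose s : R := Num.sqrt m.+1%:R.
  have := @integral_gamma_pdf R m.+1 (- Num.sqrt m.+1%:R) isT (lexx _).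
  rewrite mulNr -expr2 sqr_sqrtr// subrr.
  rewrite (_ : poisson_cdf 0 _ = 1); last first.
    rewrite /poisson_cdf big_ord_recl/= oppr0 expR0 expr0 fact0 divr1 mulr1.
    by rewrite big1 ?addr0// => j _; rewrite exprS !mul0r.
  rewrite (integralZgamma (lexx _)) => h.
  rewrite (_ : (\int[mu]_u (gamma_fun m.+1 u)%:E)%E =
    (\int[mu]_(u in `[(- s)%R, +oo[) (gamma_fun m.+1 u)%:E)%E); last first.
    rewrite [RHS]integral_mkcond; apply: eq_integral => u _.
    rewrite patchE; case: ifPn => //; rewrite notin_setE/= in_itv/= andbT => su.
    by rewrite /gamma_fun (negbTE (introN idP su)).
  move: h; rewrite -[X in (_ * X)%E]fineK ?integral_gamma_fun_fin_num//.
  rewrite -EFinM => -[] h.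
  apply: (mulIf (x := fine (\int[mu]_(u in `[(- s)%R, +oo[) (gamma_fun m.+1 u)%:E))).
    by apply/eqP => h0; move: h; rewrite h0 mulr0 => /esym/eqP; rewrite oner_eq0.
  rewrite h mulVf//.
  by apply/eqP => h0; move: h; rewrite h0 mulr0 => /esym/eqP; rewrite oner_eq0.
rewrite [X in _ --> X](_ : _ =
    normal_peak 1 * (fine (normal_prob 0 1 `[z, +oo[) / normal_peak 1)); last first.
  by rewrite mulrCA divff ?mulr1// gt_eqF.
have := cvgM cc cz; move=> /(_ _).
apply: cvg_trans; apply: near_eq_cvg; near=> m => /=.
have sz : - Num.sqrt m.+1%:R <= z.
  rewrite lerNl; near: m.
  have := @cvg_sqrtr_natr R; rewrite -cvg_shiftS => /cvgryPge; exact.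
apply: EFin_inj; rewrite EFinM fineK ?integral_gamma_fun_fin_num//.
by rewrite -integralZgamma// integral_gamma_pdf.
Unshelve. all: end_near. Qed.

End poisson_clt_normal.

(** * The normal distribution function *)

Section normal_cdf.
Variable R : realType.
Implicit Types x y : R.
Notation mu := (@lebesgue_measure R).

Definition Phi x : R := fine (normal_prob 0 1 `]-oo, x]).

Let Phi_fin_num (A : set R) : measurable A -> normal_prob 0 1 A \is a fin_num.
Proof. by move=> mA; apply: (@fin_num_measure _ _ _ (normal_prob (0 : R) 1)). Qed.

Lemma PhiB x y : x <= y -> Phi y - Phi x = fine (normal_prob 0 1 `]x, y]).
Proof.
move=> xy; rewrite /Phi (_ : `]-oo, y]%classic = `]-oo, x] `|` `]x, y]); last first.
  by rewrite -itv_bndbnd_setU.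
rewrite measureU//=; last first.
  apply/seteqP; split => // z [] /=; rewrite !in_itv/= => zx /andP[xz _].
  by move: (lt_le_trans xz zx); rewrite ltxx.
by rewrite fineD ?Phi_fin_num// addrAC subrr add0r.
Qed.

Lemma Phi_le : {homo Phi : x y / x <= y}.
Proof.
by move=> x y xy; rewrite -subr_ge0 PhiB// fine_ge0.
Qed.

Lemma Phi_lipschitz x y : x <= y -> Phi y - Phi x <= normal_peak 1 * (y - x).
Proof.
move=> xy; rewrite PhiB// -lee_fin fineK ?Phi_fin_num// /normal_prob.
apply: (@le_trans _ _ (\int[mu]_(z in `]x, y]) (normal_peak 1)%:E)%E).
  apply: ge0_le_integral => //.
  - by move=> z _; rewrite lee_fin normal_pdf_ge0.
  - by apply/measurable_EFinP/measurable_funTS; exact: measurable_normal_pdf.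
  - by move=> z _; rewrite lee_fin normal_pdf_ub.
rewrite integral_cst//= lebesgue_measure_itv/= lte_fin.
case: ltP => _; first by rewrite -EFinB -EFinM.
by rewrite mule0 lee_fin mulr_ge0 ?normal_peak_ge0// subr_ge0.
Qed.

Lemma Phi_lt : {homo Phi : x y / x < y}.
Proof.
move=> x y xy; rewrite -subr_gt0 PhiB ?ltW//.
(* On []x, y]] one has [z ^ 2 <= x ^ 2 + y ^ 2], so [c] is below the density there. *)
pose c := normal_peak 1 * expR (- (x ^+ 2 + y ^+ 2) / 2).
have c0 : 0 < c by rewrite mulr_gt0 ?expR_gt0 ?normal_peak_gt0.
apply: (@lt_le_trans _ _ (c * (y - x))).
  by rewrite mulr_gt0// subr_gt0.
rewrite -lee_fin fineK ?Phi_fin_num// /normal_prob.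
have -> : (c * (y - x))%:E = (\int[mu]_(z in `]x, y]) c%:E)%E.
  by rewrite integral_cst//= lebesgue_measure_itv/= lte_fin xy -EFinB -EFinM.
apply: ge0_le_integral => //.
- by move=> z _; rewrite lee_fin ltW.
- by apply/measurable_EFinP/measurable_funTS; exact: measurable_normal_pdf.
- move=> z /=; rewrite in_itv/= => /andP[xz zy].
  rewrite lee_fin normal_pdfE// ler_wpM2l ?normal_peak_ge0//.
  rewrite /normal_fun ler_expR subr0 expr1n !mulNr lerN2 ler_pM2r//.
  by have [z0|z0] := leP 0 z; have := sqr_ge0 x; have := sqr_ge0 y; nra.
Qed.

Lemma Phi_ge0 x : 0 <= Phi x.
Proof. by rewrite fine_ge0. Qed.

Lemma Phi_gt0 x : 0 < Phi x.
Proof. by rewrite (le_lt_trans (Phi_ge0 (x - 1)))// Phi_lt// gtrBl. Qed.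

Lemma Phi_le1 x : Phi x <= 1.
Proof. by rewrite -lee_fin fineK ?Phi_fin_num// probability_le1. Qed.

Lemma Phi_setC x : fine (normal_prob 0 1 `[x, +oo[) = 1 - Phi x.
Proof.
have x1 (z : R) : normal_prob 0 1 [set z] = 0%E.
  have /null_content_dominatesP := @normal_prob_dominates R 0 1; apply => //.
  exact: lebesgue_measure_set1.
have := @probability_setT _ _ R (normal_prob 0 1).
rewrite -(itv_setU_setT false x) measureU//=; last first.
  by rewrite -eq_opE; exact: disjoint_rays.
move=> /(congr1 fine); rewrite fineD ?Phi_fin_num//= -/(Phi x) => h.
suff -> : normal_prob 0 1 `[x, +oo[ = normal_prob 0 1 `]x, +oo[ by lra.
rewrite -(setU1itv false)//.
rewrite measureU//=; first by rewrite x1 add0e.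
apply/seteqP; split => // z [] /= ->.
by rewrite in_itv/= ltxx.
Qed.

Lemma continuous_Phi : continuous Phi.
Proof.
have pk0 : 0 < normal_peak 1 :> R by exact: normal_peak_gt0.
move=> x; apply/cvgrPdist_le => e e0; near=> y.
have xy : `|x - y| <= e / normal_peak 1.
  near: y; apply: pseudometric_normed_Zmodule.cvgr_dist_le; first exact: cvg_id.
  by rewrite divr_gt0.
apply: (@le_trans _ _ (normal_peak 1 * `|x - y|)); last first.
  by rewrite mulrC -ler_pdivlMr.
have [xley|/ltW ylex] := leP x y.
  rewrite distrC (distrC x) !ger0_norm ?subr_ge0 ?Phi_le//.
  exact: Phi_lipschitz.
rewrite !ger0_norm ?subr_ge0 ?Phi_le//.
exact: Phi_lipschitz.
Unshelve. all: end_near. Qed.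

Let N01 : probability (measurableTypeR R) R := normal_prob 0 1.

Let idTR : measurableTypeR R -> R := idfun.

#[local] HB.instance Definition _ :=
  @isMeasurableFun.Build _ _ _ _ idTR (@measurable_id _ _ setT).

Lemma cvg_Phi_pinfty : Phi x @[x --> +oo] --> (1 : R).
Proof.
have := @cvg_cdfy1 _ _ _ N01 (idTR : {RV N01 >-> R}).
by move=> /fine_cvg.
Qed.

Lemma cvg_Phi_ninfty : Phi x @[x --> -oo] --> (0 : R).
Proof.
have := @cvg_cdfNy0 _ _ _ N01 (idTR : {RV N01 >-> R}).
by move=> /fine_cvg.
Qed.

End normal_cdf.

(** * Poisson distribution functions along moving arguments *)

Section poisson_cdf_limits.
Variable R : realType.
Implicit Types (l u z : R).

Lemma poisson_cdf_anti m l l' : 0 <= l -> l <= l' ->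
  poisson_cdf l' m <= poisson_cdf l m.
Proof.
move=> l0 ll'; rewrite -lerN2.
have d (x : R) : is_derive x 1 (fun l => - poisson_cdf l m) (x ^+ m / m`!%:R * expR (- x)).
  have := is_derive_poisson_cdf x m => h.
  by apply: is_derive_eq; rewrite opprK.
apply: (@ger0_derive1_ndecr _ (fun l => - poisson_cdf l m) l l') => //.
- move=> x /[!in_itv]/= /andP[lx _]; rewrite derive1E; have [_ ->] := d x.
  by rewrite !mulr_ge0 ?expR_ge0 ?invr_ge0// exprn_ge0// (le_trans l0)// ltW.
- by apply: derivable_within_continuous => x _; have [] := d x.
Qed.

Context {T : Type} (F : set_system T) {FF : Filter F}.

(** Monotonicity in the mean sandwiches the moving [z t] between [z0 - d] and [z0 + d]; continuity
    of [Phi] closes the gap. *)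
Lemma cvg_poisson_cdf_filter (m : T -> nat) (z : T -> R) z0 :
  m @ F --> \oo -> z @ F --> z0 ->
  poisson_cdf ((m t)%:R + z t * Num.sqrt (m t)%:R) (m t) @[t --> F] -->
  1 - Phi z0.
Proof.
move=> moo zz0.
pose G (z : R) (m : nat) : R := poisson_cdf (m%:R + z * Num.sqrt m%:R) m.
have cG z' : G z' (m t) @[t --> F] --> 1 - Phi z'.
  apply: (@cvg_comp _ _ _ m (G z') _ \oo) => //.
  rewrite -cvg_shiftS -Phi_setC; exact: cvg_poisson_cdf.
apply/cvgrPdist_le => e e0.
have e2 : 0 < e / 2 by rewrite divr_gt0.
have [d d0 dP] : exists2 d, 0 < d & forall x, `|z0 - x| <= d -> `|Phi z0 - Phi x| <= e / 2.
  have /cvgrPdist_le/(_ _ e2) := @continuous_Phi R z0.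
  move=> /nbhs_ballP[d /= d0 h]; exists (d / 2); first by rewrite divr_gt0.
  move=> x xd; apply: h; rewrite /ball/= (le_lt_trans xd)//.
  by rewrite ltr_pdivrMr// ltr_pMr// ltr1n.
near=> t.
have zt : `|z0 - z t| <= d.
  by near: t; apply: pseudometric_normed_Zmodule.cvgr_dist_le.
have s_ge : d - z0 <= Num.sqrt (m t)%:R.
  near: t.
  have := cvg_comp _ _ moo (@cvg_sqrtr_natr R) => /cvgryPge; exact.
set s := Num.sqrt _ in s_ge *.
have ss : s * s = (m t)%:R by rewrite -expr2 sqr_sqrtr.
have s0 : 0 <= s by exact: sqrtr_ge0.
have mono x y : z0 - d <= x -> x <= y -> G y (m t) <= G x (m t).
  move=> zx xy; apply: poisson_cdf_anti; rewrite -/s -ss.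
    by rewrite -mulrDl mulr_ge0//; lra.
  by rewrite lerD2l ler_wpM2r.
have hp : `|1 - Phi (z0 + d) - G (z0 + d) (m t)| <= e / 2.
  by near: t; apply: pseudometric_normed_Zmodule.cvgr_dist_le => //; exact: cG.
have hm : `|1 - Phi (z0 - d) - G (z0 - d) (m t)| <= e / 2.
  by near: t; apply: pseudometric_normed_Zmodule.cvgr_dist_le => //; exact: cG.
have p1 := dP (z0 + d); have p2 := dP (z0 - d).
rewrite -/(G _ _).
move: zt; rewrite ler_distlC => /andP[z1 z2].
have g1 := mono _ _ z1 (lexx _).
have {}g1 : G (z t) (m t) <= G (z0 - d) (m t) by apply: mono => //; lra.
have g2 : G (z0 + d) (m t) <= G (z t) (m t) by apply: mono => //; lra.
move: p1 p2 hp hm; rewrite opprD opprB addNKr addrCA subrr addr0 normrN gtr0_norm//.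
move=> /(_ (lexx _)) p1 /(_ (lexx _)) p2.
rewrite !ler_norml in p1 p2 * => /andP[? ?] /andP[? ?].
move: p1 p2 => /andP[? ?] /andP[? ?].
by apply/andP; split; lra.
Unshelve. all: end_near. Qed.

(** Reaching [tok] hits is the complement of having at most [tok - 1], whence the predecessor. A
    Poisson count of about [p * n] hits deviates by about [sqrt (p * n)], which leaves [sqrt p] in
    the denominator. *)
Lemma cvg_poisson_tail (n tok : T -> nat) (a : T -> R) (p s a0 : R) : 0 < p ->
  n @ F --> \oo -> a @ F --> a0 ->
  (\forall t \near F, (tok t)%:R = p * (n t)%:R + a t * Num.sqrt (n t)%:R) ->
  1 - poisson_cdf (p * ((n t)%:R + s * Num.sqrt (n t)%:R)) (tok t).-1 @[t --> F]
  --> Phi ((p * s - a0) / Num.sqrt p).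
Proof.
move=> p0 noo aa0 tokE.
pose r t : R := Num.sqrt (n t)%:R.
have roo : r @ F --> +oo by exact: cvg_comp noo (@cvg_sqrtr_natr R).
have rV : (r t)^-1 @[t --> F] --> (0 : R).
  apply/gtr0_cvgV0 => //; near=> t; near: t.
  by move/cvgryPgt : roo; apply.
(* [(tok t - 1) / n], written so as to make its limit visible *)
pose b t := p + a t * (r t)^-1 - (r t)^-1 * (r t)^-1.
have bp : b @ F --> p.
  rewrite -[X in _ --> X](_ : p + a0 * 0 - 0 * 0 = p); last by rewrite mulr0 addr0 mul0r subr0.
  apply: cvgB; last exact: cvgM.
  by apply: cvgD; [exact: cvg_cst|exact: cvgM].
have mb : \forall t \near F, ((tok t).-1)%:R = b t * r t ^+ 2 /\ 0 < r t.
  near=> t.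
  have r0 : 0 < r t by near: t; move/cvgryPgt : roo; apply.
  have r1 : p * r t ^+ 2 + a t * r t > 0.
    rewrite (_ : _ + _ = (p * r t + a t) * r t); last by ring.
    rewrite mulr_gt0//.
    have a1 : `|a0 - a t| <= 1 by near: t; apply: pseudometric_normed_Zmodule.cvgr_dist_le.
    have rb : (1 - a0) / p < r t by near: t; move/cvgryPgt : roo; apply.
    move: rb; rewrite ltr_pdivrMr// => rb.
    move: a1; rewrite ler_distlC => /andP[? ?]; lra.
  have te : (tok t)%:R = p * r t ^+ 2 + a t * r t.
    by rewrite sqr_sqrtr//; near: t.
  have tok0 : (0 < tok t)%N by rewrite -(@ltr_nat R) te.
  split => //.
  rewrite -subn1 natrB// te /b.
  by field; rewrite gt_eqF.
have m_oo : (tok t).-1 @[t --> F] --> \oo.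
  apply/(@cvgrnyP R)/cvgryPge => A; near=> t.
  have [-> r0] : ((tok t).-1)%:R = b t * r t ^+ 2 /\ 0 < r t by near: t.
  have b1 : p / 2 <= b t.
    near: t; apply: (cvgr_ge p) => //.
    by rewrite ltr_pdivrMr// ltr_pMr// ltr1n.
  have r1 : 1 <= r t by near: t; move/cvgryPge : roo; apply.
  have r2 : A / (p / 2) <= r t by near: t; move/cvgryPge : roo; apply.
  move: r2; rewrite ler_pdivrMr ?divr_gt0// => r2.
  apply: (le_trans r2).
  rewrite mulrC; apply: ler_pM => //; first by rewrite divr_ge0// ltW.
    exact: ltW.
  by rewrite expr2 ler_peMr// ltW.
(* Solves [p * (n + s * r) = m + z * sqrt m] for [m = tok - 1 = b * r ^ 2]; the summand [1 / r]
   comes from the predecessor. *)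
pose z t := (p * s - a t + (r t)^-1) / Num.sqrt (b t).
have zc : z @ F --> (p * s - a0) / Num.sqrt p.
  rewrite -[p * s - a0]addr0.
  apply: cvgM.
    by apply: cvgD => //; apply: cvgB => //; exact: cvg_cst.
  apply: cvgV; first by rewrite gt_eqF// sqrtr_gt0.
  exact: (cvg_comp _ _ bp (@sqrt_continuous R p)).
rewrite -[X in _ --> X](_ : 1 - (1 - Phi ((p * s - a0) / Num.sqrt p)) = _); last by lra.
apply: cvgB; first exact: cvg_cst.
have := cvg_poisson_cdf_filter m_oo zc.
apply: cvg_trans; apply: near_eq_cvg; near=> t.
have [-> r0] : ((tok t).-1)%:R = b t * r t ^+ 2 /\ 0 < r t by near: t.
have b0 : 0 < b t by near: t; apply: (cvgr_gt p).
congr poisson_cdf.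
rewrite sqrtrM ?ltW// sqrtr_sqr gtr0_norm//.
rewrite -/(r t) /z.
rewrite -[X in p * (X + _)](_ : r t ^+ 2 = _); last by rewrite sqr_sqrtr.
have sb : Num.sqrt (b t) != 0 by rewrite gt_eqF// sqrtr_gt0.
rewrite [X in _ + X = _]mulrA divfK// /b.
by field; rewrite gt_eqF.
Unshelve. all: end_near. Qed.

End poisson_cdf_limits.

(** * Races and the last side to finish *)

Section fine_probability.
Context d (T : measurableType d) (R : realType) (P : probability T R).
Implicit Types A B : set T.

Lemma fine_prob_le A B : measurable A -> measurable B -> A `<=` B ->
  fine (P A) <= fine (P B).
Proof.
move=> mA mB AB; rewrite fine_le ?fin_num_measure//.
by apply: le_measure; rewrite ?inE.
Qed.

Lemma fine_prob_le1 A : measurable A -> fine (P A) <= 1.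
Proof. by move=> mA; rewrite -lee_fin fineK ?fin_num_measure// probability_le1. Qed.

Lemma fine_prob_setC A : measurable A -> fine (P (~` A)) = 1 - fine (P A).
Proof.
move=> mA; rewrite probability_setC//.
by rewrite -{1}(fineK (fin_num_measure P _ mA)) -EFinB.
Qed.

Lemma sum_fine_prob_le n (Q : {pred 'I_n}) (A : 'I_n -> set T) B :
  (forall i, measurable (A i)) -> measurable B -> trivIset setT A ->
  (forall i, Q i -> A i `<=` B) ->
  \sum_(i < n | Q i) fine (P (A i)) <= fine (P B).
Proof.
move=> mA mB tA AB.
rewrite -lee_fin -sumEFin fineK ?fin_num_measure//.
rewrite (eq_bigr (fun i => P (A i))); last first.
  by move=> i _; rewrite fineK// fin_num_measure.
rewrite -measure_bigsetU_ord//; apply: le_measure; rewrite ?inE//.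
  exact: bigsetU_measurable.
by apply: (big_ind (fun S => S `<=` B)) => // S S' SB S'B; rewrite subUset.
Qed.

Lemma fine_probU_le A B : measurable A -> measurable B ->
  fine (P (A `|` B)) <= fine (P A) + fine (P B).
Proof.
move=> mA mB; rewrite -lee_fin EFinD !fineK ?fin_num_measure//; last exact: measurableU.
exact: measureU2.
Qed.

Lemma fine_prob_le_sum n (A : 'I_n -> set T) B :
  (forall i, measurable (A i)) -> measurable B ->
  (forall w, B w -> exists i, A i w) ->
  fine (P B) <= \sum_(i < n) fine (P (A i)).
Proof.
move=> mA mB AB.
apply: (@le_trans _ _ (fine (P (\big[setU/set0]_(i < n) A i)))).
  apply: fine_prob_le => //; first exact: bigsetU_measurable.
  by move=> w /AB[i iw]; rewrite (bigD1 i)//=; left.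
suff [] : measurable (\big[setU/set0]_(i < n) A i) /\
  fine (P (\big[setU/set0]_(i < n) A i)) <= \sum_(i < n) fine (P (A i)) by [].
apply: (big_ind2 (fun S r => measurable S /\ fine (P S) <= r)) => //.
- by rewrite measure0.
- move=> S r S' r' [mS Sr] [mS' Sr']; split; first exact: measurableU.
  by rewrite (le_trans (fine_probU_le _ _))// lerD.
Qed.

End fine_probability.

Section race.
Context d (T : measurableType d) (R : realType) (P : probability T R).
Local Notation pr A := (fine (P A)).

Lemma race_payoffE (S S' : T -> \bar R) :
  race_payoff P S S' =
  2^-1 * (pr [set w | (S w < S' w)%E] - pr [set w | (S' w < S w)%E]).
Proof.
rewrite /race_payoff /pr_beats; congr (_ * _).
rewrite (_ : [set w | S' w = S w] = [set w | S w = S' w]); last first.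
  by apply/seteqP; split => w /= ->.
lra.
Qed.

Lemma race_payoff_anti (S S' : T -> \bar R) :
  race_payoff P S S' = - race_payoff P S' S.
Proof. rewrite !race_payoffE; lra. Qed.

Lemma measurable_ltS (S S' : T -> \bar R) : measurable_fun setT S ->
  measurable_fun setT S' -> measurable [set w | (S w < S' w)%E].
Proof.
by move=> mS mS'; rewrite -[X in measurable X]setTI; exact: measurable_lte.
Qed.

Lemma race_payoff_bound (S S' : T -> \bar R) :
  measurable_fun setT S -> measurable_fun setT S' -> `|race_payoff P S S'| <= 1.
Proof.
move=> mS mS'; rewrite race_payoffE.
have := fine_prob_le1 P (measurable_ltS mS mS').
have := fine_prob_le1 P (measurable_ltS mS' mS).
have h1 : 0 <= pr [set w | (S w < S' w)%E] by exact: fine_ge0.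
have h2 : 0 <= pr [set w | (S' w < S w)%E] by exact: fine_ge0.
move=> h3 h4; rewrite ler_norml; lra.
Qed.

Variable k : nat.
Implicit Types (M tx ty : 'I_k -> T -> \bar R).

(** Finiteness is part of the event because a hitting time is [+oo] when its level is never reached,
    and different token numbers may then give equal times. *)
Definition strict_last M (i : 'I_k) : set T :=
  [set w | (M i w < +oo)%E /\ forall j, j != i -> (M j w < M i w)%E].

Lemma measurable_strict_last M i : (forall j, measurable_fun setT (M j)) ->
  measurable (strict_last M i).
Proof.
move=> mM; rewrite (_ : strict_last M i =
  [set w | (M i w < +oo)%E] `&`
  \bigcap_(j in [set` [pred j | j != i]]) [set w | (M j w < M i w)%E]).
  apply: measurableI.
    by apply: (measurable_ltS (S' := cst +oo%E)) => //; exact: measurable_cst.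
  apply: fin_bigcap_measurable => [|j _]; first exact: finite_finset.
  exact: measurable_ltS.
apply/seteqP; split => w /= [w1 w2]; split => // j; exact: w2.
Qed.

Lemma trivIset_strict_last M : trivIset setT (strict_last M).
Proof.
apply/trivIsetP => i j _ _ ij; apply/seteqP; split => // w [[_ wi] [_ wj]].
have := wi j; rewrite eq_sym => /(_ ij) ji; have := lt_trans ji (wj _ ij).
by rewrite ltxx.
Qed.

Lemma sum_strict_last_le1 M : (forall j, measurable_fun setT (M j)) ->
  \sum_(i < k) pr (strict_last M i) <= 1.
Proof.
move=> mM; rewrite -[leRHS](_ : pr setT = 1); last by rewrite probability_setT.
apply: (@sum_fine_prob_le _ _ _ _ _ xpredT) => //.
- by move=> i; exact: measurable_strict_last.
- exact: trivIset_strict_last.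
Qed.

(** [limit_time] and [clearance_time] are both convertible to instances of this maximum, so one race
    lemma serves the two games. *)
Definition last_time tx (w : T) : \bar R := \big[maxe/-oo%E]_(i < k) tx i w.

Lemma measurable_last_time tx : (forall j, measurable_fun setT (tx j)) ->
  measurable_fun setT (last_time tx).
Proof.
move=> mt; rewrite /last_time.
elim: (index_enum _) => [|i s IH].
  by under eq_fun do rewrite big_nil; exact: measurable_cst.
under eq_fun do rewrite big_cons.
exact: measurable_maxe.
Qed.

(* Whoever placed fewer tokens on the last side to finish wins the race. *)
Lemma race_payoff_approx tx ty (s q : 'I_k -> R) (N : set T) :
  (forall i, q i = pr (strict_last (fun j w => maxe (tx j w) (ty j w)) i)) ->
  (forall j, measurable_fun setT (tx j)) ->
  (forall j, measurable_fun setT (ty j)) ->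
  measurable N -> P N = 0%E ->
  (forall i w, s i = 0 -> tx i w = ty i w) ->
  (forall i w, 0 < s i -> (tx i w <= ty i w)%E /\
     (~ N w -> (ty i w < +oo)%E -> (tx i w < ty i w)%E)) ->
  (forall i w, s i < 0 -> (ty i w <= tx i w)%E /\
     (~ N w -> (tx i w < +oo)%E -> (ty i w < tx i w)%E)) ->
  `|2 * race_payoff P (last_time tx) (last_time ty) -
    \sum_(i < k) Num.sg (s i) * q i| <= 1 - \sum_(i < k) q i.
Proof.
move=> qE mtx mty mN N0 s0 sp sn.
pose M j w := maxe (tx j w) (ty j w).
have mM j : measurable_fun setT (M j) by exact: measurable_maxe.
pose W i := strict_last M i `\` N.
have mW i : measurable (W i) by apply: measurableD => //; exact: measurable_strict_last.
have PW i : pr (W i) = q i.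
  have mi := measurable_strict_last i mM.
  rewrite qE [in RHS](measureDI _ mi mN) [X in fine (_ + X)](_ : _ = 0%E) ?adde0//.
  apply/eqP; rewrite eq_le measure_ge0 andbT -N0.
  by apply: le_measure; rewrite ?inE//; exact: measurableI.
have tW : trivIset setT W.
  apply/trivIsetP => i j iT jT ij; apply/seteqP; split => // w [[wi _] [wj _]].
  by have /trivIsetP/(_ i j iT jT ij) <- := @trivIset_strict_last M.
have mSx := measurable_last_time mtx.
have mSy := measurable_last_time mty.
have Wlt (a b : 'I_k -> T -> \bar R) i w : strict_last M i w ->
    (forall j, (a j w <= M j w)%E) -> M i w = b i w -> (a i w < b i w)%E ->
    (last_time a w < last_time b w)%E.
  move=> [_ Wi] aM Mb ab; apply: (@lt_le_trans _ _ (b i w)); last first.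
    exact: le_bigmax.
  apply/bigmax_ltP; split; first by rewrite (le_lt_trans _ ab)// leNye.
  move=> j _; have [->//|ji] := eqVneq j i.
  by rewrite (le_lt_trans (aM j))// -Mb Wi.
have aM j w : (tx j w <= M j w)%E by rewrite /M le_max lexx.
have bM j w : (ty j w <= M j w)%E by rewrite /M le_max lexx orbT.
pose lt := [set w | (last_time tx w < last_time ty w)%E].
pose gt := [set w | (last_time ty w < last_time tx w)%E].
pose eq := ~` (lt `|` gt).
have mlt : measurable lt by exact: measurable_ltS.
have mgt : measurable gt by exact: measurable_ltS.
have meq : measurable eq by apply: measurableC; exact: measurableU.
have h1 : \sum_(i < k | 0 < s i) q i <= pr lt.
  rewrite -(eq_bigr _ (fun i _ => PW i)); apply: sum_fine_prob_le => // i si w [Wi Nw].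
  have [le /(_ Nw) lt_] := sp i w si.
  have Mty : M i w = ty i w by apply/max_idPr.
  apply: (Wlt tx ty i) => //; apply: lt_.
  by rewrite -Mty; case: Wi.
have h2 : \sum_(i < k | s i < 0) q i <= pr gt.
  rewrite -(eq_bigr _ (fun i _ => PW i)); apply: sum_fine_prob_le => // i si w [Wi Nw].
  have [le /(_ Nw) lt_] := sn i w si.
  have Mty : M i w = tx i w by apply/max_idPl.
  apply: (Wlt ty tx i) => //; apply: lt_.
  by rewrite -Mty; case: Wi.
have h3 : \sum_(i < k | s i == 0) q i <= pr eq.
  rewrite -(eq_bigr _ (fun i _ => PW i)); apply: sum_fine_prob_le => // i /eqP si w [[_ Wi] Nw].
  have xy := s0 i w si.
  have Mx : M i w = tx i w by rewrite /M -xy maxxx.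
  have E (a : 'I_k -> T -> \bar R) : (forall j, (a j w <= M j w)%E) -> a i w = tx i w ->
      last_time a w = tx i w.
    move=> ale ai; apply/eqP; rewrite eq_le; apply/andP; split; last first.
      by rewrite -ai; exact: le_bigmax.
    apply/bigmax_leP; split; first exact: leNye.
    move=> j _; rewrite -Mx; have [->//|ji] := eqVneq j i.
    by rewrite (le_trans (ale j))// ltW// Wi.
  by rewrite /eq /lt /gt /= !E// ltxx => -[].
(* [h1], [h2] and [h3] bound from below three probabilities that add up to 1, so together they are
   off by exactly the deficit [1 - sum q i]. *)
have h4 : pr lt + pr gt + pr eq = 1.
  rewrite /eq fine_prob_setC; last exact: measurableU.
  rewrite measureU//; first by rewrite fineD ?fin_num_measure//; lra.
  apply/seteqP; split => // w []; rewrite /lt/gt/= => /lt_trans /[apply].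
  by rewrite ltxx.
have split3 (f : 'I_k -> R) : \sum_(i < k) f i =
    \sum_(i < k | 0 < s i) f i + \sum_(i < k | s i < 0) f i + \sum_(i < k | s i == 0) f i.
  rewrite (bigID (fun i => 0 < s i)) -addrA/=; congr (_ + _).
  rewrite (bigID (fun i => s i < 0))/=; congr (_ + _); apply: eq_bigl => i.
    by case: ltgtP.
  by case: ltgtP.
have -> : \sum_(i < k) Num.sg (s i) * q i =
    \sum_(i < k | 0 < s i) q i - \sum_(i < k | s i < 0) q i.
  rewrite split3 [X in _ + X](eq_bigr (fun=> 0)) ?big1_eq ?addr0; last first.
    by move=> i /eqP ->; rewrite sgr0 mul0r.
  rewrite -sumrN; congr (_ + _); apply: eq_bigr => i si.
    by rewrite gtr0_sg// mul1r.
  by rewrite ltr0_sg// mulN1r.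
rewrite (split3 q) race_payoffE -/lt -/gt ler_norml; lra.
Qed.

End race.

(** * Products of distribution functions on a grid *)

Section prod_bounds.
Variables (R : realFieldType) (I : eqType).
Implicit Types (a b : I -> R) (r : seq I).

Lemma prod01 (P : pred I) a r : (forall i, 0 <= a i <= 1) ->
  0 <= \prod_(j <- r | P j) a j <= 1.
Proof.
move=> a01; apply: (big_ind (fun x => 0 <= x <= 1)); first by rewrite ler01 lexx.
- move=> x y /andP[x0 x1] /andP[y0 y1]; rewrite mulr_ge0//=.
  by rewrite (le_trans _ x1)// ler_piMr.
- by move=> i _; exact: a01.
Qed.

Lemma prodB_le_sum (P : pred I) a b r :
  (forall i, 0 <= a i <= b i) -> (forall i, b i <= 1) ->
  \prod_(j <- r | P j) b j - \prod_(j <- r | P j) a j <= \sum_(j <- r) (b j - a j).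
Proof.
move=> ab b1.
have b01 i : 0 <= b i <= 1.
  by rewrite b1 andbT; have /andP[/le_trans] := ab i; apply.
have a01 i : 0 <= a i <= 1.
  by have /andP[-> /le_trans] := ab i; apply.
elim: r => [|x r IH]; first by rewrite !big_nil subrr.
rewrite !big_cons; have /andP[a0 abx] := ab x.
case: ifP => Px; last by rewrite (le_trans IH)// lerDr subr_ge0.
have /andP[B0 B1] := prod01 P r b01; have /andP[A0 A1] := prod01 P r a01.
set B := \prod_(j <- r | P j) b j in IH B0 B1 *.
set A := \prod_(j <- r | P j) a j in IH A0 A1 *.
have s0 : 0 <= \sum_(j <- r) (b j - a j).
  by apply: sumr_ge0 => j _; rewrite subr_ge0; have /andP[] := ab j.
have /andP[_ ax1] := a01 x.
have h : (b x - a x) * B <= b x - a x by rewrite ler_piMr// subr_ge0.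
have h2 : a x * (B - A) <= \sum_(j <- r) (b j - a j).
  have [BA|/ltW BA] := leP 0 (B - A); first by rewrite (le_trans _ IH)// ler_piMl.
  by rewrite (le_trans _ s0)// mulr_ge0_le0.
rewrite (_ : b x * B - a x * A = (b x - a x) * B + a x * (B - A)); last by ring.
exact: lerD.
Qed.

(** For probabilities, a union bound: if every factor meets its level [b] but not every one its
    level [a], some [i] falls into its own gap while the others meet [b]. *)
Lemma prodB_le_sum_prod a b r : uniq r ->
  (forall i, 0 <= a i <= b i) ->
  \prod_(j <- r) b j - \prod_(j <- r) a j <=
  \sum_(i <- r) (b i - a i) * \prod_(j <- r | j != i) b j.
Proof.
move=> ur ab; elim: r ur => [|x r IH /= /andP[xr ur]].
  by rewrite !big_nil subrr.
have b0 i : 0 <= b i by have /andP[/le_trans] := ab i; apply.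
rewrite !big_cons eqxx/=.
have -> : \prod_(j <- r | j != x) b j = \prod_(j <- r) b j.
  rewrite big_seq_cond [RHS]big_seq_cond; apply: eq_bigl => j.
  by case: (boolP (j \in r)) => //= jr; apply: contraNneq xr => <-.
have -> : \sum_(i <- r) (b i - a i) * \prod_(j <- x :: r | j != i) b j =
    b x * \sum_(i <- r) (b i - a i) * \prod_(j <- r | j != i) b j.
  rewrite big_distrr/= !big_seq; apply: eq_bigr => i ir.
  rewrite big_cons ifT; first by rewrite mulrCA.
  by apply: contraNneq xr => ->.
have /andP[a0 abx] := ab x.
have A0 : 0 <= \prod_(j <- r) a j.
  by apply: prodr_ge0 => j _; have /andP[] := ab j.
have AB : \prod_(j <- r) a j <= \prod_(j <- r) b j.
  by apply: ler_prod => j _; exact: ab.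
have := ler_wpM2l (b0 x) (IH ur).
move: (\sum_(i <- r) _) (\prod_(j <- r) b j) (\prod_(j <- r) a j) A0 AB => S B A A0 AB h.
have : 0 <= (b x - a x) * (B - A) by rewrite mulr_ge0 ?subr_ge0.
nra.
Qed.

End prod_bounds.

Section grid.
Variables (R : realType) (k : nat).
Implicit Types (F : 'I_k -> R -> R) (t : nat -> R) (q : 'I_k -> R).

(* For independent random times with distribution functions [F j], this is the
   probability that some cell [`]t l, t l.+1]] contains the [i]-th one while
   all the others are smaller than [t l]. *)
Definition grid_sum F N t i : R :=
  \sum_(l < N) (F i (t l.+1) - F i (t l)) * \prod_(j < k | j != i) F j (t l).

(** The product of all the [F j] telescopes over the cells. In a cell the other factors are taken at
    the left end instead of the right one, at a cost of at most [k * e] times the increment of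
    [F i]. The increments of one [F i] add up to at most 1, so the total loss is at most
    [k ^ 2 * e]. *)
Lemma sum_grid_sum_ge F N t e : {homo t : l m / (l <= m)%N >-> l <= m} ->
  (forall i, {homo F i : x y / x <= y}) -> (forall i x, 0 <= F i x <= 1) ->
  (forall i l, F i (t l.+1) - F i (t l) <= e) ->
  \prod_(j < k) F j (t N) - \prod_(j < k) F j (t 0%N) - k%:R ^+ 2 * e <=
  \sum_(i < k) grid_sum F N t i.
Proof.
move=> tmono Fmono F01 Fe; rewrite /grid_sum exchange_big/=.
pose dsum l := \sum_(i < k) (F i (t l.+1) - F i (t l)).
have tS l : t l <= t l.+1 by exact: tmono.
have step l : \prod_(j < k) F j (t l.+1) - \prod_(j < k) F j (t l) <=
    \sum_(i < k) (F i (t l.+1) - F i (t l)) * \prod_(j < k | j != i) F j (t l) +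
    k%:R * e * dsum l.
  have ab i : 0 <= F i (t l) <= F i (t l.+1).
    by have /andP[-> _] := F01 i (t l); rewrite Fmono.
  have b1 i : F i (t l.+1) <= 1 by have /andP[] := F01 i (t l.+1).
  apply: (le_trans (prodB_le_sum_prod (index_enum_uniq _) ab)).
  rewrite /dsum mulr_sumr -big_split/=; apply: ler_sum => i _.
  rewrite [k%:R * e * _]mulrC -mulrDr; apply: ler_wpM2l.
    by rewrite subr_ge0; have /andP[] := ab i.
  rewrite -lerBlDl (le_trans (prodB_le_sum (fun j => j != i) _ ab b1))//.
  apply: (@le_trans _ _ (\sum_(j < k) e)); first by apply: ler_sum => j _; exact: Fe.
  by rewrite sumr_const card_ord mulr_natl.
have : \sum_(l < N) (\prod_(j < k) F j (t l.+1) - \prod_(j < k) F j (t l)) <=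
    \sum_(l < N) (\sum_(i < k) (F i (t l.+1) - F i (t l)) * \prod_(j < k | j != i) F j (t l) +
    k%:R * e * dsum l) by apply: ler_sum => l _; exact: step.
rewrite [X in _ <= X -> _]big_split/=.
rewrite (_ : \sum_(l < N) k%:R * e * dsum l = k%:R * e * \sum_(l < N) dsum l); last first.
  by rewrite mulr_sumr.
have tel (G : nat -> R) : \sum_(l < N) (G l.+1 - G l) = G N - G 0%N.
  by rewrite -(big_mkord xpredT (fun l => G l.+1 - G l)) telescope_sumr.
rewrite (tel (fun l => \prod_(j < k) F j (t l))).
have : k%:R * e * \sum_(l < N) dsum l <= k%:R ^+ 2 * e.
  case: (posnP k) => [k0|k0].
    have kR : k%:R = 0 :> R by rewrite k0.
    by rewrite kR !mul0r expr0n mul0r.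
  have e0 : 0 <= e.
    by apply: le_trans (Fe (Ordinal k0) 0%N); rewrite subr_ge0 Fmono.
  rewrite expr2 mulrAC; apply: ler_wpM2r => //; apply: ler_wpM2l => //.
  rewrite /dsum exchange_big/= -[leRHS](_ : \sum_(i < k) 1 = _); last first.
    by rewrite sumr_const card_ord.
  apply: ler_sum => i _; rewrite (tel (fun l => F i (t l))).
  have /andP[_ h1] := F01 i (t N); have /andP[h2 _] := F01 i (t 0%N); lra.
lra.
Qed.

End grid.

Section grid_limits.
Variables (R : realType) (k : nat).
Implicit Types (F : 'I_k -> R -> R) (t : nat -> R) (q : 'I_k -> R).

Record regular_cdfs F (C : R) : Prop := {
  rcdf_le : forall i, {homo F i : x y / x <= y} ;
  rcdf_01 : forall i x, 0 <= F i x <= 1 ;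
  rcdf_lipschitz : forall i x y, x <= y -> F i y - F i x <= C * (y - x) ;
  rcdf_pinfty : forall i, F i x @[x --> +oo] --> (1 : R) ;
  rcdf_ninfty : forall i, F i x @[x --> -oo] --> (0 : R) }.

(** Mass is lost in three places, at most [e / 3] in each: beyond the right end, before the left
    end, where one small factor makes the product small, and inside the cells, where the Lipschitz
    bound applies. *)
Lemma grid_exhausts F C e : (0 < k)%N -> regular_cdfs F C -> 0 < e ->
  exists N t, {homo t : l m / (l <= m)%N >-> l <= m} /\
    1 - e <= \sum_(i < k) grid_sum F N t i.
Proof.
move=> k0 rF e0; pose i0 := Ordinal k0.
have e3 : 0 < e / 3 by rewrite divr_gt0.
have [A A0 [Ap Am]] : exists2 A, 0 < A &
    (forall x, A <= x -> 1 - \prod_(j < k) F j x <= e / 3) /\ F i0 (- A) <= e / 3.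
  have ek : 0 < e / 3 / k%:R by rewrite divr_gt0// ltr0n.
  have hp : \forall A \near +oo, forall j, forall x, A <= x -> 1 - F j x <= e / 3 / k%:R.
    apply: filter_forall => j.
    have /cvgrPdist_le/(_ _ ek)[M [Mr hM]] := rcdf_pinfty rF j.
    exists M; split => // A MA x Ax.
    by rewrite (le_trans (ler_norm _))// hM// (lt_le_trans MA).
  have hm : \forall A \near +oo, F i0 (- A) <= e / 3.
    have /cvgrPdist_le/(_ _ e3) := rcdf_ninfty rF i0.
    move=> [M [Mr hM]]; exists (- M); split; first by rewrite realN.
    move=> A MA; have := hM (- A); rewrite ltrNl => /(_ MA).
    by rewrite sub0r normrN ger0_norm//; have /andP[] := rcdf_01 rF i0 (- A).
  near (pinfty_nbhs R) => A; exists A; first by near: A; exact: nbhs_pinfty_gt.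
  split; last by near: A.
  have hA : forall j x, A <= x -> 1 - F j x <= e / 3 / k%:R by near: A.
  move=> x Ax.
  have := @prodB_le_sum R 'I_k xpredT (F ^~ x) (fun=> 1) (index_enum 'I_k).
  rewrite big1// => h; apply: (le_trans (h _ _)) => //; first by move=> j; exact: (rcdf_01 rF j x).
  apply: (@le_trans _ _ (\sum_(j < k) (e / 3 / k%:R))).
    by apply: ler_sum => j _; exact: hA.
  by rewrite sumr_const card_ord -[leLHS]mulr_natr divfK ?lexx ?gt_eqF ?ltr0n.
have C0 : 0 <= C.
  have := rcdf_lipschitz rF i0 (@ler01 R).
  have := rcdf_le rF i0 (@ler01 R); rewrite subr0; lra.
(* This mesh gives [k ^ 2 * (C * h) <= e / 3]; [C + 1] replaces [C], which is only known to be
   nonnegative. *)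
pose h := e / 3 / (k%:R ^+ 2 * (C + 1)).
have h0 : 0 < h.
  by rewrite !divr_gt0// mulr_gt0 ?exprn_gt0 ?ltr0n// ltr_wpDl.
pose N := Num.bound (2 * A / h).
pose t (l : nat) : R := - A + l%:R * h.
exists N, t; split.
  by move=> l m lm; rewrite lerD2l ler_wpM2r ?ler_nat// ltW.
have tmono : {homo t : l m / (l <= m)%N >-> l <= m}.
  by move=> l m lm; rewrite lerD2l ler_wpM2r ?ler_nat// ltW.
have tN : A <= t N.
  have : 2 * A / h < N%:R.
    by apply: archi_boundP; apply: divr_ge0; [apply: mulr_ge0|] => //; exact: ltW.
  rewrite ltr_pdivrMr// /t; lra.
have cell i l : F i (t l.+1) - F i (t l) <= C * h.
  apply: (le_trans (rcdf_lipschitz rF i (tmono _ _ (leqnSn l)))).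
  rewrite ler_wpM2l// /t -natr1; lra.
apply: (le_trans _ (sum_grid_sum_ge N tmono (rcdf_le rF) (rcdf_01 rF) cell)).
have h1 := Ap _ tN.
have h2 : \prod_(j < k) F j (t 0%N) <= e / 3.
  apply: le_trans Am; rewrite /t mul0r addr0 (bigD1 i0)//=.
  have /andP[? ?] := rcdf_01 rF i0 (- A).
  by rewrite ler_piMr//; have /andP[] := prod01 (fun j => j != i0) (index_enum 'I_k) ((rcdf_01 rF) ^~ (- A)).
have h3 : k%:R ^+ 2 * (C * h) <= e / 3.
  have -> : k%:R ^+ 2 * (C * h) = e / 3 * (C / (C + 1)).
    have k_neq0 : k%:R != 0 :> R by rewrite gt_eqF// ltr0n.
    have C1 : C + 1 != 0 by rewrite gt_eqF// ltr_wpDl.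
    rewrite /h; move: (k%:R : R) k_neq0 => a a0.
    by field; rewrite C1 a0.
  by rewrite ler_piMr ?(ltW e3)// ler_pdivrMr ?ltr_wpDl// mul1r lerDl.
lra.
Unshelve. all: end_near. Qed.

(** All that is retained of the independence of the finishing times. For regular [F] it determines
    [q] as soon as the [q i] add up to at most 1. *)
Definition grid_bounded F q := forall N t,
  {homo t : l m / (l <= m)%N >-> l <= m} -> forall i, grid_sum F N t i <= q i.

Lemma grid_bounded_sum1 F C q : (0 < k)%N -> regular_cdfs F C ->
  grid_bounded F q -> \sum_(i < k) q i <= 1 -> \sum_(i < k) q i = 1.
Proof.
move=> k0 rF Fq q1; apply/eqP; rewrite eq_le q1/=.
apply/ler_addgt0Pr => e e0.
have [N [t [tm h]]] := grid_exhausts k0 rF e0.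
rewrite -lerBlDr (le_trans h)//; apply: ler_sum => i _; exact: Fq.
Qed.

(** The lower bounds by grid sums pass to the limit along [Th], and a total mass of at most 1 turns
    them into upper bounds. Regularity is asked of the limit [F] only: the [G a] may have jumps. *)
Lemma cvg_grid_bounded (T : Type) (Th : set_system T) {FTh : Filter Th}
    (G : T -> 'I_k -> R -> R) (q_ : T -> 'I_k -> R) F C q :
  (0 < k)%N -> regular_cdfs F C -> grid_bounded F q -> \sum_(i < k) q i <= 1 ->
  (forall i x, G a i x @[a --> Th] --> F i x) ->
  (forall N t, {homo t : l m / (l <= m)%N >-> l <= m} -> forall i,
     \forall a \near Th, grid_sum (G a) N t i <= q_ a i) ->
  (\forall a \near Th, \sum_(i < k) q_ a i <= 1) ->
  forall i, q_ a i @[a --> Th] --> q i.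
Proof.
move=> k0 rF Fq q1 GF Gq q_1 i.
have kR : 1 <= k%:R :> R by rewrite ler1n.
have k0R : 0 < k%:R :> R by exact: lt_le_trans kR.
apply/cvgrPdist_le => e e0.
(* Each [q_ a j] will fall short of [q j] by at most [2 * e'], hence all of them together by at most
   [e]. *)
pose e' := e / (2 * k%:R).
have e'0 : 0 < e' by rewrite divr_gt0// mulr_gt0.
have [N [t [tm gt]]] := grid_exhausts k0 rF e'0.
have gc j : grid_sum (G a) N t j @[a --> Th] --> grid_sum F N t j.
  rewrite /grid_sum; apply: cvg_big => [|l _]; first exact: add_continuous.
  apply: cvgM; first exact: cvgB.
  apply: cvg_big => [|m _]; [exact: mul_continuous|exact: GF].
have gq j : q j - grid_sum F N t j <= e'.
  have : \sum_(j < k) (q j - grid_sum F N t j) <= e' by rewrite sumrB; lra.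
  apply: le_trans; rewrite (bigD1 j)//= lerDl; apply: sumr_ge0 => m _.
  by rewrite subr_ge0 Fq.
have lower : \forall a \near Th, forall j, q j - 2 * e' <= q_ a j.
  apply: filter_forall => j; near=> a.
  have h1 : grid_sum (G a) N t j <= q_ a j by near: a; exact: Gq.
  have h2 : `|grid_sum F N t j - grid_sum (G a) N t j| <= e'.
    by near: a; apply: pseudometric_normed_Zmodule.cvgr_dist_le.
  have := gq j; move: h2; rewrite ler_norml => /andP[_ h2]; lra.
near=> a.
have la : forall j, q j - 2 * e' <= q_ a j by near: a.
have sa : \sum_(i < k) q_ a i <= 1 by near: a.
have q1' := grid_bounded_sum1 k0 rF Fq q1.
have ke : 2 * e' * k%:R = e.
  rewrite /e'; field; rewrite gt_eqF//.
have e2 : 2 * e' <= e by rewrite -ke ler_peMr// mulr_ge0// ltW.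
rewrite distrC ler_norml; apply/andP; split; first by have := la i; lra.
have : \sum_(j < k | j != i) (q j - 2 * e') <= \sum_(j < k | j != i) q_ a j.
  by apply: ler_sum => j _.
rewrite sumrB => S1.
move: sa; rewrite (bigD1 i)//= => sa; move: q1'; rewrite (bigD1 i)//= => q1'.
have : \sum_(j < k | j != i) (2 * e') <= 2 * e' * k%:R - 2 * e'.
  have -> : 2 * e' * k%:R = \sum_(j < k) (2 * e').
    by rewrite sumr_const card_ord mulr_natr.
  by rewrite [in leRHS](bigD1 i)//= addrAC subrr add0r.
rewrite ke; lra.
Unshelve. all: end_near. Qed.

End grid_limits.

Section strict_last_grid.
Context d (T : measurableType d) (R : realType) (P : probability T R) (k : nat).
Variable M : 'I_k -> T -> \bar R.
Hypothesis mM : forall j, measurable_fun setT (M j).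
Local Notation pr A := (fine (P A)).

Let below i (x : R) := [set w | (M i w <= x%:E)%E].
Let between i (x y : R) := [set w | (x%:E < M i w <= y%:E)%E].

Let mbelow i x : measurable (below i x).
Proof.
rewrite /below -[X in measurable X]setTI.
by apply: measurable_lee => //; exact: measurable_cst.
Qed.

Let betweenE i x y : between i x y = below i y `\` below i x.
Proof.
apply/seteqP; split => w; rewrite /between /below /=.
  by move=> /andP[xw ->]; split => //; apply/negP; rewrite -ltNge.
by move=> [-> /negP]; rewrite -ltNge => ->.
Qed.

Let mbetween i x y : measurable (between i x y).
Proof. by rewrite betweenE; exact: measurableD. Qed.

(** The cells give disjoint events inside [strict_last M i], and independence makes the probability
    of each a product. [G] stays abstract to cover both one normal variable and a whole Poisson
    process per side. *)
Lemma grid_sum_le_strict_last (G : 'I_k -> set_system T) N (t : nat -> R) i :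
  mutually_independent P G ->
  (forall j l, G j (below j (t l))) ->
  (forall j l, G j (between j (t l) (t l.+1))) ->
  {homo t : l m / (l <= m)%N >-> l <= m} ->
  grid_sum (fun j x => pr (below j x)) N t i <= pr (strict_last M i).
Proof.
move=> ind Gb Gbt tm.
pose A l j := if j == i then between i (t l) (t l.+1) else below j (t l).
pose J : {set 'I_k} := [set: 'I_k]%SET.
pose cell l := \bigcap_(j in [set` J]) A l j.
have mA l j : measurable (A l j) by rewrite /A; case: ifP.
have mcell l : measurable (cell l).
  by apply: fin_bigcap_measurable => // ; exact: finite_finset.
have cellP l : pr (cell l) = (pr (below i (t l.+1)) - pr (below i (t l))) *
    \prod_(j < k | j != i) pr (below j (t l)).
  rewrite /cell ind; last first.
    by move=> j _; rewrite /A; case: eqP => [->|_].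
  rewrite /= (bigD1 i) ?inE//=; congr (_ * _).
    rewrite /A eqxx betweenE measureD//; last first.
      by rewrite -ge0_fin_numE// fin_num_measure.
    rewrite (_ : _ `&` _ = below i (t l)); last first.
      apply/setIidPr => w; rewrite /below/= => /le_trans; apply.
      by rewrite lee_fin tm.
    by rewrite fineB ?fin_num_measure.
  apply: eq_big => [j|j ji]; first by rewrite inE.
  by case/andP: ji => _ /negbTE ji; rewrite /A ji.
rewrite /grid_sum (eq_bigr (fun l : 'I_N => pr (cell l))) => [|l _]; last by rewrite cellP.
apply: (@sum_fine_prob_le _ _ _ _ _ xpredT) => //.
- exact: measurable_strict_last.
- have key (l m : nat) w : (l < m)%N -> cell l w -> cell m w -> False.
    move=> lm cl cm.
    have /= := cl i; rewrite inE /A eqxx => /(_ isT) /andP[_ h1].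
    have /= := cm i; rewrite inE /A eqxx => /(_ isT) /andP[h2 _].
    have := lt_le_trans h2 h1; rewrite lte_fin => /lt_le_trans /(_ (tm _ _ lm)).
    by rewrite ltxx.
  apply/trivIsetP => l m _ _ lm; apply/seteqP; split => // w [cl cm].
  have : (l != m :> nat) by [].
  by rewrite neq_ltn => /orP[] h; [exact: (key _ _ _ h cl cm)|exact: (key _ _ _ h cm cl)].
- move=> l _ w cw; have /= := cw i; rewrite inE /A eqxx => /(_ isT) /andP[h1 h2].
  split; first by rewrite (le_lt_trans h2)// ltry.
  move=> j ji; have /= := cw j; rewrite inE /A (negbTE ji) => /(_ isT) h3.
  exact: le_lt_trans h3 h1.
Qed.

End strict_last_grid.

(** * The Gaussian game *)

Section gaussian_race.
Context (R : realType) (k : nat) (p : 'I_k -> R).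
Context d (T : measurableType d) (P : probability T R).
Variable Z : 'I_k -> {RV P >-> R}.
Hypothesis k_gt0 : (0 < k)%N.
Hypothesis p_gt0 : forall i, 0 < p i.
Hypothesis p_sum1 : \sum_(i < k) p i = 1.
Hypothesis Z_indep : mutually_independent P (fun i : 'I_k => sigma_of (Z i)).
Hypothesis Z_normal : forall (i : 'I_k) (B : set R), measurable B ->
  distribution P (Z i) B = normal_prob 0 1 B.
Implicit Types (m : 'I_k -> R) (x y : 'rV[R]_k).
Local Notation pr A := (fine (P A)).

Definition side_time m i w : \bar R := (m i / p i + Z i w / Num.sqrt (p i))%:E.

Definition side_cdf m i s := Phi ((p i * s - m i) / Num.sqrt (p i)).

Definition last_prob m i : R := pr (strict_last (side_time m) i).

Let sp_gt0 i : 0 < Num.sqrt (p i). Proof. by rewrite sqrtr_gt0. Qed.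

Let ss i : Num.sqrt (p i) * Num.sqrt (p i) = p i.
Proof. by rewrite -expr2 sqr_sqrtr// ltW. Qed.

Lemma measurable_side_time m j : measurable_fun setT (side_time m j).
Proof.
apply/measurable_EFinP; apply: measurable_funD; first exact: measurable_cst.
by apply: measurable_funM => //; exact: measurable_cst.
Qed.

Let side_timeE m i s w : (side_time m i w <= s%:E)%E =
  (Z i w <= (p i * s - m i) / Num.sqrt (p i)).
Proof.
rewrite /side_time lee_fin -lerBrDl ler_pdivrMr//.
congr (_ <= _); move: (ss i) (sp_gt0 i).
move: (Num.sqrt (p i)) => r; move: (p i) => q <- r0; field.
by rewrite gt_eqF.
Qed.

Lemma side_cdfE m i s :
  pr [set w | (side_time m i w <= s%:E)%E] = side_cdf m i s.
Proof.
rewrite /side_cdf /Phi -(Z_normal i)//; congr (fine (P _)).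
by apply/seteqP; split => w /=; rewrite side_timeE in_itv.
Qed.

Let sqrtp_le1 i : Num.sqrt (p i) <= 1.
Proof.
rewrite -(@sqrtr1 R) ler_psqrt ?qualifE/= ?(ltW (p_gt0 i))//.
rewrite -p_sum1 (bigD1 i)//= lerDl.
by apply: sumr_ge0 => j _; exact: ltW.
Qed.

Lemma regular_side_cdf m : regular_cdfs (side_cdf m) (normal_peak 1).
Proof.
have mono i : {homo (fun s => (p i * s - m i) / Num.sqrt (p i)) : x y / x <= y}.
  by move=> x y xy; rewrite ler_pM2r ?invr_gt0// lerD2r ler_pM2l.
have E i : (fun s => (p i * s - m i) / Num.sqrt (p i)) =
    (fun s => Num.sqrt (p i) * s - m i / Num.sqrt (p i)).
  apply/funext => s; move: (ss i) (sp_gt0 i).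
  move: (Num.sqrt (p i)) => r; move: (p i) => q <- r0; field.
  by rewrite gt_eqF.
split.
- by move=> i x y xy; apply: Phi_le; exact: mono.
- by move=> i x; rewrite Phi_ge0 Phi_le1.
- move=> i x y xy; apply: (le_trans (Phi_lipschitz (mono i _ _ xy))).
  apply: ler_wpM2l; first exact: normal_peak_ge0.
  have := congr1 (fun f => f y - f x) (E i) => /= ->.
  rewrite opprB addrA subrK -mulrBr ler_piMl// ?subr_ge0//.
- move=> i; have c : (p i * s - m i) / Num.sqrt (p i) @[s --> +oo] --> +oo.
    rewrite E; apply/cvgryPge => A; near=> s.
    rewrite lerBrDr -ler_pdivrMl//; near: s.
  exact: cvg_comp c (@cvg_Phi_pinfty R).
- move=> i; have c : (p i * s - m i) / Num.sqrt (p i) @[s --> -oo] --> -oo.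
    rewrite E; apply/cvgrNyPle => A; near=> s.
    rewrite lerBlDr -ler_pdivlMl//; near: s.
  exact: cvg_comp c (@cvg_Phi_ninfty R).
Unshelve. all: end_near. Qed.

Lemma grid_bounded_last_prob m : grid_bounded (side_cdf m) (last_prob m).
Proof.
move=> N t tm i.
have -> : side_cdf m = fun j (x : R) => pr [set w | (side_time m j w <= x%:E)%E].
  by apply/funext => j; apply/funext => x; rewrite side_cdfE.
apply: (@grid_sum_le_strict_last _ _ _ P _ (side_time m) _ (fun i => sigma_of (Z i))) => //.
- exact: measurable_side_time.
- move=> j l; exists `]-oo, (p j * t l - m j) / Num.sqrt (p j)]%classic => //.
  by rewrite setTI; apply/seteqP; split => w /=; rewrite side_timeE in_itv.
- move=> j l; exists `](p j * t l - m j) / Num.sqrt (p j),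
     (p j * t l.+1 - m j) / Num.sqrt (p j)]%classic => //.
  by rewrite setTI; apply/seteqP; split => w /=; rewrite in_itv/= side_timeE (@ltNge _ (\bar R)) side_timeE -ltNge.
Qed.

Lemma sum_last_prob m : \sum_(i < k) last_prob m i = 1.
Proof.
apply: (grid_bounded_sum1 k_gt0 (regular_side_cdf m) (grid_bounded_last_prob m)).
exact/sum_strict_last_le1/measurable_side_time.
Qed.

Lemma last_prob_ge0 m i : 0 <= last_prob m i.
Proof. exact: fine_ge0. Qed.

Lemma last_prob_le1 m i : last_prob m i <= 1.
Proof.
by apply: fine_prob_le1; apply: measurable_strict_last; exact: measurable_side_time.
Qed.

(** The single cell []0, 1]] already contributes a positive amount, because [Phi] is positive and
    strictly increasing. *)
Lemma last_prob_gt0 m i : 0 < last_prob m i.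
Proof.
have tm : {homo (fun l => l%:R : R) : l n / (l <= n)%N >-> l <= n}.
  by move=> l n; rewrite ler_nat.
apply: lt_le_trans (grid_bounded_last_prob m 1 tm i).
rewrite /grid_sum big_ord1 mulr_gt0//; last by apply: prodr_gt0 => j _; exact: Phi_gt0.
by rewrite subr_gt0; apply: Phi_lt; rewrite ltr_pM2r ?invr_gt0// ltrD2r ltr_pM2l// ltr_nat.
Qed.

Lemma cvg_last_prob (S : Type) (F : set_system S) {FF : Filter F}
    (m_ : S -> 'I_k -> R) m :
  (forall i, m_ a i @[a --> F] --> m i) ->
  forall i, last_prob (m_ a) i @[a --> F] --> last_prob m i.
Proof.
move=> mm; apply: (@cvg_grid_bounded _ _ _ _ _ (fun a => side_cdf (m_ a)) _ _ _ _ k_gt0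
  (regular_side_cdf m) (grid_bounded_last_prob m)).
- by rewrite sum_last_prob.
- move=> i x.
  have c : (p i * x - m_ a i) / Num.sqrt (p i) @[a --> F] -->
      (p i * x - m i) / Num.sqrt (p i).
    by apply: cvgM; [apply: cvgB; [exact: cvg_cst|exact: mm]|exact: cvg_cst].
  exact: (cvg_comp _ _ c (@continuous_Phi R _)).
- by move=> N t tm i; apply: nearW => a; exact: grid_bounded_last_prob.
- by apply: nearW => a; rewrite sum_last_prob.
Qed.

(** The Gaussian [last_prob] add up to 1, so the error term of [race_payoff_approx] vanishes and the
    formula is exact. *)
Lemma K_pureE x y : 2 * K_pure p P Z x y =
  \sum_(i < k) Num.sg (y 0 i - x 0 i) *
    last_prob (fun j => Num.max (x 0 j) (y 0 j)) i.
Proof.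
set q := last_prob _.
have ltE i w : (side_time (x 0)%R i w < side_time (y 0)%R i w)%E = (x 0 i < y 0 i).
  by rewrite /side_time lte_fin ltrD2r ltr_pM2r// invr_gt0.
have ltE' i w : (side_time (y 0)%R i w < side_time (x 0)%R i w)%E = (y 0 i < x 0 i).
  by rewrite /side_time lte_fin ltrD2r ltr_pM2r// invr_gt0.
apply/eqP; rewrite -subr_eq0 -normr_le0.
rewrite -[leRHS](_ : 1 - \sum_(i < k) q i = 0); last by rewrite sum_last_prob subrr.
have -> : K_pure p P Z x y =
  race_payoff P (last_time (side_time (x 0))) (last_time (side_time (y 0))) by [].
apply: (@race_payoff_approx _ _ R P k (side_time (x 0)) (side_time (y 0))
  (fun i => y 0 i - x 0 i) q set0) => //.
- move=> i; rewrite /q /last_prob; congr (fine (P (strict_last _ i))).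
  apply/funext => j; apply/funext => w; rewrite /side_time -EFin_max; congr EFin.
  rewrite -[in RHS]addr_maxl; congr (_ + _).
  by rewrite maxr_pMl// invr_ge0 ltW.
- exact: measurable_side_time.
- exact: measurable_side_time.
- by move=> i w /eqP; rewrite subr_eq0 => /eqP xy; rewrite /side_time xy.
- by move=> i w; rewrite subr_gt0 => xy; split => [|_ _]; [apply: ltW|]; rewrite ltE.
- by move=> i w; rewrite subr_lt0 => xy; split => [|_ _]; [apply: ltW|]; rewrite ltE'.
Qed.

End gaussian_race.

(** * Hitting times of Poisson processes *)

Section poisson_hitting.
Context d (T : measurableType d) (R : realType) (P : probability T R).
Variables (lam : R) (Y : R -> T -> nat).
Hypothesis lam_gt0 : 0 < lam.
Hypothesis YP : poisson_process P lam Y.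
Local Notation pr A := (fine (P A)).

Definition hitting (m : nat) (w : T) : \bar R :=
  ereal_inf [set t%:E | t in [set t : R | 0 <= t /\ (m <= Y t w)%N]].

Lemma measurable_count t (B : set nat) : 0 <= t -> measurable [set w | B (Y t w)].
Proof.
move=> t0; rewrite -[X in measurable X]setTI.
exact: (pp_measurable YP t0 measurableT).
Qed.

(** Right continuity makes the infimum attained: an integer-valued path keeps the value [Y t] for a
    moment after [t]. *)
Lemma hitting_le (m : nat) t w : 0 <= t ->
  (hitting m w <= t%:E)%E = (m <= Y t w)%N.
Proof.
move=> t0; apply/idP/idP => [|mY]; last by apply: ereal_inf_lbound; exists t.
move=> ht; rewrite leqNgt; apply/negP => Ym.
have [e /= e0 he] := pp_right_continuous YP w t0.
have te : (hitting m w < (t + e)%:E)%E.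
  by rewrite (le_lt_trans ht)// lte_fin ltrDl.
have [_ [u [u0 mu] <-]] := @ereal_inf_lt _ _ _ te.
rewrite lte_fin => ute.
have tu : t < u.
  rewrite ltNge; apply/negP => ut.
  by move: Ym; rewrite ltnNge (leq_trans mu)//; exact: (pp_nondecreasing YP).
have := he u; rewrite /ball/= ltr0_norm ?subr_lt0// opprB ltrBlDl => /(_ ute tu) E.
by move: Ym; rewrite -E ltnNge mu.
Qed.

Lemma hitting_ge0 m w : (0 <= hitting m w)%E.
Proof. by apply/ereal_infP => _ [t [t0 _] <-]; rewrite lee_fin. Qed.

Lemma hitting_mono m m' w : (m <= m')%N -> (hitting m w <= hitting m' w)%E.
Proof.
move=> mm'; apply: ereal_inf_le_tmp => _ [t [t0 mt] <-]; exists t => //.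
by split => //; exact: leq_trans mt.
Qed.

Lemma hitting_maxn m m' w :
  hitting (maxn m m') w = maxe (hitting m w) (hitting m' w).
Proof.
have [mm'|/ltnW mm'] := leqP m m'.
  by apply/esym/max_idPr; exact: hitting_mono.
by apply/esym/max_idPl; exact: hitting_mono.
Qed.

Lemma sigma_process_below m t :
  sigma_process Y [set w | (hitting m w <= t%:E)%E].
Proof.
have sY : sigma_algebra setT (sigma_process Y) by exact: smallest_sigma_algebra.
have [t0|t0] := leP 0 t; last first.
  rewrite (_ : [set w | _] = set0); first by case: sY.
  apply/seteqP; split => // w /= h; have := le_trans (hitting_ge0 m w) h.
  by rewrite lee_fin leNgt t0.
apply: sub_gen_smallest; exists t => //.
exists [set j | (m <= j)%N] => //; rewrite setTI.
by apply/seteqP; split => w /=; rewrite hitting_le.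
Qed.

Lemma sigma_process_between m s t :
  sigma_process Y [set w | (s%:E < hitting m w <= t%:E)%E].
Proof.
rewrite (_ : [set w | _] = [set w | (hitting m w <= t%:E)%E] `\`
   [set w | (hitting m w <= s%:E)%E]); last first.
  apply/seteqP; split => w /=.
    by move=> /andP[xw ->]; split => //; apply/negP; rewrite -ltNge.
  by move=> [-> /negP]; rewrite -ltNge => ->.
have h1 := sigma_process_below m t; have h2 := sigma_process_below m s.
have := @measurableD _ (g_sigma_algebraType (\bigcup_(t in [set t : R | 0 <= t]) sigma_of (Y t))) _ _ h1 h2.
exact.
Qed.

Lemma measurable_hitting m : measurable_fun setT (hitting m).
Proof.
apply: (measurability _ (ErealGenOInfty.measurableE R)) => _ [_ [r ->] <-].
rewrite setTI.
rewrite (_ : _ @^-1` _ = ~` [set w | (hitting m w <= r%:E)%E]); last first.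
  apply/seteqP; split => w /=; rewrite in_itv/= andbT.
    by move=> rw; apply/negP; rewrite -ltNge.
  by move=> /negP; rewrite -ltNge.
apply: measurableC; have [r0|r0] := leP 0 r.
  by under eq_set do rewrite hitting_le//; exact: (measurable_count [set j | (m <= j)%N]).
rewrite (_ : [set w | _] = set0)//.
apply/seteqP; split => // w /= h; have := le_trans (hitting_ge0 m w) h.
by rewrite lee_fin leNgt r0.
Qed.

Lemma pr_Y_eq t (j : nat) : 0 < t ->
  pr [set w | Y t w = j] = (lam * t) ^+ j / j`!%:R * expR (- (lam * t)).
Proof.
move=> t0; have := pp_increments YP (lexx 0) t0 j.
under eq_set do rewrite (pp_start YP) add0n.
by move=> ->; rewrite /= subr0 /poisson_pmf mulr_gt0.
Qed.

Lemma measurable_increment s t (j : nat) : 0 <= s -> 0 <= t -> measurable [set w | Y t w = (Y s w + j)%N].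
Proof.
move=> s0 t0.
rewrite (_ : [set w | _] = \bigcup_i ([set w | Y s w = i] `&` [set w | Y t w = (i + j)%N])).
  apply: bigcup_measurable => i _; apply: measurableI.
    exact: (measurable_count [set i]).
  exact: (measurable_count [set (i + j)%N]).
apply/seteqP; split => w /=; first by move=> E; exists (Y s w).
by move=> [i _ [/= -> ->]].
Qed.

Lemma pr_hitting_le m t : 0 < t -> (0 < m)%N ->
  pr [set w | (hitting m w <= t%:E)%E] = 1 - poisson_cdf (lam * t) m.-1.
Proof.
move=> t0 m0.
have mYj j : measurable [set w | Y t w = j].
  exact: (measurable_count [set j] (ltW t0)).
rewrite (_ : [set w | _] = ~` \big[setU/set0]_(j < m) [set w | Y t w = j]); last first.
  under eq_set do rewrite hitting_le ?ltW//.
  rewrite -(bigcup_mkord m (fun j => [set w | Y t w = j])); apply/seteqP; split => w /=.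
    by move=> mY [j /= jm E]; move: mY; rewrite E leqNgt jm.
  by move=> h; rewrite leqNgt; apply/negP => ym; apply: h; exists (Y t w).
rewrite fine_prob_setC; last by apply: bigsetU_measurable.
congr (1 - _).
rewrite measure_bigsetU_ord//; last first.
  apply/trivIsetP => i j _ _ ij; apply/seteqP; split => // w [/= -> /ord_inj E].
  by rewrite E eqxx in ij.
rewrite /poisson_cdf prednK// -sum_fine//; last first.
  by move=> i _; rewrite fin_num_measure.
by apply: eq_bigr => j _; rewrite pr_Y_eq.
Qed.

End poisson_hitting.

(** * Almost sure absence of double jumps *)

Section no_double_jump.
Context d (T : measurableType d) (R : realType) (P : probability T R).
Variables (lam : R) (Y : R -> T -> nat).
Hypothesis lam_gt0 : 0 < lam.
Hypothesis YP : poisson_process P lam Y.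
Local Notation pr A := (fine (P A)).

Let mjump s t : 0 <= s -> 0 <= t -> measurable [set w | (Y s w + 2 <= Y t w)%N].
Proof.
move=> s0 t0.
rewrite (_ : [set w | _] = \bigcup_i ([set w | Y s w = i] `&` [set w | (i + 2 <= Y t w)%N])).
  apply: bigcup_measurable => i _; apply: measurableI.
    exact: (measurable_count YP [set i]).
  exact: (measurable_count YP [set j | (i + 2 <= j)%N]).
apply/seteqP; split => w /=; first by move=> E; exists (Y s w).
by move=> [i _ [/= -> ->]].
Qed.

(** With [l = lam * h] the probability is [1 - (1 + l) * exp (- l)], and [exp (- l) >= 1 - l] bounds
    it by [l ^ 2]. Being of second order in [h], the bound still tends to 0 when summed over a fine
    grid. *)
Let pr_jump s h : 0 <= s -> 0 < h ->
  pr [set w | (Y s w + 2 <= Y (s + h)%R w)%N] <= (lam * h) ^+ 2.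
Proof.
move=> s0 h0; set l := lam * h.
have l0 : 0 < l by rewrite mulr_gt0.
have sh : s < s + h by rewrite ltrDl.
have sh0 : 0 <= s + h by rewrite addr_ge0// ltW.
pose A j := [set w | Y (s + h) w = (Y s w + j)%N].
have mA j : measurable (A j) by exact: (measurable_increment YP).
have PA j : pr (A j) = l ^+ j / j`!%:R * expR (- l).
  by rewrite /A (pp_increments YP)// addrAC subrr add0r /poisson_pmf l0.
rewrite (_ : [set w | _] = ~` (A 0%N `|` A 1%N)); last first.
  apply/seteqP; split => w; rewrite /A /=.
    by move=> h2 [] E; move: h2; rewrite E leq_add2l.
  move=> /not_orP[/eqP h1 /eqP h2].
  have := pp_nondecreasing YP w s0 (ltW sh).
  by rewrite addn0 in h1; move: h1 h2; lia.
rewrite fine_prob_setC; last exact: measurableU.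
rewrite measureU//; last first.
  apply/seteqP; split => // w []; rewrite /A/= => -> /eqP.
  by rewrite eqn_add2l.
rewrite fineD ?fin_num_measure// !PA expr0 expr1 !fact0 factS fact0 muln1 !divr1 mul1r.
have := expR_ge1Dx (- l); nra.
Qed.

Let grid_jumps (B N : nat) := \big[setU/set0]_(l < N.+1)
  [set w | (Y (l%:R * (B%:R / N.+1%:R))%R w + 2 <=
            Y (l%:R * (B%:R / N.+1%:R) + B%:R / N.+1%:R)%R w)%N].

(** For some horizon, every equidistant subdivision has a cell in which the count grows by at least
    two: a countable description satisfied by every path with a double jump. *)
Let double_jump := \bigcup_B \bigcap_N grid_jumps B.+1 N.

Let mgrid_jumps B N : measurable (grid_jumps B N).
Proof.
apply: bigsetU_measurable => l _; apply: mjump.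
  by rewrite mulr_ge0// divr_ge0.
by rewrite addr_ge0// ?mulr_ge0// divr_ge0.
Qed.

Let mdouble_jump : measurable double_jump.
Proof.
apply: bigcup_measurable => B _; apply: bigcap_measurableType => N _.
exact: mgrid_jumps.
Qed.

(** For a fixed horizon the union bound over the [N + 1] cells gives [C / (N + 1)], with [N]
    arbitrary; the horizons are countably many. *)
Let double_jump0 : P double_jump = 0%E.
Proof.
apply/eqP; rewrite eq_le measure_ge0 andbT.
have z B : P (\bigcap_N grid_jumps B.+1 N) = 0%E.
  have mI : measurable (\bigcap_N grid_jumps B.+1 N).
    by apply: bigcap_measurableType => N _; exact: mgrid_jumps.
  rewrite -(fineK (fin_num_measure P _ mI)); congr EFin.
  apply/eqP; rewrite eq_le fine_ge0// andbT.
  pose C := (lam * B.+1%:R) ^+ 2.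
  have C0 : 0 < C by rewrite exprn_gt0// mulr_gt0.
  have hN (N : nat) : pr (\bigcap_N grid_jumps B.+1 N) <= C / N.+1%:R.
    apply: (@le_trans _ _ (\sum_(l < N.+1) C / N.+1%:R ^+ 2)); last first.
      rewrite sumr_const card_ord -[leLHS]mulr_natr.
      rewrite (_ : C / N.+1%:R ^+ 2 * N.+1%:R = C / N.+1%:R)//.
      have : N.+1%:R != 0 :> R by [].
      by move: (N.+1%:R : R) => a a0; field.
    have h0 : 0 < B.+1%:R / N.+1%:R :> R by rewrite divr_gt0.
    apply: (@le_trans _ _ (\sum_(l < N.+1) pr [set w |
        (Y (l%:R * (B.+1%:R / N.+1%:R))%R w + 2 <=
         Y (l%:R * (B.+1%:R / N.+1%:R) + B.+1%:R / N.+1%:R)%R w)%N])).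
      apply: fine_prob_le_sum => //.
        move=> l; apply: mjump; rewrite ?addr_ge0// ?mulr_ge0// ltW//.
      move=> w /(_ N I); rewrite /grid_jumps.
      elim/big_ind : _ => //= [S1 S2 h1 h2 [/h1//|/h2//]|l _ h].
      by exists l.
    apply: ler_sum => l _; apply: le_trans (pr_jump _ h0) _.
      by rewrite mulr_ge0// ltW.
    by rewrite /C -expr_div_n mulrA.
  rewrite leNgt; apply/negP => pos.
  have := hN (Num.truncn (C / pr (\bigcap_N grid_jumps B.+1 N))).
  rewrite leNgt ltr_pdivrMr// mulrC -ltr_pdivrMr//.
  by rewrite truncnS_gt.
have -> : 0%E = (\sum_(0 <= B <oo) P (\bigcap_N grid_jumps B.+1 N))%E.
  by rewrite eseries0.
apply: measure_sigma_subadditive => //.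
by move=> B; apply: bigcap_measurableType => N _; exact: mgrid_jumps.
Qed.

(** If the levels [m < m'] are reached at the same finite time [t], the path is below [m] before [t]
    and at least [m'] at [t]: it jumps by two or more. In every subdivision the first cell that ends
    at or after [t] sees this. *)
Lemma hitting_strict_mono : exists N, [/\ measurable N, P N = 0%E &
  forall w, ~ N w -> forall m m', (m < m')%N -> (hitting Y m' w < +oo)%E ->
  (hitting Y m w < hitting Y m' w)%E].
Proof.
exists double_jump; split => // w Nw m m' mm' m'oo.
rewrite lt_neqAle (hitting_mono _ _ (ltnW mm')) andbT; apply/eqP => E.
apply: Nw.
have m'0 : (0 <= hitting Y m' w)%E := hitting_ge0 _ _ _.
have [t tE] : exists t, hitting Y m' w = t%:E.
  by exists (fine (hitting Y m' w)); rewrite fineK// ge0_fin_numE.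
rewrite tE lee_fin in m'0.
have Yt : (m' <= Y t w)%N by rewrite -(hitting_le YP)// tE.
have Ylt s : 0 <= s -> s < t -> (Y s w < m)%N.
  by move=> s0 st; rewrite ltnNge -(hitting_le YP)// E tE lee_fin -ltNge.
have t0 : 0 < t.
  rewrite lt_neqAle m'0 andbT; apply/eqP => t0; move: Yt.
  by rewrite -t0 (pp_start YP) leqn0 => /eqP m'0'; rewrite m'0' in mm'.
(* The horizon of index [B] is [B + 1], and [truncn t + 1] exceeds [t]. *)
exists (Num.truncn t) => // N _; rewrite /grid_jumps.
set B := (Num.truncn t).+1; set h := B%:R / N.+1%:R.
have h0 : 0 < h by rewrite divr_gt0.
have tB : t <= N.+1%:R * h.
  rewrite /h mulrC divfK// ltW// /B; exact: truncnS_gt.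
have ex : exists l, t <= l%:R * h by exists N.+1.
have [l tl lmin] := ex_minnP ex.
case: l tl lmin => [|l tl lmin]; first by rewrite mul0r leNgt t0.
have lN : (l < N.+1)%N by exact: lmin.
have lt : l%:R * h < t.
  by rewrite ltNge; apply/negP => /lmin; rewrite ltnn.
rewrite (bigD1 (Ordinal lN))//=; left => /=.
have l0 : 0 <= l%:R * h by rewrite mulr_ge0// ltW.
have Y1 := Ylt _ l0 lt.
have Y2 : (Y t w <= Y (l%:R * h + h)%R w)%N.
  by apply: (pp_nondecreasing YP) => //; rewrite -[X in _ + X]mul1r -mulrDl natr1.
by rewrite addn2; apply: leq_trans Y2; apply: leq_trans Yt; apply: leq_trans mm'.
Qed.

End no_double_jump.

(** * Races of independent Poisson processes *)

Section poisson_race.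
Context (R : realType) (k : nat) (p : 'I_k -> R).
Context d (T : measurableType d) (P : probability T R).
Variable Y : 'I_k -> R -> T -> nat.
Hypothesis k_gt0 : (0 < k)%N.
Hypothesis p_gt0 : forall i, 0 < p i.
Hypothesis p_sum1 : \sum_(i < k) p i = 1.
Hypothesis Y_indep : mutually_independent P (fun i : 'I_k => sigma_process (Y i)).
Hypothesis Y_poisson : forall i : 'I_k, poisson_process P (p i) (Y i).
Local Notation pr A := (fine (P A)).
Implicit Types (x y : 'rV[R]_k).

Definition token_last_prob (tok : 'I_k -> nat) i : R :=
  pr (strict_last (fun j => hitting (Y j) (tok j)) i).

Lemma tokensE n x i : (0 < n)%N -> A_ p n x ->
  (tokens p n x i)%:R = p i * n%:R + x 0 i * Num.sqrt n%:R.
Proof.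
move=> n0 [xi _ <-]; rewrite normalizeK// mxE divfK; last first.
  by rewrite gt_eqF// sqrtr_gt0 ltr0n.
by rewrite addrC subrK.
Qed.

Lemma A_allocation n x : A_ p n x -> allocation x.
Proof.
move=> [xi xin <-]; rewrite /allocation/=; under eq_bigr do rewrite mxE.
rewrite -mulr_suml sumrB -mulr_suml p_sum1 mul1r -natr_sum.
by rewrite (_ : (\sum_(i < k) xi i)%N = n)// subrr mul0r.
Qed.

Lemma measurable_hittings (tok : 'I_k -> nat) j :
  measurable_fun setT (hitting (Y j) (tok j)).
Proof. exact: (measurable_hitting (Y_poisson j)). Qed.

(** Normalization preserves the order on each side, and the larger of two token numbers has the
    later hitting time, so [race_payoff_approx] applies off the double jumps of the [k]
    processes. *)
Lemma Kn_pure_approx n x y q : (0 < n)%N -> A_ p n x -> A_ p n y ->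
  q = token_last_prob (fun j => maxn (tokens p n x j) (tokens p n y j)) ->
  (`|2 * Kn_pure p P Y n x y - \sum_(i < k) Num.sg (y 0 i - x 0 i) * q i|
  <= 1 - \sum_(i < k) q i)%R.
Proof.
move=> n0 Ax Ay qE.
have s0 : 0 < Num.sqrt n%:R :> R by rewrite sqrtr_gt0 ltr0n.
have sgE i : (y 0 i - x 0 i) * Num.sqrt n%:R =
    (tokens p n y i)%:R - (tokens p n x i)%:R.
  by rewrite !tokensE//; ring.
have pos i : (0 < y 0 i - x 0 i) = (tokens p n x i < tokens p n y i)%N.
  by rewrite -(pmulr_lgt0 _ s0) sgE subr_gt0 ltr_nat.
have neg i : (y 0 i - x 0 i < 0) = (tokens p n y i < tokens p n x i)%N.
  by rewrite -(pmulr_llt0 _ s0) sgE subr_lt0 ltr_nat.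
pose N_ i := projT1 (cid (hitting_strict_mono (p_gt0 i) (Y_poisson i))).
have NP i := projT2 (cid (hitting_strict_mono (p_gt0 i) (Y_poisson i))).
have mN i : measurable (N_ i) by have [] := NP i.
have -> : Kn_pure p P Y n x y = race_payoff P
    (last_time (fun j => hitting (Y j) (tokens p n x j)))
    (last_time (fun j => hitting (Y j) (tokens p n y j))) by [].
apply: (@race_payoff_approx _ _ R P k _ _ (fun i => y 0 i - x 0 i) q
  (\big[setU/set0]_(i < k) N_ i)).
- move=> i; rewrite qE /token_last_prob; congr (fine (P (strict_last _ i))).
  by apply/funext => j; apply/funext => w; rewrite hitting_maxn.
- exact: measurable_hittings.
- exact: measurable_hittings.
- exact: bigsetU_measurable.
- suff [] : measurable (\big[setU/set0]_(i < k) N_ i) /\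
     P (\big[setU/set0]_(i < k) N_ i) = 0%E by [].
  apply: (big_ind (fun S => measurable S /\ P S = 0%E)) => //.
    move=> S S' [mS S0] [mS' S'0]; split; first exact: measurableU.
    by apply: null_set_setU.
  by move=> i _; have [] := NP i.
- move=> i w /eqP yx; suff -> : tokens p n x i = tokens p n y i by [].
  by apply/eqP; rewrite -(@eqr_nat R) eq_sym -subr_eq0 -sgE (eqP yx) mul0r.
- move=> i w; rewrite pos => xy; split; first exact: hitting_mono (ltnW xy).
  move=> Nw; have [_ _ /(_ w)] := NP i; apply => //.
  by apply: contra_not Nw => Nw; rewrite (bigD1 i)//=; left.
- move=> i w; rewrite neg => xy; split; first exact: hitting_mono (ltnW xy).
  move=> Nw; have [_ _ /(_ w)] := NP i; apply => //.
  by apply: contra_not Nw => Nw; rewrite (bigD1 i)//=; left.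
Qed.

Lemma measurable_clearance_time (tok : 'I_k -> nat) :
  measurable_fun setT (clearance_time Y tok).
Proof. exact: (measurable_last_time (measurable_hittings tok)). Qed.

Lemma Kn_pure_bound n x y : `|Kn_pure p P Y n x y| <= 1.
Proof. by apply: race_payoff_bound; exact: measurable_clearance_time. Qed.

Section limits.
Context (S : Type) (F : set_system S) {FF : Filter F} (n : S -> nat).
Hypothesis noo : n @ F --> \oo.
Local Notation r a := (Num.sqrt (n a)%:R : R).

(** Time is measured as [n + s * sqrt n] because the rates add up to 1. Eventually both the time and
    the token number are positive, as [pr_hitting_le] demands. *)
Lemma cvg_hitting (i : 'I_k) (tok : S -> nat) (b : S -> R) (b0 s : R) :
  b @ F --> b0 ->
  (\forall a \near F, (tok a)%:R = p i * (n a)%:R + b a * r a) ->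
  pr [set w | (hitting (Y i) (tok a) w <= ((n a)%:R + s * r a)%:E)%E] @[a --> F] -->
  Phi ((p i * s - b0) / Num.sqrt (p i)).
Proof.
move=> bb0 tokE.
have roo : r a @[a --> F] --> +oo by exact: cvg_comp noo (@cvg_sqrtr_natr R).
have := @cvg_poisson_tail R S F FF n tok b (p i) s b0 (p_gt0 i) noo bb0 tokE.
apply: cvg_trans; apply: near_eq_cvg; near=> a.
have r0 : 0 < r a by near: a; move/cvgryPgt : roo; apply.
have rs : - s < r a by near: a; move/cvgryPgt : roo; apply.
have b1 : `|b0 - b a| <= 1 by near: a; apply: pseudometric_normed_Zmodule.cvgr_dist_le.
have rb : (1 - b0) / p i < r a by near: a; move/cvgryPgt : roo; apply.
have tE : (tok a)%:R = p i * (n a)%:R + b a * r a by near: a.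
have rr : r a ^+ 2 = (n a)%:R by rewrite sqr_sqrtr.
rewrite /= (pr_hitting_le (p_gt0 i) (Y_poisson i))//.
  move: rr rs; set ra := r a => <- rs.
  rewrite (_ : _ + _ = (ra + s) * ra); last by ring.
  by rewrite mulr_gt0// -ltrBlDr sub0r.
rewrite -(@ltr_nat R) tE.
move: rr rb r0; set ra := r a => <- rb r0.
rewrite (_ : _ + _ = (p i * ra + b a) * ra); last by ring.
rewrite mulr_gt0//.
move: rb; rewrite ltr_pdivrMr// => rb.
move: b1; rewrite ler_distlC => /andP[? ?]; lra.
Unshelve. all: end_near. Qed.

Lemma cvg_token_last_prob (tok : S -> 'I_k -> nat) (b : S -> 'I_k -> R) b0 q :
  (forall i, b a i @[a --> F] --> b0 i) ->
  (\forall a \near F, forall i, (tok a i)%:R = p i * (n a)%:R + b a i * r a) ->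
  grid_bounded (side_cdf p b0) q -> \sum_(i < k) q i <= 1 ->
  forall i, token_last_prob (tok a) i @[a --> F] --> q i.
Proof.
move=> bb0 tokE Fq q1.
apply: (@cvg_grid_bounded _ _ _ _ _
  (fun a i s => pr [set w | (hitting (Y i) (tok a i) w <= ((n a)%:R + s * r a)%:E)%E])
  _ _ _ _ k_gt0 (regular_side_cdf p_gt0 p_sum1 b0) Fq q1).
- move=> i s; apply: cvg_hitting; first exact: bb0.
  by apply: filterS tokE => a; exact.
- move=> N t tm i; apply: nearW => a.
  have tm' : {homo (fun l => (n a)%:R + t l * r a) : l m / (l <= m)%N >-> l <= m}.
    by move=> l m lm; rewrite lerD2l ler_wpM2r ?sqrtr_ge0// tm.
  have := @grid_sum_le_strict_last _ _ _ P _ (fun j => hitting (Y j) (tok a j))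
    (measurable_hittings (tok a)) _ N _ i Y_indep _ _ tm'.
  apply.
  + by move=> j l; exact: (sigma_process_below (Y_poisson j)).
  + by move=> j l; exact: (sigma_process_between (Y_poisson j)).
- apply: nearW => a; apply: sum_strict_last_le1; exact: measurable_hittings.
Qed.

End limits.

End poisson_race.

(** * From the token game to the Gaussian game *)

Section payoff_limits.
Context (R : realType) (k : nat) (p : 'I_k -> R).
Context dZ (TZ : measurableType dZ) (PZ : probability TZ R).
Variable Z : 'I_k -> {RV PZ >-> R}.
Context d (T : measurableType d) (P : probability T R).
Variable Y : 'I_k -> R -> T -> nat.
Hypothesis k_gt0 : (0 < k)%N.
Hypothesis p_gt0 : forall i, 0 < p i.
Hypothesis p_sum1 : \sum_(i < k) p i = 1.
Hypothesis Z_indep : mutually_independent PZ (fun i : 'I_k => sigma_of (Z i)).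
Hypothesis Z_normal : forall (i : 'I_k) (B : set R), measurable B ->
  distribution PZ (Z i) B = normal_prob 0 1 B.
Hypothesis Y_indep : mutually_independent P (fun i : 'I_k => sigma_process (Y i)).
Hypothesis Y_poisson : forall i : 'I_k, poisson_process P (p i) (Y i).
Local Notation pr A := (fine (P A)).
Implicit Types (x y u : 'rV[R]_k).

Definition maxv x y : 'I_k -> R := fun j => Num.max (x 0 j) (y 0 j).

(* The pairs at which [K_pure] is lower semicontinuous along allocations: where
   coordinates of [x] and [y] coincide, no admissible perturbation [u] of
   [y - x] lowers the payoff. *)
Definition lsc_pair x y := forall u, allocation u ->
  (forall i, x 0 i != y 0 i -> Num.sg (u 0 i) = Num.sg (y 0 i - x 0 i)) ->
  \sum_(i < k) Num.sg (y 0 i - x 0 i) * last_prob p Z (maxv x y) i <=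
  \sum_(i < k) Num.sg (u 0 i) * last_prob p Z (maxv x y) i.

Context (S : Type) (F : set_system S) {FF : Filter F} (n : S -> nat).
Variables (x_ y_ : S -> 'rV[R]_k).
Hypothesis noo : n @ F --> \oo.
Hypothesis xA : \forall a \near F, A_ p (n a) (x_ a).
Hypothesis yA : \forall a \near F, A_ p (n a) (y_ a).
Local Notation r a := (Num.sqrt (n a)%:R : R).

Let ngt0 : \forall a \near F, (0 < n a)%N.
Proof. by have := noo (nbhs_infty_gt 0); exact. Qed.

(** The filter is arbitrary so that it can later be generated by shrinking sets of triples
    [(n, y, x)]. Two errors of at most [e / 2] enter twice the payoff: the distance of the
    last-finisher probabilities from their limits, and their deficit from 1. *)
Lemma Kn_liminf x0 y0 e :
  (forall i, x_ a 0 i @[a --> F] --> x0 0 i) ->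
  (forall i, y_ a 0 i @[a --> F] --> y0 0 i) ->
  lsc_pair x0 y0 -> 0 < e ->
  \forall a \near F, K_pure p PZ Z x0 y0 - e <= Kn_pure p P Y (n a) (x_ a) (y_ a).
Proof.
move=> xx yy G e0.
pose tok a j := maxn (tokens p (n a) (x_ a) j) (tokens p (n a) (y_ a) j).
pose b a := maxv (x_ a) (y_ a).
pose q := last_prob p Z (maxv x0 y0).
have tokE : \forall a \near F, forall i, (tok a i)%:R = p i * (n a)%:R + b a i * r a.
  near=> a.
  have n0 : (0 < n a)%N by near: a.
  have Ax : A_ p (n a) (x_ a) by near: a.
  have Ay : A_ p (n a) (y_ a) by near: a.
  move=> i; have r0 : 0 < r a by rewrite sqrtr_gt0 ltr0n.
  rewrite /tok /b /maxv.
  have := tokensE i n0 Ax; have := tokensE i n0 Ay.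
  have [xy ty tx|yx ty tx] := leP (x_ a 0 i) (y_ a 0 i).
    rewrite (maxn_idPr _) ?ty// -(@ler_nat R) ty tx lerD2l.
    by rewrite ler_pM2r.
  rewrite (maxn_idPl _) ?tx// -(@ler_nat R) ty tx lerD2l.
  by rewrite ler_pM2r// ltW.
have bc i : b a i @[a --> F] --> maxv x0 y0 i.
  rewrite /b /maxv maxr_absE; under eq_cvg do rewrite maxr_absE.
  apply: cvgM; last exact: cvg_cst.
  by apply: cvgD; [exact: cvgD|apply: cvg_norm; exact: cvgB].
have sq : \sum_(i < k) q i = 1 := sum_last_prob k_gt0 p_gt0 p_sum1 Z_indep Z_normal _.
have Fq := grid_bounded_last_prob p_gt0 Z_indep Z_normal (maxv x0 y0).
have qc := cvg_token_last_prob k_gt0 p_gt0 p_sum1 Y_indep Y_poisson noo bc tokE Fq.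
have {}qc i : token_last_prob P Y (tok a) i @[a --> F] --> q i.
  by apply: qc; rewrite -/q sq.
pose e' := e / (2 * k%:R).
have kR : 0 < k%:R :> R by rewrite ltr0n.
have e'0 : 0 < e' by rewrite divr_gt0// mulr_gt0.
have qe : \forall a \near F, forall i, `|q i - token_last_prob P Y (tok a) i| <= e'.
  apply: filter_forall => i.
  exact: pseudometric_normed_Zmodule.cvgr_dist_le.
have sgn : \forall a \near F, forall i, x0 0 i != y0 0 i ->
    Num.sg (y_ a 0 i - x_ a 0 i) = Num.sg (y0 0 i - x0 0 i).
  apply: filter_forall => i.
  have c : y_ a 0 i - x_ a 0 i @[a --> F] --> y0 0 i - x0 0 i by exact: cvgB.
  case: (ltgtP (x0 0 i) (y0 0 i)) => xy; last by apply: nearW.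
    rewrite -subr_gt0 in xy; have := cvgr_gt _ c; move=> /(_ _ (0 : R) xy).
    by apply: filterS => a h _; rewrite !gtr0_sg.
  rewrite -subr_lt0 in xy; have := cvgr_lt _ c; move=> /(_ _ (0 : R) xy).
  by apply: filterS => a h _; rewrite !ltr0_sg.
near=> a.
have n0 : (0 < n a)%N by near: a.
have Ax : A_ p (n a) (x_ a) by near: a.
have Ay : A_ p (n a) (y_ a) by near: a.
have qa : forall i, `|q i - token_last_prob P Y (tok a) i| <= e' by near: a.
have sa : forall i, x0 0 i != y0 0 i ->
    Num.sg (y_ a 0 i - x_ a 0 i) = Num.sg (y0 0 i - x0 0 i) by near: a.
have h1 := Kn_pure_approx p_gt0 Y_poisson n0 Ax Ay (erefl _).
rewrite -/(tok a) in h1.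
set qn := token_last_prob P Y (tok a) in qa h1.
have h2 := K_pureE k_gt0 p_gt0 p_sum1 Z_indep Z_normal x0 y0.
rewrite -/(maxv x0 y0) -/q in h2.
(* [y_ a - x_ a] is an admissible perturbation for [lsc_pair]: it sums to 0 and has the signs of
   [y0 - x0] wherever these do not vanish. *)
have h3 : \sum_(i < k) Num.sg (y0 0 i - x0 0 i) * q i <=
    \sum_(i < k) Num.sg (y_ a 0 i - x_ a 0 i) * q i.
  have := G (y_ a - x_ a); under [X in _ -> _ -> _ <= X]eq_bigr do rewrite !mxE.
  apply.
    have := A_allocation p_sum1 Ax; have := A_allocation p_sum1 Ay.
    rewrite /allocation/= => hy hx; under eq_bigr do rewrite !mxE.
    by rewrite sumrB hx hy subrr.
  by move=> i /sa; rewrite !mxE.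
have sgle1 (z : R) : `|Num.sg z| <= 1 by rewrite normr_sg; case: (_ == _).
have h4 : \sum_(i < k) Num.sg (y_ a 0 i - x_ a 0 i) * q i - k%:R * e' <=
    \sum_(i < k) Num.sg (y_ a 0 i - x_ a 0 i) * qn i.
  have -> : k%:R * e' = \sum_(i < k) e' by rewrite sumr_const card_ord mulr_natl.
  rewrite -sumrB; apply: ler_sum => i _.
  rewrite lerBlDl -lerBlDr -mulrBr (le_trans (ler_norm _))// normrM.
  by rewrite (le_trans _ (qa i))// ler_piMl.
have h5 : 1 - \sum_(i < k) qn i <= k%:R * e'.
  have -> : k%:R * e' = \sum_(i < k) e' by rewrite sumr_const card_ord mulr_natl.
  rewrite -sq -sumrB; apply: ler_sum => i _.
  by rewrite (le_trans (ler_norm _)).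
have ke : k%:R * e' = e / 2 by rewrite /e'; field; rewrite gt_eqF.
move: h1; rewrite ler_norml => /andP[h1 _].
rewrite ke in h4 h5; lra.
Unshelve. all: end_near. Qed.

(** For large [s], all sides of [x_ a] are cleared by time [n + s * sqrt n] with probability close
    to 1. Once [s] is fixed, a side of normalized load at least [C] is hardly ever cleared by then
    if [C] is large, so [y_ a] rarely wins. *)
Lemma Kn_liminf_unbounded x0 e :
  (forall i, x_ a 0 i @[a --> F] --> x0 0 i) ->
  (forall C : R, \forall a \near F, exists i, C <= y_ a 0 i) -> 0 < e ->
  \forall a \near F, - e <= Kn_pure p P Y (n a) (x_ a) (y_ a).
Proof.
move=> xx yoo e0.
pose e' := e / (2 * k%:R).
have kR : 0 < k%:R :> R by rewrite ltr0n.
have e'0 : 0 < e' by rewrite divr_gt0// mulr_gt0.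
have ee : e' <= e / 2.
  by rewrite /e' ler_pdivrMr ?mulr_gt0// mulrA divfK// ler_peMr ?ler1n// ltW.
have [s hs] : exists s, forall j, 1 - side_cdf p (x0 0) j s <= e' / 2.
  have : \forall s \near +oo, forall j, 1 - side_cdf p (x0 0) j s <= e' / 2.
    apply: filter_forall => j; near=> s.
    apply: (le_trans (ler_norm _)); near: s.
    have := rcdf_pinfty (regular_side_cdf p_gt0 p_sum1 (x0 0)) j.
    by move=> h; apply: pseudometric_normed_Zmodule.cvgr_dist_le; [exact: h|rewrite divr_gt0].
  by move=> h; near (pinfty_nbhs R) => s; exists s; near: s.
have [C hC] : exists C, forall j, side_cdf p (fun=> C) j s <= e / 4.
  have : \forall C \near +oo, forall j, side_cdf p (fun=> C) j s <= e / 4.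
    apply: filter_forall => j.
    have c : (p j * s - C) / Num.sqrt (p j) @[C --> +oo] --> -oo.
      apply/cvgrNyPle => B; near=> C.
      rewrite ler_pdivrMr ?sqrtr_gt0// lerBlDr -lerBlDl; near: C.
      by apply: nbhs_pinfty_ge; rewrite num_real.
    have := cvg_comp _ _ c (@cvg_Phi_ninfty R) => h.
    have e4 : 0 < e / 4 by rewrite divr_gt0.
    have /cvgrPdist_le/(_ _ e4) := h.
    by apply: filterS => B; rewrite sub0r normrN ger0_norm// Phi_ge0.
  by move=> h; near (pinfty_nbhs R) => C; exists C; near: C.
(* The token numbers of [y_ a] need not converge after normalization. On the overloaded side they
   are replaced by this smaller number, whose normalization [c] tends to [C]; fewer tokens only make
   [y_ a] faster. *)
pose tokC a i := Num.truncn (p i * (n a)%:R + C * r a).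
pose c a i := ((tokC a i)%:R - p i * (n a)%:R) / r a.
have roo : r a @[a --> F] --> +oo by exact: cvg_comp noo (@cvg_sqrtr_natr R).
have tokCE : \forall a \near F, forall i, (tokC a i)%:R = p i * (n a)%:R + c a i * r a.
  near=> a => i; have n0 : (0 < n a)%N by near: a.
  by rewrite /c divfK ?gt_eqF ?sqrtr_gt0 ?ltr0n// addrC subrK.
have tokCle : \forall a \near F, forall i, 0 <= p i * (n a)%:R + C * r a.
  apply: filter_forall => i; near=> a.
  have rC : - C / p i < r a by near: a; move/cvgryPgt : roo; apply.
  have -> : (n a)%:R = r a ^+ 2 by rewrite sqr_sqrtr.
  have r0 : 0 <= r a by rewrite sqrtr_ge0.
  rewrite ltr_pdivrMr// in rC.
  move: rC; rewrite sqrtr_sqr ger0_norm// => rC.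
  rewrite (_ : _ + _ = (p i * r a + C) * r a); last by ring.
  by rewrite mulr_ge0//; lra.
have cC i : c a i @[a --> F] --> C.
  have rV : (r a)^-1 @[a --> F] --> (0 : R).
    apply/gtr0_cvgV0 => //; near=> a; near: a.
    by move/cvgryPgt : roo; apply.
  apply/cvgrPdist_le => e1 e10; near=> a.
  have r0 : 0 < r a by near: a; move/cvgryPgt : roo; apply.
  have n0 : (0 < n a)%N by near: a.
  have h0 : 0 <= p i * (n a)%:R + C * r a.
    by have : forall i, 0 <= p i * (n a)%:R + C * r a by near: a.
  have /andP[t1 t2] := Num.Theory.truncn_itv h0.
  have r1 : (r a)^-1 <= e1.
    rewrite -[leLHS]ger0_norm ?invr_ge0 ?(ltW r0)// -normrN -sub0r.
    by near: a; move: rV => /cvgrPdist_le; apply.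
  apply: le_trans r1.
  have -> : C - c a i = (p i * (n a)%:R + C * r a - (tokC a i)%:R) / r a.
    by rewrite /c; field; rewrite gt_eqF.
  rewrite normrM [X in _ * X]gtr0_norm ?invr_gt0// ler_piMl ?invr_ge0 ?(ltW r0)//.
  rewrite -/(tokC a i) in t1 t2; rewrite -natr1 in t2.
  rewrite ger0_norm; lra.
have tokx i : \forall a \near F, (tokens p (n a) (x_ a) i)%:R = p i * (n a)%:R + x_ a 0 i * r a.
  near=> a; apply: tokensE; last by near: a.
  by near: a.
have hx : \forall a \near F, forall j,
    1 - pr [set w | (hitting (Y j) (tokens p (n a) (x_ a) j) w <= ((n a)%:R + s * r a)%:E)%E] <= e'.
  apply: filter_forall => j.
  have cx := cvg_hitting (s := s) p_gt0 Y_poisson noo (xx j) (tokx j).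
  have e'2 : 0 < e' / 2 by rewrite divr_gt0.
  near=> a.
  have := hs j; rewrite /side_cdf.
  suff : `|Phi ((p j * s - x0 0 j) / Num.sqrt (p j)) - pr [set w | (hitting (Y j)
      (tokens p (n a) (x_ a) j) w <= ((n a)%:R + s * r a)%:E)%E]| <= e' / 2.
    by rewrite ler_norml => /andP[? ?]; lra.
  by near: a; move: (cx FF) => /cvgrPdist_le; apply.
have hy : \forall a \near F, forall j,
    pr [set w | (hitting (Y j) (tokC a j) w <= ((n a)%:R + s * r a)%:E)%E] <= e / 2.
  apply: filter_forall => j.
  have tC : \forall a \near F, (tokC a j)%:R = p j * (n a)%:R + c a j * r a.
    by apply: filterS tokCE => a'; exact.
  have cx := cvg_hitting (s := s) p_gt0 Y_poisson noo (cC j) tC.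
  have e4 : 0 < e / 4 by rewrite divr_gt0.
  near=> a.
  have := hC j; rewrite /side_cdf.
  suff : `|Phi ((p j * s - C) / Num.sqrt (p j)) - pr [set w | (hitting (Y j)
      (tokC a j) w <= ((n a)%:R + s * r a)%:E)%E]| <= e / 4.
    by rewrite ler_norml => /andP[? ?]; lra.
  by near: a; move: (cx FF) => /cvgrPdist_le; apply.
near=> a.
have n0 : (0 < n a)%N by near: a.
have Ay : A_ p (n a) (y_ a) by near: a.
have [i Ci] : exists i, C <= y_ a 0 i by near: a.
have hxa : forall j, 1 - pr [set w | (hitting (Y j)
  (tokens p (n a) (x_ a) j) w <= ((n a)%:R + s * r a)%:E)%E] <= e' by near: a.
have hya : forall j, pr [set w | (hitting (Y j) (tokC a j) w <=
  ((n a)%:R + s * r a)%:E)%E] <= e / 2 by near: a.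
have tl : forall i, 0 <= p i * (n a)%:R + C * r a by near: a.
have tyC : (tokC a i <= tokens p (n a) (y_ a) i)%N.
  have /andP[t1 _] := Num.Theory.truncn_itv (tl i).
  rewrite -(@ler_nat R) (tokensE i n0 Ay) (le_trans t1)// lerD2l.
  by rewrite ler_wpM2r ?sqrtr_ge0.
set t := (n a)%:R + s * r a in hxa hya.
pose Sx := clearance_time Y (tokens p (n a) (x_ a)).
pose Sy := clearance_time Y (tokens p (n a) (y_ a)).
have mSx : measurable_fun setT Sx by exact: measurable_clearance_time.
have mSy : measurable_fun setT Sy by exact: measurable_clearance_time.
have mh m j : measurable [set w | (hitting (Y j) m w <= t%:E)%E].
  rewrite -[X in measurable X]setTI; apply: measurable_lee => //.
  exact: (measurable_hitting (Y_poisson j)).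
have key : pr [set w | (Sy w < Sx w)%E] <= e.
  pose B := [set w | (hitting (Y i) (tokC a i) w <= t%:E)%E].
  pose D := \big[setU/set0]_(j < k)
    ~` [set w | (hitting (Y j) (tokens p (n a) (x_ a) j) w <= t%:E)%E].
  have mD : measurable D by apply: bigsetU_measurable => j _; apply: measurableC; exact: mh.
  apply: (@le_trans _ _ (pr (B `|` D))).
    apply: fine_prob_le; [exact: measurable_ltS|by apply: measurableU => //; exact: mh|].
    move=> w /= yx; rewrite /B /D /=.
    have [h|h] := leP (Sx w) t%:E.
      left; apply: (le_trans (hitting_mono _ w tyC)).
      apply: (@le_trans _ _ (Sy w)); last by rewrite ltW// (lt_le_trans yx).
      exact: (le_bigmax _ (fun j => hitting (Y j) (tokens p (n a) (y_ a) j) w) i).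
    right; move: h; rewrite ltNge => /negP h.
    have [j hj] : exists j, ~ (hitting (Y j) (tokens p (n a) (x_ a) j) w <= t%:E)%E.
      apply/not_existsP => hj; apply: h; apply/bigmax_leP; split; first exact: leNye.
      by move=> j _; have := hj j => /contrapT.
    by rewrite (bigD1 j)//=; left.
  apply: (le_trans (fine_probU_le P (mh _ _) mD)).
  have D1 : pr D <= \sum_(j < k) e'.
    apply: (@le_trans _ _ (\sum_(j < k) pr (~` [set w | (hitting (Y j)
      (tokens p (n a) (x_ a) j) w <= t%:E)%E]))).
      apply: fine_prob_le_sum => //; first by move=> j; apply: measurableC; exact: mh.
      move=> w; rewrite /D; elim/big_ind : _ => //= [S1 S2 h1 h2 [/h1//|/h2//]|j _ h].
      by exists j.
    by apply: ler_sum => j _; rewrite fine_prob_setC; [exact: hxa|exact: mh].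
  have ke : \sum_(j < k) e' = e / 2.
    by rewrite sumr_const card_ord -mulr_natr /e'; field; rewrite gt_eqF.
  have := hya i; rewrite -/B; lra.
rewrite /Kn_pure race_payoffE -/Sx -/Sy.
have : 0 <= pr [set w | (Sx w < Sy w)%E] by exact: fine_ge0.
lra.
Unshelve. all: end_near. Qed.

End payoff_limits.

(** * Weak convergence *)

Section probability_integrals.
Context d (T : measurableType d) (R : realType) (P : probability T R).
Implicit Types (f g : T -> R) (D : set T).

Lemma bounded_integrable f D M : measurable D -> measurable_fun D f ->
  (forall x, D x -> `|f x| <= M) -> P.-integrable D (EFin \o f).
Proof.
move=> mD mf fM; apply: measurable_bounded_integrable => //.
  by rewrite (le_lt_trans (probability_le1 _ _))// ltry.
exists M; split; first by rewrite num_real.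
by move=> x Mx y Dy; apply: (le_trans (fM _ Dy)); exact: ltW.
Qed.

Lemma Rintegral_prob1 f D M : measurable D -> P D = 1%E -> measurable_fun setT f ->
  (forall x, `|f x| <= M) -> \int[P]_x f x = \int[P]_(x in D) f x.
Proof.
move=> mD D1 mf fM.
have fi : P.-integrable setT (EFin \o f) by exact: (@bounded_integrable _ _ M).
have DC0 : P (~` D) = 0%E by rewrite probability_setC// D1 subee.
have mDC := measurableC mD.
rewrite -(setUv D) Rintegral_setU//; last 2 first.
- by rewrite setUv.
- by apply/disj_setPCl.
rewrite [X in _ + X](_ : _ = 0) ?addr0// /Rintegral.
have := @negligible_integral _ T R P (~` D) (~` D) (EFin \o f) mDC mDC.
move=> -> //; first by rewrite setDv integral_set0.
exact: (integrableS measurableT).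
Qed.

Lemma bounded_convergence (f_ : nat -> T -> R) f M :
  (forall n, measurable_fun setT (f_ n)) -> measurable_fun setT f ->
  (forall n x, `|f_ n x| <= M) ->
  {ae P, forall x, f_ n x @[n --> \oo] --> f x} ->
  \int[P]_x f_ n x @[n --> \oo] --> \int[P]_x f x.
Proof.
move=> mf_ mf fM fcvg.
have [| | | | |fi _ h] := @dominated_convergence _ T R P setT measurableT
  (fun n => EFin \o f_ n) (EFin \o f) (cst M%:E).
- by move=> n; exact/measurable_EFinP.
- exact/measurable_EFinP.
- case: fcvg => A [mA A0 hA]; exists A; split => //.
  move=> x /= nx; apply: hA => /= c; apply: nx => _.
  by apply: cvg_EFin c; exact: nearW.
- apply: (@bounded_integrable (cst M) setT `|M|) => //.
- by apply: aeW => x n _; rewrite /= lee_fin.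
- apply: fine_cvg; rewrite fineK//; exact: integrable_fin_num.
Qed.

End probability_integrals.

(** * Lipschitz minorants and lower limits under weak convergence *)

Section weak_liminf.
Context (R : realType) (k : nat).
Implicit Types (x : 'rV[R]_k).

Lemma continuous_measurable_rV (f : 'rV[R]_k -> R) : continuous f ->
  measurable_fun [set: borel_rV R k] f.
Proof.
move=> cf; apply: (measurability _ (RGenOpens.measurableE R)) => _ [_ [a [b ->] <-]].
rewrite setTI; apply: sub_gen_smallest.
by apply: open_comp; [move=> x _; exact: cf|exact: interval_open].
Qed.

Variables (alpha : nat -> probability (borel_rV R k) R)
  (alpha0 : probability (borel_rV R k) R).
Hypothesis alpha_cvg : weakly_converges alpha alpha0.

Variables (I : Type) (nu : I -> nat) (U : nat -> set I)
  (D : nat -> set (borel_rV R k)) (H : I -> 'rV[R]_k -> R).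
Hypothesis U_anti : forall i j, (i <= j)%N -> U j `<=` U i.
Hypothesis mD : forall n, measurable (D n).
Hypothesis D1 : forall n, (0 < n)%N -> alpha n (D n) = 1%E.
Hypothesis mH : forall i, measurable_fun (D (nu i)) (H i).
Hypothesis H1 : forall i x, `|H i x| <= 1.

(** The element 1 keeps the set nonempty and its infimum at most 1. Only points of the carriers [D]
    compete, since the integrals of [H] are taken there. *)
Let env_set j x := [set r : R | r = 1 \/ exists2 ix : I * 'rV[R]_k,
  U j ix.1 /\ D (nu ix.1) ix.2 & r = Num.min 1 (H ix.1 ix.2 + j%:R * `|x - ix.2|)].

(* The largest [j]-Lipschitz minorant of 1 and of all the [H i], [i \in U j]. *)
Let env j x := inf (env_set j x).

Let env_set_lb j x : lbound (env_set j x) (-1).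
Proof.
move=> r [->|[[i y] /= _ ->]]; first by lra.
rewrite le_min; apply/andP; split; first by lra.
have := H1 i y; rewrite ler_norml => /andP[h _].
by rewrite (le_trans h)// lerDl mulr_ge0.
Qed.

Let env_le j x r : env_set j x r -> env j x <= r.
Proof. by move=> xr; apply: ge_inf => //; exists (-1); exact: env_set_lb. Qed.

Let env_ge j x r : (forall s, env_set j x s -> r <= s) -> r <= env j x.
Proof. by move=> h; apply: lb_le_inf => //; exists 1; left. Qed.

Let env_lipschitz j x y : env j x <= env j y + j%:R * `|x - y|.
Proof.
rewrite -lerBlDr; apply: env_ge => s [->|[[i z] /= [Ui Dz] ->]].
  rewrite lerBlDr (@le_trans _ _ 1)//; first by apply: env_le; left.
  by rewrite lerDl mulr_ge0.
have : env j x <= Num.min 1 (H i z + j%:R * `|x - z|).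
  by apply: env_le; right; exists (i, z).
have jxz : j%:R * `|x - z| <= j%:R * `|x - y| + j%:R * `|y - z|.
  by rewrite -mulrDr ler_wpM2l// -[x - z](subrKA y) ler_normD.
have : 0 <= j%:R * `|x - y| by rewrite mulr_ge0.
rewrite !le_min => ? /andP[? ?]; apply/andP; split; lra.
Qed.

Let env_continuous j : continuous (env j).
Proof.
move=> x; have FF := nbhs_filter x; apply/cvgrPdist_le => e e0.
have e1 : 0 < e / j.+1%:R by rewrite divr_gt0.
apply: filterS (nbhsx_ballx (x : 'rV[R]_k) (e / j.+1%:R) e1) => y.
rewrite mx_norm_ball /ball_/= => xy.
have h : j%:R * `|x - y| <= e.
  apply: (@le_trans _ _ (j.+1%:R * (e / j.+1%:R))); last by rewrite mulrC divfK.
  by apply: ler_pM => //; [rewrite ler_nat|exact: ltW].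
have h1 := env_lipschitz j x y; have := env_lipschitz j y x.
rewrite distrC => h2.
by rewrite ler_norml; apply/andP; split; rewrite ?lerBlDl ?lerBrDl; lra.
Qed.

Let env_bound j x : `|env j x| <= 1.
Proof.
rewrite ler_norml; apply/andP; split; first by apply: env_ge; exact: env_set_lb.
by apply: env_le; left.
Qed.

Let env_leH j i x : U j i -> D (nu i) x -> env j x <= H i x.
Proof.
move=> Ui Dx; have : env j x <= Num.min 1 (H i x + j%:R * `|x - x|).
  by apply: env_le; right; exists (i, x).
by rewrite subrr normr0 mulr0 addr0 le_min => /andP[].
Qed.

Let measurable_env j : measurable_fun [set: borel_rV R k] (env j).
Proof. by apply: continuous_measurable_rV; exact: env_continuous. Qed.

(* A Fatou lemma for weak convergence, uniform in the index [i]. *)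
Lemma weak_liminf (h : 'rV[R]_k -> R) :
  measurable_fun [set: borel_rV R k] h -> (forall x, `|h x| <= 1) ->
  {ae alpha0, forall x0, forall e, 0 < e -> exists j, forall i, U j i ->
     forall x, D (nu i) x -> `|x - x0| < j.+1%:R^-1 -> h x0 - e <= H i x} ->
  forall e, 0 < e -> exists j : nat, forall i, U j i -> (j <= nu i)%N ->
    \int[alpha0]_x h x - e <= \int[alpha (nu i)]_(x in D (nu i)) H i x.
Proof.
move=> mh h1 hae e e0.
(* Only a lower bound on the limit of [env j] is at hand; cutting off at [h] gives genuine
   convergence to [h], to which bounded convergence applies. *)
pose g j x := Num.min (env j x) (h x).
have mg j : measurable_fun [set: borel_rV R k] (g j) by exact: measurable_minr.
have g1 j x : `|g j x| <= 1.
  by rewrite /g; case: (leP (env j x) (h x)) => _; [exact: env_bound|exact: h1].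
have gh : {ae alpha0, forall x, g j x @[j --> \oo] --> h x}.
  case: hae => A [mA A0 hA]; exists A; split => // x /= nx; apply: hA => /= good.
  apply: nx; apply/cvgrPdist_le => e1 e10.
  have [j0 hj0] := good _ e10.
  (* From this index on, a point at distance at least [1 / (j0 + 1)] pays a penalty of at least 2,
     which lifts any value [>= -1] to at least 1. *)
  exists (2 * j0.+1)%N => // j /= jj0.
  have lower : h x - e1 <= env j x.
    apply: env_ge => s [->|[[i z] /= [Ui Dz] ->]].
      by have := h1 x; rewrite ler_norml => /andP[_ ?]; lra.
    rewrite le_min; apply/andP; split.
      by have := h1 x; rewrite ler_norml => /andP[_ ?]; lra.
    have [zx|zx] := ltP `|z - x| j0.+1%:R^-1.
      apply: (@le_trans _ _ (H i z)); last by rewrite lerDl mulr_ge0.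
      apply: hj0 => //; apply: U_anti Ui; apply: leq_trans jj0.
      by rewrite mul2n -addnn (leq_trans (leqnSn _))// leq_addr.
    have j2 : 2 <= j%:R * `|x - z|.
      rewrite distrC; apply: (@le_trans _ _ ((2 * j0.+1)%:R * j0.+1%:R^-1)).
        by rewrite natrM -mulrA divff ?mulr1.
      by apply: ler_pM => //; rewrite ler_nat.
    have := H1 i z; rewrite ler_norml => /andP[? _].
    by have := h1 x; rewrite ler_norml => /andP[_ ?]; lra.
  rewrite /g; case: (leP (env j x) (h x)) => [le|_].
    by rewrite ger0_norm ?subr_ge0//; lra.
  by rewrite subrr normr0 ltW.
have cg := bounded_convergence mg mh g1 gh.
have e2 : 0 < e / 2 by rewrite divr_gt0.
have [j hj] : exists j, \int[alpha0]_x h x - e / 2 <= \int[alpha0]_x env j x.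
  have /cvgrPdist_le/(_ _ e2)[j _ /(_ j (leqnn j))] := cg.
  rewrite /= ler_norml => /andP[_ hj]; exists j.
  apply: (@le_trans _ _ (\int[alpha0]_x g j x)); first by lra.
  apply: le_Rintegral => //.
  - by apply: (@bounded_integrable _ _ _ _ _ _ 1) => // x _; exact: g1.
  - by apply: (@bounded_integrable _ _ _ _ _ _ 1) => // x _; exact: env_bound.
  - by move=> x _; rewrite /g ge_min lexx.
have := alpha_cvg (@env_continuous j) (ex_intro _ 1 (env_bound j)).
move=> /cvgrPdist_le/(_ _ e2)[N _ hN].
exists (maxn j (maxn N 1)) => i Ui; rewrite !geq_max => /and3P[_ Ni ni].
have Uj : U j i by apply: U_anti Ui; rewrite leq_maxl.
have := hN _ Ni; rewrite /= ler_norml => /andP[_ hi].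
rewrite (Rintegral_prob1 (mD (nu i)) (D1 ni) (measurable_env j) (env_bound j)) in hi.
have : \int[alpha (nu i)]_(x in D (nu i)) env j x <= \int[alpha (nu i)]_(x in D (nu i)) H i x.
  apply: le_Rintegral => //.
  - apply: (@bounded_integrable _ _ _ _ _ _ 1) => //.
    by apply: measurable_funTS; exact: measurable_env.
  - exact: (@bounded_integrable _ _ _ _ _ _ 1).
  - by move=> x Dx; exact: env_leH.
lra.
Qed.

End weak_liminf.

(** * Integrals of bounded antisymmetric kernels *)

Section antisymmetric_kernel.
Context d (T : measurableType d) (R : realType) (P : probability T R).

Lemma norm_Rintegral_le (f : T -> R) (D : set T) (M : R) : measurable D ->
  measurable_fun D f -> 0 <= M -> (forall x, `|f x| <= M) ->
  `|\int[P]_(x in D) f x| <= M.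
Proof.
move=> mD mf M0 fM.
have fi : P.-integrable D (EFin \o f) by exact: (@bounded_integrable _ _ _ _ _ _ M).
apply: (le_trans (le_normr_Rintegral mD fi)).
apply: (@le_trans _ _ (\int[P]_(x in D) M)).
  apply: le_Rintegral => //.
  - apply: (@bounded_integrable _ _ _ _ _ _ M) => //; first exact: measurableT_comp.
    by move=> x _; rewrite normr_id.
  - by apply: (@bounded_integrable _ _ _ _ _ _ `|M|).
rewrite Rintegral_cst// ler_piMr//; exact: fine_prob_le1.
Qed.

Lemma Rintegral_eq0_ae (f : T -> R) (D : set T) (M : R) : measurable D ->
  measurable_fun D f -> (forall x, D x -> 0 <= f x <= M) ->
  \int[P]_(x in D) f x = 0 -> {ae P, forall x, D x -> f x = 0}.
Proof.
move=> mD mf fM I0.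
have fi : P.-integrable D (EFin \o f).
  apply: (@bounded_integrable _ _ _ _ _ _ M) => // x /fM/andP[f0 fM'].
  by rewrite ger0_norm.
have [+ _] := ae_eq_integral_abs P mD (measurable_int _ fi).
rewrite (eq_integral (EFin \o f)); last first.
  by move=> x /set_mem/fM/andP[f0 _] /=; rewrite ger0_norm.
rewrite -[X in X = _ -> _]fineK; last exact: integrable_fin_num.
rewrite -[fine _]/(\int[P]_(x in D) f x) I0 => /(_ erefl).
by apply: filterS => x fx Dx; have /= [] := fx Dx.
Qed.

Lemma bounded_Fubini (f : T * T -> R) (M : R) : measurable_fun setT f ->
  (forall z, `|f z| <= M) ->
  measurable_fun setT (fun y => \int[P]_x f (x, y)) /\
  \int[P]_y \int[P]_x f (x, y) = \int[P]_x \int[P]_y f (x, y).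
Proof.
move=> mf fM.
have mfE : measurable_fun setT (EFin \o f) by exact/measurable_EFinP.
have fi : (P \x P)%E.-integrable setT (EFin \o f).
  apply/(integrable12ltyP _ _ mfE).
  apply: (@le_lt_trans _ _ (\int[P]_x (M%:E))%E); last first.
    by rewrite integral_cst// [X in (_ * X)%E]probability_setT mule1 ltry.
  apply: ge0_le_integral => //.
  - by move=> x _; exact: integral_ge0.
  - apply: (@measurable_fun_fubini_tonelli_F _ _ _ _ _ P (abse \o (EFin \o f))) => //=.
    exact: measurableT_comp.
  - move=> x _; apply: (@le_trans _ _ (\int[P]_y (M%:E))%E).
      apply: ge0_le_integral => //.
      + by apply: measurableT_comp => //; exact: measurable_fun_pair2 mfE.
      + by move=> y _; rewrite lee_fin.
    by rewrite integral_cst// [X in (_ * X)%E]probability_setT mule1.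
have fin1 y : (\int[P]_x (f (x, y))%:E)%E = (\int[P]_x f (x, y))%:E.
  rewrite fineK//; apply: integrable_fin_num => //.
  apply: (@bounded_integrable _ _ _ _ (fun x => f (x, y)) _ M) => //.
  exact: (measurable_fun_pair1 y mf).
have fin2 x : (\int[P]_y (f (x, y))%:E)%E = (\int[P]_y f (x, y))%:E.
  rewrite fineK//; apply: integrable_fin_num => //.
  apply: (@bounded_integrable _ _ _ _ (fun y => f (x, y)) _ M) => //.
  exact: (measurable_fun_pair2 x mf).
split.
  apply/measurable_EFinP; rewrite (_ : _ \o _ = fubini_G P (EFin \o f)).
    exact: (measurable_fubini_G fi).
  by apply/funext => y; rewrite /fubini_G /= fin1.
rewrite [LHS]/Rintegral [RHS]/Rintegral; congr fine.
under eq_integral do rewrite -fin1.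
under [RHS]eq_integral do rewrite -fin2.
by rewrite -(Fubini fi).
Qed.

Lemma Rintegral_anti (f : T * T -> R) (M : R) : measurable_fun setT f ->
  (forall z, `|f z| <= M) -> (forall x y, f (x, y) = - f (y, x)) ->
  \int[P]_y \int[P]_x f (x, y) = 0.
Proof.
move=> mf fM anti.
have [_ E] := bounded_Fubini mf fM.
have int2 x : \int[P]_y f (x, y) = - \int[P]_y f (y, x).
  rewrite -[RHS]mulN1r -RintegralZl//.
    by apply: eq_Rintegral => y _; rewrite mulN1r anti.
  apply: (@bounded_integrable _ _ _ _ (fun y => f (y, x)) _ M) => //.
  exact: (measurable_fun_pair1 x mf).
have bnd x : `|\int[P]_y f (y, x)| <= M.
  apply: norm_Rintegral_le => //; first exact: (measurable_fun_pair1 x mf).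
  by rewrite (le_trans _ (fM (x, x))).
have : \int[P]_x \int[P]_y f (x, y) = - \int[P]_x \int[P]_y f (y, x).
  rewrite -[RHS]mulN1r -RintegralZl//.
    by apply: eq_Rintegral => y _; rewrite mulN1r int2.
  by apply: (@bounded_integrable _ _ _ _ _ _ M) => //; have [] := bounded_Fubini mf fM.
by rewrite -E => /eqP; rewrite -subr_eq0 opprK -mulr2n mulrn_eq0/= => /eqP.
Qed.

End antisymmetric_kernel.

(** * Optimal strategies of the continuous game *)

Lemma Rintegral_lincomb d (T : measurableType d) (R : realType)
    (P : probability T R) n (c : 'I_n -> R) (f : 'I_n -> T -> R) :
  (forall i, P.-integrable setT (EFin \o f i)) ->
  \int[P]_x (\sum_(i < n) c i * f i x) = \sum_(i < n) c i * \int[P]_x f i x.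
Proof.
move=> fi.
have cfi i : P.-integrable setT (fun x => (c i)%:E * (f i x)%:E)%E by exact: (integrableZl measurableT (c i) (fi i)).
rewrite {1}/Rintegral.
under eq_integral do rewrite -sumEFin.
under eq_integral do under eq_bigr do rewrite EFinM.
rewrite integral_sum// (eq_bigr (fun i => (c i * \int[P]_x f i x)%:E)) ?sumEFin//.
move=> i _; rewrite (integralZl measurableT (fi i)) EFinM fineK//; exact: (integrable_fin_num measurableT (fi i)).
Qed.

Lemma allocation_inj (R : realType) k (x y : 'rV[R]_k) i : (k <= 2)%N ->
  allocation x -> allocation y -> x 0 i = y 0 i -> x = y.
Proof.
rewrite /allocation/=; case: k x y i => [|[|[|//]]] x y i _.
- by move=> _ _ _; apply/rowP => -[].
- by move=> _ _; rewrite (ord1 i) => xy; apply/rowP => j; rewrite (ord1 j).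
rewrite !big_ord_recl !big_ord0 !addr0 => hx hy xy; apply/rowP => j.
have [->//|ji] := eqVneq j i.
have E (z : 'rV[R]_2) : z 0 ord0 + z 0 (lift ord0 ord0) = 0 -> z 0 j = - z 0 i.
  move=> /eqP; rewrite addr_eq0 => /eqP hz.
  have c2 (l : 'I_2) : l = ord0 \/ l = lift ord0 ord0.
    by case: (unliftP ord0 l) => [l' ->|->]; [right; rewrite (ord1 l')|left].
  move: ji; case: (c2 i) => ->; case: (c2 j) => ->; by rewrite ?eqxx// hz ?opprK.
by rewrite (E _ hx) (E _ hy) xy.
Qed.

Section optimal_strategies.
Context (R : realType) (k : nat) (p : 'I_k -> R).
Context d (T : measurableType d) (P : probability T R).
Variable Z : 'I_k -> {RV P >-> R}.
Hypothesis k_gt0 : (0 < k)%N.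
Hypothesis p_gt0 : forall i, 0 < p i.
Hypothesis p_sum1 : \sum_(i < k) p i = 1.
Hypothesis Z_indep : mutually_independent P (fun i : 'I_k => sigma_of (Z i)).
Hypothesis Z_normal : forall (i : 'I_k) (B : set R), measurable B ->
  distribution P (Z i) B = normal_prob 0 1 B.
Implicit Types (x y v : 'rV[R]_k).
Local Notation K := (K_pure p P Z).

Lemma measurable_coord i : measurable_fun [set: borel_rV R k] (fun x : 'rV[R]_k => x 0 i).
Proof. by apply: continuous_measurable_rV; exact: coord_continuous. Qed.

Lemma measurable_allocation : measurable (@allocation R k : set (borel_rV R k)).
Proof.
have mf : measurable_fun [set: borel_rV R k] (fun x : 'rV[R]_k => \sum_(i < k) x 0 i).
  by apply: measurable_sum => i; exact: measurable_coord.
rewrite -[X in measurable X]setTI (_ : @allocation R k =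
  (fun x : borel_rV R k => \sum_(i < k) (x : 'rV_k) 0 i) @^-1` [set 0])//.
exact: mf.
Qed.

(** The event that one player is faster is measurable jointly in the two allocations and the noise,
    and the probabilities of its sections are measurable by Tonelli. *)
Lemma measurable_K_pure :
  measurable_fun setT (fun z : borel_rV R k * borel_rV R k => K z.1 z.2).
Proof.
pose t (b : bool) (zw : (borel_rV R k * borel_rV R k) * T) : \bar R :=
  limit_time p Z (if b then zw.1.1 else zw.1.2) zw.2.
have mt b : measurable_fun setT (t b).
  apply: (@measurable_last_time _ _ _ _ (fun i (zw : (borel_rV R k * borel_rV R k) * T) =>
    ((if b then (zw.1.1 : 'rV_k) else zw.1.2) 0 i / p i + Z i zw.2 / Num.sqrt (p i))%:E)) => i.
  apply/measurable_EFinP; apply: measurable_funD; apply: measurable_funM => //.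
    case: b; apply: (measurableT_comp (measurable_coord i)).
      by apply: (measurableT_comp (@measurable_fst _ _ _ _)); exact: measurable_fst.
    by apply: (measurableT_comp (@measurable_snd _ _ _ _)); exact: measurable_fst.
  by apply: measurableT_comp => //; exact: measurable_snd.
have mpr b : measurable_fun setT (fun z : borel_rV R k * borel_rV R k =>
    fine (P [set w | (t b (z, w) < t (~~ b) (z, w))%E])).
  have mA := measurable_ltS (mt b) (mt (~~ b)).
  have := measurable_fun_xsection P mA.
  move=> h; apply: (measurableT_comp (fine_measurable measurableT)).
  apply: eq_measurable_fun h => z _ /=; congr (P _).
  by apply/seteqP; split => w; rewrite /xsection/= ?inE.
rewrite (_ : (fun z => _) = fun z : borel_rV R k * borel_rV R k =>
  2^-1 * (fine (P [set w | (t true (z, w) < t false (z, w))%E]) -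
          fine (P [set w | (t false (z, w) < t true (z, w))%E]))); last first.
  by apply/funext => -[x y]; rewrite /K_pure race_payoffE.
apply: measurable_funM => //; apply: measurable_funB.
  exact: (mpr true).
exact: (mpr false).
Qed.

Lemma measurable_limit_time x : measurable_fun setT (limit_time p Z x).
Proof. by apply: measurable_last_time => i; exact: measurable_side_time. Qed.

Lemma K_pure_bound x y : `|K x y| <= 1.
Proof. by apply: race_payoff_bound; exact: measurable_limit_time. Qed.

Lemma measurable_K_pure1 y : measurable_fun [set: borel_rV R k] (fun x => K x y).
Proof. exact: (measurable_fun_pair1 (y : borel_rV R k) measurable_K_pure). Qed.

Variable alpha : probability (borel_rV R k) R.
Hypothesis alpha_opt : optimal p P Z alpha.

Let g y := \int[alpha]_x K x y.

Let K_int y : alpha.-integrable setT (EFin \o (fun x => K x y)).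
Proof.
apply: (@bounded_integrable _ (borel_rV R k) R alpha (fun x => K x y) setT 1) => //.
  exact: measurable_K_pure1.
by move=> x _; exact: K_pure_bound.
Qed.

(** Otherwise the Dirac mass at [y] would have a positive payoff against [alpha]. *)
Lemma optimal_ge0 y : allocation y -> 0 <= \int[alpha]_x K x y.
Proof.
move=> ay; rewrite leNgt; apply/negP => gy.
case: alpha_opt => _; apply; exists (dirac (y : borel_rV R k)).
  by rewrite /mixed_strategy/= diracE mem_set.
rewrite /K_mixed.
rewrite (_ : \int[alpha]_y' _ = \int[alpha]_x (- 1 * K x y)); last first.
  apply: eq_Rintegral => x _; rewrite mulN1r /Rintegral integral_dirac//.
    rewrite diracT mul1e /=; exact: race_payoff_anti.
  by apply/measurable_EFinP; exact: measurable_K_pure1.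
rewrite RintegralZl//; lra.
Qed.

Lemma ae_allocation : {ae alpha, forall x, allocation x}.
Proof.
exists (~` (@allocation R k)); split => //.
  by apply: measurableC; exact: measurable_allocation.
have m := measurable_allocation.
by rewrite probability_setC// (_ : alpha (@allocation R k) = 1%E) ?subee//; case: alpha_opt.
Qed.

Let g_measurable : measurable_fun [set: borel_rV R k] g.
Proof.
have [] := @bounded_Fubini _ _ R alpha (fun z => K z.1 z.2) 1 measurable_K_pure _.
  by move=> z; exact: K_pure_bound.
by [].
Qed.

Let g_bound y : `|g y| <= 1.
Proof.
apply: norm_Rintegral_le => //; first exact: measurable_K_pure1.
by move=> x; exact: K_pure_bound.
Qed.

Lemma optimal_ae0 : {ae alpha, forall y, \int[alpha]_x K x y = 0}.
Proof.
have I0 : \int[alpha]_(y in @allocation R k) g y = 0.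
  rewrite -(Rintegral_prob1 measurable_allocation _ g_measurable g_bound).
    apply: (@Rintegral_anti _ _ R alpha (fun z => K z.1 z.2) 1 measurable_K_pure).
      by move=> z; exact: K_pure_bound.
    by move=> x y; exact: race_payoff_anti.
  by case: alpha_opt.
have h : {ae alpha, forall y, allocation y -> g y = 0}.
  apply: (Rintegral_eq0_ae (M := 1) measurable_allocation) => //.
    exact: measurable_funTS.
  move=> y ay; rewrite optimal_ge0//=.
  by have := g_bound y; rewrite ler_norml => /andP[].
have h2 := ae_allocation.
have FF := ae_filter_ringOfSetsType alpha.
by apply: filterS2 h h2 => y; exact.
Qed.

End optimal_strategies.

Lemma near_sg (R : realType) (S : Type) (F : set_system S) {FF : Filter F}
    (f : S -> R) l : f @ F --> l -> l != 0 -> \forall a \near F, Num.sg (f a) = Num.sg l.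
Proof.
move=> fl l0; have [lt0|gt0|e0] := ltgtP l 0; last by rewrite e0 eqxx in l0.
  have := cvgr_lt _ fl; move=> /(_ _ (0 : R) lt0).
  by apply: filterS => a h; rewrite !ltr0_sg.
have := cvgr_gt _ fl; move=> /(_ _ (0 : R) gt0).
by apply: filterS => a h; rewrite !gtr0_sg.
Qed.

Lemma cvg_maxv (R : realType) k (S : Type) (F : set_system S) {FF : Filter F}
    (x_ y_ : S -> 'rV[R]_k) (x y : 'rV[R]_k) i :
  x_ a 0 i @[a --> F] --> x 0 i -> y_ a 0 i @[a --> F] --> y 0 i ->
  maxv (x_ a) (y_ a) i @[a --> F] --> maxv x y i.
Proof.
move=> xx yy; rewrite /maxv maxr_absE; under eq_cvg do rewrite maxr_absE.
apply: cvgM; last exact: cvg_cst.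
by apply: cvgD; [exact: cvgD|apply: cvg_norm; exact: cvgB].
Qed.

(** * Coincidences of coordinates under an optimal strategy *)

Section coincidences.
Context (R : realType) (k : nat) (p : 'I_k -> R).
Context d (T : measurableType d) (P : probability T R).
Variable Z : 'I_k -> {RV P >-> R}.
Hypothesis k_gt0 : (0 < k)%N.
Hypothesis p_gt0 : forall i, 0 < p i.
Hypothesis p_sum1 : \sum_(i < k) p i = 1.
Hypothesis Z_indep : mutually_independent P (fun i : 'I_k => sigma_of (Z i)).
Hypothesis Z_normal : forall (i : 'I_k) (B : set R), measurable B ->
  distribution P (Z i) B = normal_prob 0 1 B.
Implicit Types (x y v : 'rV[R]_k).
Local Notation K := (K_pure p P Z).
Local Notation q x y i := (last_prob p Z (maxv x y) i).

Variable alpha : probability (borel_rV R k) R.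
Hypothesis alpha_opt : optimal p P Z alpha.

Let same y i : set (borel_rV R k) := [set x : 'rV[R]_k | x 0 i = y 0 i].

Let measurable_same y i : measurable (same y i).
Proof.
rewrite -[X in measurable X]setTI (_ : same y i =
  (fun x : borel_rV R k => (x : 'rV[R]_k) 0 i) @^-1` [set y 0 i])//.
exact: measurable_coord.
Qed.

Let measurable_q y i : measurable_fun [set: borel_rV R k] (fun x => q x y i).
Proof.
apply: continuous_measurable_rV => x; have FF := nbhs_filter (x : 'rV[R]_k).
apply: (cvg_last_prob k_gt0 p_gt0 p_sum1 Z_indep Z_normal) => j.
by apply: cvg_maxv; [exact: coord_continuous|exact: cvg_cst].
Qed.

(** The size of the jump of twice the payoff when [y i] moves off a coinciding [x i]. *)
Let tie y i x : R := \1_(same y i) x * q x y i.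

Let measurable_tie y i : measurable_fun [set: borel_rV R k] (tie y i).
Proof.
by apply: measurable_funM => //; exact: measurable_indic.
Qed.

Let tie_itv y i x : 0 <= tie y i x <= 1.
Proof.
rewrite /tie indicE; case: (_ \in _).
  by rewrite mul1r last_prob_ge0//= last_prob_le1.
by rewrite mul0r lexx ler01.
Qed.

Let tie_int y i : alpha.-integrable setT (EFin \o tie y i).
Proof.
apply: (@bounded_integrable _ (borel_rV R k) R alpha (tie y i) setT 1) => // x _.
by have /andP[t0 t1] := tie_itv y i x; rewrite ger0_norm.
Qed.

(** Let [y] move to [y + v / (n + 1)]. Where [x i] differs from [y i] the sign is eventually
    unchanged; where they agree it passes from 0 to the sign of [v i]. So [2 * K] tends to its value
    at [y] plus the signed sum of the [tie]. Integrated against [alpha], the value at [y] gives 0,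
    and a limit of nonnegative payoffs remains. *)
Lemma sum_sg_tie_ge0 y v : allocation y -> allocation v ->
  \int[alpha]_x K x y = 0 ->
  0 <= \sum_(i < k) Num.sg (v 0 i) * \int[alpha]_x tie y i x.
Proof.
move=> ay av g0.
pose y_ (n : nat) : 'rV[R]_k := y + n.+1%:R^-1 *: v.
have ay_ n : allocation (y_ n).
  rewrite /allocation/=; under eq_bigr do rewrite !mxE.
  by rewrite big_split/= -mulr_sumr ay av mulr0 addr0.
have y_c i : y_ n 0 i @[n --> \oo] --> y 0 i.
  rewrite -[y 0 i]addr0 -(mul0r (v 0 i)).
  under eq_cvg do rewrite !mxE.
  apply: cvgD; first exact: cvg_cst.
  by apply: cvgMl; exact: cvg_harmonic.
pose f x := 2 * K x y + \sum_(i < k) Num.sg (v 0 i) * tie y i x.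
have mK z : measurable_fun [set: borel_rV R k] (fun x => 2 * K x z).
  by apply: measurable_funM => //; exact: measurable_K_pure1.
have mf : measurable_fun [set: borel_rV R k] f.
  apply: measurable_funD => //; apply: measurable_sum => i.
  exact: measurable_funM.
have K2 z x : `|2 * K x z| <= 2.
  by rewrite normrM ger0_norm// ler_piMr// K_pure_bound.
have cf : {ae alpha, forall x, 2 * K x (y_ n) @[n --> \oo] --> f x}.
  apply: aeW => x; rewrite /f K_pureE//; under eq_cvg do rewrite K_pureE//.
  rewrite -big_split/=.
  apply: cvg_big => [|i _]; first exact: add_continuous.
  have qc : q x (y_ n) i @[n --> \oo] --> q x y i.
    by apply: cvg_last_prob => // j; apply: cvg_maxv; [exact: cvg_cst|exact: y_c].
  rewrite /tie mulrA -mulrDl; apply: cvgM => //.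
  have [xy|xy] := eqVneq (x 0 i) (y 0 i).
    rewrite indicE mem_set// mulr1 xy subrr sgr0 add0r.
    apply: cvg_near_cst; apply: nearW => n.
    by rewrite !mxE addrAC subrr add0r sgrM gtr0_sg ?mul1r// invr_gt0.
  rewrite indicE memNset; last by move=> /= xy'; rewrite xy' eqxx in xy.
  rewrite mulr0 addr0; apply: cvg_near_cst; apply: near_sg.
    by apply: cvgB => //; exact: cvg_cst.
  by rewrite subr_eq0 eq_sym.
have := bounded_convergence (fun n => mK (y_ n)) mf (fun n => K2 (y_ n)) cf.
have Kint z : alpha.-integrable setT (EFin \o (fun x => K x z)).
  apply: (@bounded_integrable _ (borel_rV R k) R alpha (fun x => K x z) setT 1) => //.
    exact: measurable_K_pure1.
  by move=> x _; exact: K_pure_bound.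
have -> : \int[alpha]_x f x = \sum_(i < k) Num.sg (v 0 i) * \int[alpha]_x tie y i x.
  rewrite /f RintegralD//.
  - by rewrite RintegralZl// g0 mulr0 add0r Rintegral_lincomb.
  - by apply: (@bounded_integrable _ (borel_rV R k) R alpha (fun x => 2 * K x y) setT 2).
  - apply: (@bounded_integrable _ (borel_rV R k) R alpha _ setT (\sum_(i < k) 1)) => //.
      by apply: measurable_sum => i; exact: measurable_funM.
    move=> x _; apply: (le_trans (ler_norm_sum _ _ _)); apply: ler_sum => i _.
    have /andP[t0 t1] := tie_itv y i x.
    by rewrite normrM normr_sg ger0_norm// mulr_ile1//; case: (_ == _).
move=> h; apply: (cvgr_to_ge h).
apply: nearW => n /=.
by rewrite RintegralZl// mulr_ge0// (optimal_ge0 alpha_opt).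
Qed.

Let ae_exists (A : set (borel_rV R k)) (Q : 'rV[R]_k -> Prop) : measurable A ->
  alpha A != 0%E -> {ae alpha, forall x, Q x} -> exists2 x, A x & Q x.
Proof.
move=> mA A0 aeQ; apply: contrapT => h; move/eqP: A0; apply.
apply: measure_negligible => //; apply: negligibleS aeQ => x Ax Qx.
by apply: h; exists x.
Qed.

Let ae_optimal : {ae alpha, forall x, allocation x /\ \int[alpha]_x' K x' x = 0}.
Proof.
have FF := ae_filter_ringOfSetsType alpha.
have h := optimal_ae0 alpha_opt.
have h2 := ae_allocation alpha_opt.
by apply: filterS2 h2 h => x.
Qed.

(** [last_prob] is positive, so [tie] vanishes only off the coincidence. *)
Let tie_eq0 y i : \int[alpha]_x tie y i x = 0 -> alpha (same y i) = 0%E.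
Proof.
move=> t0; apply: measure_negligible => //.
have := Rintegral_eq0_ae measurableT (measurable_tie y i) (fun x _ => tie_itv y i x) t0.
apply: negligibleS => x /= xy /(_ Logic.I).
rewrite /tie indicE mem_set// mul1r => /eqP; apply/negP.
by rewrite gt_eqF// last_prob_gt0.
Qed.

Let sum_delta (D : 'I_k -> R) i : \sum_(l < k) (l == i)%:R * D l = D i.
Proof.
rewrite (bigD1 i)//= eqxx mul1r big1 ?addr0// => l /negPf ->.
by rewrite mul0r.
Qed.

(* Moving [y] along [e_i - e_j] and [2 e_i - e_j - e_l] turns
   [sum_sg_tie_ge0] into [0 <= D i - D j] and [0 <= D i - D j - D l]. *)
Let same_null3 y i : (2 < k)%N -> allocation y ->
  \int[alpha]_x K x y = 0 -> alpha (same y i) = 0%E.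
Proof.
move=> k2 ay g0; apply: tie_eq0.
pose D l := \int[alpha]_x tie y l x.
have D1 l : \sum_(m < k) (m == l)%:R = 1 :> R.
  by have := sum_delta (fun=> 1) l; under eq_bigr do rewrite mulr1.
have Dge a b : a != b -> D b <= D a.
  move=> ab; pose v : 'rV[R]_k := \row_l ((l == a)%:R - (l == b)%:R).
  have av : allocation v.
    by rewrite /allocation/=; under eq_bigr do rewrite mxE; rewrite sumrB !D1 subrr.
  have := sum_sg_tie_ge0 ay av g0.
  rewrite (eq_bigr (fun l => (l == a)%:R * D l - (l == b)%:R * D l)).
    by rewrite sumrB !sum_delta subr_ge0.
  move=> l _; rewrite mxE -/(D l) -mulrBl; congr (_ * _).
  case: (eqVneq l a) => [->|la]; case: (eqVneq _ b) => [eb|lb].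
  - by rewrite subrr sgr0.
  - by rewrite subr0 sgr1.
  - by rewrite sub0r sgrN1.
  - by rewrite subrr sgr0.
have [j [l [ij il jl]]] : exists j l : 'I_k, [/\ i != j, i != l & j != l].
  have : (1 < #|predC1 i|)%N.
    by rewrite -ltnS (leq_trans k2)//; have := cardC1 i; rewrite card_ord => ->; case: (k) k2.
  case/card_gt1P => j [l [ji li jl]]; by exists j, l; split => //; rewrite eq_sym.
(* The first kind of direction makes the three values agree. In the second only signs count: the
   coefficient 2 that balances the sum weighs no more than 1, and the condition becomes
   [0 <= - D i]. *)
have Dj : D i = D j by apply/eqP; rewrite eq_le !Dge// eq_sym.
have Dl : D i = D l by apply/eqP; rewrite eq_le !Dge// eq_sym.
have D0 : 0 <= D i by apply: Rintegral_ge0 => x _; have /andP[] := tie_itv y i x.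
pose v : 'rV[R]_k := \row_m (2 * (m == i)%:R - (m == j)%:R - (m == l)%:R).
have av : allocation v.
  rewrite /allocation/=; under eq_bigr do rewrite mxE.
  by rewrite !sumrB -mulr_sumr !D1; lra.
have := sum_sg_tie_ge0 ay av g0.
rewrite (eq_bigr (fun m => (m == i)%:R * D m - (m == j)%:R * D m - (m == l)%:R * D m)).
  rewrite !sumrB !sum_delta -Dj -Dl -/(D i); lra.
move=> m _; rewrite mxE -/(D m) -!mulrBl; congr (_ * _).
have [->|mi] := eqVneq m i.
  by rewrite (negPf ij) (negPf il) !subr0 mulr1 gtr0_sg.
have [->|mj] := eqVneq m j.
  by rewrite (negPf jl) mulr0 !sub0r !subr0 sgrN1.
have [_|ml] := eqVneq m l; first by rewrite mulr0 !sub0r oppr0 add0r sgrN1.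
by rewrite mulr0 !subr0 sgr0.
Qed.

Lemma lsc_pair_neq x y : (forall i, x 0 i != y 0 i) -> lsc_pair p Z x y.
Proof.
move=> xy u _ hu; rewrite le_eqVlt; apply/orP; left; apply/eqP.
by apply: eq_bigr => i _; rewrite hu.
Qed.

Lemma optimal_lsc y0 : allocation y0 -> {ae alpha, forall x, lsc_pair p Z x y0}.
Proof.
move=> ay0; have FF := ae_filter_ringOfSetsType alpha.
have [k2|k2] := ltnP 2 k.
  have : {ae alpha, forall x, forall i, ~ same y0 i x}.
    apply: filter_forall => i; exists (same y0 i); split => //; last first.
      by move=> x /= /contrapT.
    apply/eqP; apply: contraT => s0.
    (* [y0] itself need not have payoff 0, but a set of positive mass contains such a [y]; sharing
       the coordinate [i], [y] and [y0] define the same set. *)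
    have [y yy0 [ay gy]] := ae_exists (measurable_same y0 i) s0 ae_optimal.
    by rewrite -(same_null3 i k2 ay gy) /same yy0 eqxx in s0.
  apply: filterS => x xy; apply: lsc_pair_neq => i.
  by apply/eqP; exact: xy.
pose i0 := Ordinal k_gt0.
have far x : allocation x -> ~ same y0 i0 x -> lsc_pair p Z x y0.
  move=> ax xy; apply: lsc_pair_neq => i; apply/eqP => xyi; apply: xy.
  by rewrite (allocation_inj k2 ax ay0 xyi).
have [s0|s0] := eqVneq (alpha (same y0 i0)) 0%E.
  have h : {ae alpha, forall x, ~ same y0 i0 x}.
    by exists (same y0 i0); split => // x /= /contrapT.
  have h2 := ae_optimal.
  by apply: filterS2 h h2 => x xy [ax _]; exact: far.
have [y yy0 [ay]] := ae_exists (measurable_same y0 i0) s0 ae_optimal.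
rewrite (allocation_inj k2 ay ay0 yy0) => g0.
have h2 := ae_optimal; apply: filterS h2 => x [ax _].
have [xy|/far] := pselect (same y0 i0 x); last exact.
rewrite (allocation_inj k2 ax ay0 xy) => u au _.
under eq_bigr do rewrite subrr sgr0 mul0r; rewrite big1_eq.
(* Among allocations the coincidence set is the point [y0] alone, so [tie] integrates to [m] times
   [last_prob], and division by [m] turns [sum_sg_tie_ge0] into the claim. *)
pose m := fine (alpha (same y0 i0)).
have m0 : 0 < m.
  by rewrite fine_gt0// lt0e s0 measure_ge0/= (le_lt_trans (probability_le1 _ _))// ltry.
have tieE i : \int[alpha]_x tie y0 i x = m * q y0 y0 i.
  have ma := @measurable_allocation R k.
  have a1 : alpha (@allocation R k) = 1%E by case: alpha_opt.
  have mI : measurable_fun [set: borel_rV R k] (\1_(same y0 i0) : _ -> R).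
    exact: measurable_indic.
  have Ib x' : `|\1_(same y0 i0) x' : R| <= 1 by rewrite indicE; case: (_ \in _); rewrite ?normr1 ?normr0.
  rewrite (@Rintegral_prob1 _ _ _ _ _ _ 1 ma a1)//; last first.
    by move=> x'; have /andP[t0 t1] := tie_itv y0 i x'; rewrite ger0_norm.
  rewrite (_ : \int[alpha]_(x in _) _ = \int[alpha]_(x in @allocation R k) (\1_(same y0 i0) x * q y0 y0 i)).
    rewrite RintegralZr//.
      rewrite -(@Rintegral_prob1 _ _ _ _ (\1_(same y0 i0)) _ 1 ma a1)//.
      by rewrite /Rintegral integral_indic// setIT.
    by apply: (@bounded_integrable _ (borel_rV R k) R alpha _ _ 1) => //; exact: measurable_funTS.
  apply: eq_Rintegral => x' /set_mem ax'; rewrite /tie !indicE.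
  have [xy'|xy'] := pselect (same y0 i0 x').
    by rewrite (allocation_inj k2 ax' ay0 xy') !mem_set.
  rewrite !memNset ?mul0r//= => xyi; apply: xy'.
  by rewrite (allocation_inj k2 ax' ay0 xyi).
have := sum_sg_tie_ge0 ay0 au g0.
under eq_bigr do rewrite tieE mulrCA.
by rewrite -mulr_sumr pmulr_rge0.
Qed.

End coincidences.

(** * Asymptotic optimality *)

Lemma ler_norm_coord (R : realType) k (x : 'rV[R]_k) i : `|x 0 i| <= `|x|.
Proof.
rewrite {2}/Num.norm/= mx_normrE.
exact: (le_bigmax _ (fun ij : 'I_1 * 'I_k => `|x ij.1 ij.2|) (0, i)).
Qed.

Lemma compact_box (R : realType) k (a b : R) :
  compact [set y : 'rV[R]_k | forall i, y ord0 i \in `[a, b]].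
Proof.
apply: (@rV_compact _ _ (fun=> `[a, b]%classic)).
by move=> _; apply: segment_compact.
Qed.

(** * Measurability on finite sets *)

Section finite_sets.
Context d (T : measurableType d).
Hypothesis measurable_point : forall x : T, measurable [set x].

Lemma finite_set_measurable (A : set T) : finite_set A -> measurable A.
Proof.
move=> fA; rewrite (_ : A = \bigcup_(x in A) [set x]).
  exact: fin_bigcup_measurable.
by apply/seteqP; split => [x Ax|x [y Ay ->]//]; exists x.
Qed.

Lemma finite_set_measurable_fun d' (T' : measurableType d') (A : set T) (f : T -> T') :
  finite_set A -> measurable_fun A f.
Proof.
by move=> fA _ B _; apply: finite_set_measurable; exact: finite_setIl.
Qed.

End finite_sets.

Lemma borel_rV_measurable_set1 (R : realType) k (x : borel_rV R k) : measurable [set x].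
Proof.
rewrite (_ : [set x] = \bigcap_(i in [set: 'I_k])
    ((fun y : borel_rV R k => (y : 'rV[R]_k) 0 i) @^-1` [set (x : 'rV[R]_k) 0 i])).
  apply: fin_bigcap_measurable => [|i _]; first exact: finite_finset.
  rewrite -[X in measurable X]setTI; exact: measurable_coord.
apply/seteqP; split => [y -> //|y h]; apply/rowP => i.
exact: h.
Qed.

Lemma near_decreasing_basis S (V : nat -> set S) :
  (forall i j, (i <= j)%N -> V j `<=` V i) ->
  Filter (filter_from [set: nat] V).
Proof.
move=> Vd; apply: filter_fromT_filter; first by exists 0%N.
by move=> i j; exists (maxn i j) => x Vx; split; apply: Vd Vx; rewrite ?leq_maxl ?leq_maxr.
Qed.

Section token_limits.
Context (R : realType) (k : nat) (p : 'I_k -> R).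
Context dZ (TZ : measurableType dZ) (PZ : probability TZ R).
Variable Z : 'I_k -> {RV PZ >-> R}.
Context dY (TY : measurableType dY) (PY : probability TY R).
Variable Y : 'I_k -> R -> TY -> nat.
Variable alpha : nat -> probability (borel_rV R k) R.
Variable alpha0 : probability (borel_rV R k) R.
Hypothesis k_gt0 : (0 < k)%N.
Hypothesis p_gt0 : forall i, 0 < p i.
Hypothesis p_sum1 : \sum_(i < k) p i = 1.
Hypothesis Z_indep : mutually_independent PZ (fun i : 'I_k => sigma_of (Z i)).
Hypothesis Z_normal : forall (i : 'I_k) (B : set R), measurable B ->
  distribution PZ (Z i) B = normal_prob 0 1 B.
Hypothesis Y_indep : mutually_independent PY (fun i : 'I_k => sigma_process (Y i)).
Hypothesis Y_poisson : forall i : 'I_k, poisson_process PY (p i) (Y i).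
Hypothesis alpha_mixed : forall n : nat, (0 < n)%N -> token_mixed_strategy p n (alpha n).
Hypothesis alpha_cvg : weakly_converges alpha alpha0.
Hypothesis alpha0_optimal : optimal p PZ Z alpha0.
Implicit Types (x y : 'rV[R]_k).
Local Notation A n := (A_ p n).
Local Notation Kn := (Kn_pure p PY Y).

Lemma measurable_A_ n : measurable (A n : set (borel_rV R k)).
Proof.
exact: (finite_set_measurable (@borel_rV_measurable_set1 R k) (finite_A_ p n)).
Qed.

Let measurable_Kn n y : measurable_fun (A n : set (borel_rV R k)) (fun x => Kn n x y).
Proof.
exact: (finite_set_measurable_fun (@borel_rV_measurable_set1 R k) _ (finite_A_ p n)).
Qed.

Let Kn1 n x y : `|Kn n x y| <= 1.
Proof. exact: Kn_pure_bound Y_poisson _ _ _. Qed.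

(* [weak_liminf] and the limits of [Kn_pure] along the pairs [(n, y)] with
   [n >= j], [y \in A n] and [Q j y], for [j] tending to infinity. *)
Let Kn_mixed_ge (Q : nat -> set 'rV[R]_k) (h : 'rV[R]_k -> R) :
  (forall i j, (i <= j)%N -> Q j `<=` Q i) ->
  measurable_fun [set: borel_rV R k] h -> (forall x, `|h x| <= 1) ->
  0 <= \int[alpha0]_x h x ->
  {ae alpha0, forall x0, forall (S : Type) (F : set_system S), Filter F ->
    forall (n : S -> nat) (x_ y_ : S -> 'rV[R]_k),
    n @ F --> \oo -> (\forall a \near F, A (n a) (x_ a)) ->
    (\forall a \near F, A (n a) (y_ a)) ->
    (forall i, x_ a 0 i @[a --> F] --> x0 0 i) ->
    (forall j, \forall a \near F, Q j (y_ a)) ->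
    forall e, 0 < e -> \forall a \near F, h x0 - e <= Kn (n a) (x_ a) (y_ a)} ->
  forall e, 0 < e -> exists j, forall n y, (j <= n)%N -> A n y -> Q j y ->
    - e <= Kn_mixed p PY Y n (alpha n) y.
Proof.
move=> Qd mh h1 h0 hae e e0.
pose U j := [set ny : nat * 'rV[R]_k | [/\ (j <= ny.1)%N, A ny.1 ny.2 & Q j ny.2]].
have [] := @weak_liminf R k alpha alpha0 alpha_cvg (nat * 'rV[R]_k)%type fst U
  (fun n => A n) (fun ny x => Kn ny.1 x ny.2) _ measurable_A_ alpha_mixed
  (fun ny => @measurable_Kn ny.1 ny.2) (fun ny x => @Kn1 ny.1 x ny.2) h mh h1 _ e e0.
- by move=> i j ij ny [/(leq_trans ij) ? ? /(Qd _ _ ij) ?].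
- have FF := ae_filter_ringOfSetsType alpha0.
  apply: filterS hae => x0 lim e1 e10.
  (* Triples [(n, y, x)]: the uniform bound asked by [weak_liminf] is the limit hypothesis read
     along the filter generated by these sets. *)
  pose V j := [set a : (nat * 'rV[R]_k) * 'rV[R]_k |
    [/\ U j a.1, A a.1.1 a.2 & `|a.2 - x0| < j.+1%:R^-1]].
  have Vd i j : (i <= j)%N -> V j `<=` V i.
    move=> ij a [[u1 u2 u3] Aa ax]; split => //.
      by split => //; [exact: leq_trans u1|exact: Qd u3].
    by rewrite (lt_le_trans ax)// lef_pV2 ?posrE ?ltr0n// ler_nat ltnS.
  have VF := near_decreasing_basis Vd.
  have nV j : filter_from [set: nat] V (V j) by exists j.
  have [| | | | |j _ hj] := lim _ _ VF (fun a => a.1.1) (fun a => a.2) (fun a => a.1.2) _ _ _ _ _ e1 e10.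
  + move=> B [N _ NB]; exists N => // a [[Na _ _] _ _]; exact: NB.
  + by apply: filterS (nV 0%N) => a [].
  + by apply: filterS (nV 0%N) => a [[]].
  + move=> i; apply/cvgrPdist_lt => e2 e20.
    near \oo => j.
    have je : j.+1%:R^-1 < e2.
      by near: j; exact: (near_infty_natSinv_lt (PosNum e20)).
    apply: filterS (nV j) => a [_ _ ax].
    rewrite distrC (le_lt_trans _ (lt_trans ax je))//.
    by have := ler_norm_coord (a.2 - x0) i; rewrite !mxE.
  + by move=> j; apply: filterS (nV j) => a [[]].
  exists j => ny Uj x Ax xx0; exact: (hj (ny, x)).
move=> j hj; exists j => n y jn Any Qy.
have := hj (n, y) (And3 jn Any Qy) jn; apply: le_trans; lra.
Unshelve. all: end_near. Qed.

(** The lower limit is [K_pure] against [y0]: [optimal_lsc] justifies it almost everywhere, and its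
    mean under [alpha0] is nonnegative by optimality. *)
Let Kn_mixed_ge_near y0 : allocation y0 -> forall e, 0 < e ->
  exists j, forall n y, (j <= n)%N -> A n y -> `|y - y0| < j.+1%:R^-1 ->
    - e <= Kn_mixed p PY Y n (alpha n) y.
Proof.
move=> ay0; apply: (@Kn_mixed_ge (fun j => [set y | `|y - y0| < j.+1%:R^-1])
  (fun x => K_pure p PZ Z x y0)).
- move=> i j ij y /= yy0.
  by rewrite (lt_le_trans yy0)// lef_pV2 ?posrE ?ltr0n// ler_nat ltnS.
- exact: measurable_K_pure1.
- by move=> x; exact: K_pure_bound.
- exact: (optimal_ge0 alpha0_optimal).
have FF := ae_filter_ringOfSetsType alpha0.
have := optimal_lsc k_gt0 p_gt0 p_sum1 Z_indep Z_normal alpha0_optimal ay0.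
apply: filterS => x0 lsc S F HF n x_ y_ noo xA yA xx0 yy0 e e0.
apply: (Kn_liminf k_gt0 p_gt0 p_sum1 Z_indep Z_normal Y_indep Y_poisson noo xA yA xx0 _ lsc e0).
move=> i; apply/cvgrPdist_lt => e2 e20.
near \oo => j.
have je : j.+1%:R^-1 < e2.
  by near: j; exact: (near_infty_natSinv_lt (PosNum e20)).
apply: filterS (yy0 j) => a /= ay.
rewrite distrC (le_lt_trans _ (lt_trans ay je))//.
by have := ler_norm_coord (y_ a - y0) i; rewrite !mxE.
Unshelve. all: end_near. Qed.

Let Kn_mixed_ge_far e : 0 < e ->
  exists j, forall n y, (j <= n)%N -> A n y -> (exists i, j%:R <= y 0 i) ->
    - e <= Kn_mixed p PY Y n (alpha n) y.
Proof.
apply: (@Kn_mixed_ge (fun j => [set y | exists i, j%:R <= y 0 i]) (cst 0)) => //.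
- by move=> i j ij y [l jl]; exists l; rewrite (le_trans _ jl)// ler_nat.
- by move=> x; rewrite normr0 ler01.
- exact: Rintegral_ge0.
apply: aeW => x0 S F HF n x_ y_ noo xA yA xx0 yoo e0 e00; rewrite sub0r.
apply: (Kn_liminf_unbounded k_gt0 p_gt0 p_sum1 Y_poisson noo xA yA xx0 _ e00).
move=> C; apply: filterS (yoo (Num.bound `|C|)) => a [i Ci]; exists i.
by rewrite (le_trans _ Ci)// (le_trans (ler_norm C))// ltW// archi_boundP.
Qed.

Lemma Kn_mixed_liminf e : 0 < e ->
  \forall n \near \oo, forall y, A n y -> - e <= Kn_mixed p PY Y n (alpha n) y.
Proof.
move=> e0; have [j hj] := Kn_mixed_ge_far e0.
(* Coordinates that are at most [j] and add up to 0 are at least [- k * j], so an allocation outside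
   this box has a coordinate above [j] and falls under [hj]. *)
pose B := [set y : 'rV[R]_k | forall i, y ord0 i \in `[- (k%:R * j%:R), j%:R]].
pose C := @allocation R k `&` B.
have cB : compact B := @compact_box R k _ _.
have cC : compact C.
  rewrite /C setIC; apply: compact_closedI => //.
  rewrite (_ : @allocation R k = (fun x => \sum_(i < k) x 0 i) @^-1` [set 0])//.
  apply: closed_comp => [x _|]; last exact: closed_eq.
  have FF := nbhs_filter (x : 'rV[R]_k).
  apply: cvg_big => [|i _]; first exact: add_continuous.
  exact: coord_continuous.
(* This form of compactness merges the local thresholds for [n] into one. *)
have /compact_near_coveringP cov := cC.
have h : \forall n \near \oo,
    C `<=` (fun y => A n y -> - e <= Kn_mixed p PY Y n (alpha n) y).
  apply: cov.
  move=> y0 [ay0 _]; have [l hl] := Kn_mixed_ge_near ay0 e0.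
  exists ([set y | `|y - y0| < l.+1%:R^-1], [set n | (l <= n)%N]) => /=.
    split; last exact: nbhs_infty_ge.
    have l0 : 0 < l.+1%:R^-1 :> R by rewrite invr_gt0.
    have := nbhsx_ballx (y0 : 'rV[R]_k) _ l0.
    by rewrite mx_norm_ball; apply: filterS => y; rewrite /ball_/= distrC.
  by move=> [y n] /= [? ?] ?; exact: hl.
near=> n => y Ay.
have hn : C `<=` (fun y => A n y -> - e <= Kn_mixed p PY Y n (alpha n) y) by near: n.
have [[i ji]|yj] := pselect (exists i, j%:R <= y 0 i).
  apply: hj => //; last by exists i.
  by near: n; exact: nbhs_infty_ge.
have ay := A_allocation p_sum1 Ay.
have {}yj i : y 0 i <= j%:R.
  by rewrite leNgt; apply/negP => ji; apply: yj; exists i; exact: ltW.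
apply: hn => //; split => // i; rewrite in_itv/= yj andbT.
have := ay; rewrite /allocation/= (bigD1 i)//= => /eqP; rewrite addr_eq0 => /eqP ->.
rewrite lerN2; apply: (@le_trans _ _ (\sum_(l < k | l != i) j%:R)).
  by apply: ler_sum.
rewrite sumr_const -[leLHS]mulr_natl ler_wpM2r// ler_nat.
by rewrite -[leqRHS](card_ord k) max_card.
Unshelve. all: end_near. Qed.

(** The minimum over [y] is at most the mean of the payoff when [y] is drawn from [alpha n] itself,
    and that mean vanishes. *)
Lemma kappa_le0 n : (0 < n)%N -> kappa p PY Y n (alpha n) <= 0.
Proof.
move=> n0; have [y0 Ay0 [_ ymin]] := kappa_min p PY Y n (alpha n) k_gt0.
have [y1 Ay1 [-> {y0 Ay0}ymin]] := kappa_min p PY Y n (alpha n) k_gt0.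
pose AA : set (borel_rV R k * borel_rV R k) := A n `*` A n.
(* The indicator of a finite symmetric set makes [f] measurable on the whole product and keeps it
   antisymmetric. *)
pose f (z : borel_rV R k * borel_rV R k) : R := \1_AA z * Kn n z.1 z.2.
have mf : measurable_fun setT f.
  have mAA : measurable AA by apply: measurableX; exact: measurable_A_.
  rewrite -(setUv AA); apply/measurable_funU => //; first exact: measurableC.
  split.
    apply: finite_set_measurable_fun.
      move=> [x y]; rewrite (_ : [set (x, y)] = [set x] `*` [set y]).
        by apply: measurableX; exact: borel_rV_measurable_set1.
      by apply/seteqP; split => [[? ?] [-> ->]|[? ?] [/= -> ->]].
    by apply: finite_setX; exact: finite_A_.
  apply: (eq_measurable_fun (fun=> 0 : R)) => // z /set_mem zA.
  by rewrite /f indicE memNset// mul0r.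
have fM z : `|f z| <= 1.
  rewrite /f indicE; case: (_ \in _); first by rewrite mul1r Kn1.
  by rewrite mul0r normr0.
have f_anti x y : f (x, y) = - f (y, x).
  rewrite /f !indicE !in_setX/= andbC -mulrN; congr (_ * _).
  exact: race_payoff_anti.
have := Rintegral_anti (alpha n) mf fM f_anti.
have -> : \int[alpha n]_y \int[alpha n]_x f (x, y) =
    \int[alpha n]_(y in A n) Kn_mixed p PY Y n (alpha n) y.
  rewrite [RHS]Rintegral_mkcond; apply: eq_Rintegral => y _.
  rewrite patchE; case: ifPn => yA.
    rewrite /Kn_mixed [RHS]Rintegral_mkcond; apply: eq_Rintegral => x _.
    rewrite /f indicE in_setX/= yA andbT patchE.
    by case: (_ \in _); rewrite ?mul1r ?mul0r.
  transitivity (\int[alpha n]_x (0 : R)); last by rewrite Rintegral_cst// mul0r.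
  apply: eq_Rintegral => x _.
  by rewrite /f indicE in_setX/= (negPf yA) andbF mul0r.
have mA := measurable_A_ n.
have A1 : alpha n (A n) = 1%E := alpha_mixed n0.
have bK y : `|Kn_mixed p PY Y n (alpha n) y| <= 1.
  by apply: norm_Rintegral_le.
move=> <-; have -> : Kn_mixed p PY Y n (alpha n) y1 =
    \int[alpha n]_(y in A n) Kn_mixed p PY Y n (alpha n) y1.
  by rewrite Rintegral_cst// [X in fine X]A1 mulr1.
apply: le_Rintegral => //.
  by apply: (@bounded_integrable _ (borel_rV R k) R (alpha n) _ _ 1).
apply: (@bounded_integrable _ (borel_rV R k) R (alpha n) _ _ 1) => //.
exact: (finite_set_measurable_fun (@borel_rV_measurable_set1 R k) _ (finite_A_ p n)).
Qed.

End token_limits.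

Theorem corollary4p3 (R : realType) (k : nat) (p : 'I_k -> R)
  (dZ : measure_display) (TZ : measurableType dZ) (PZ : probability TZ R)
  (Z : 'I_k -> {RV PZ >-> R})
  (dY : measure_display) (TY : measurableType dY) (PY : probability TY R)
  (Y : 'I_k -> R -> TY -> nat)
  (alpha : nat -> probability (borel_rV R k) R)
  (alpha0 : probability (borel_rV R k) R)
  (k_gt0 : (0 < k)%N)
  (p_gt0 : forall i, 0 < p i)
  (p_sum1 : \sum_(i < k) p i = 1)
  (Z_indep : mutually_independent PZ (fun i : 'I_k => sigma_of (Z i)))
  (Z_normal : forall (i : 'I_k) (B : set R), measurable B ->
     distribution PZ (Z i) B = normal_prob 0 1 B)
  (Y_indep : mutually_independent PY (fun i : 'I_k => sigma_process (Y i)))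
  (Y_poisson : forall i : 'I_k, poisson_process PY (p i) (Y i))
  (alpha_mixed : forall n : nat, (0 < n)%N -> token_mixed_strategy p n (alpha n))
  (alpha_cvg : weakly_converges alpha alpha0)
  (alpha0_optimal : optimal p PZ Z alpha0) :
  kappa p PY Y n (alpha n) @[n --> \oo] --> (0 : R).
Proof.
apply/cvgrPdist_le => e e0; near=> n.
have k0 : kappa p PY Y n (alpha n) <= 0.
  by apply: kappa_le0 => //; near: n; exact: nbhs_infty_gt.
have hn : forall y, A_ p n y -> - e <= Kn_mixed p PY Y n (alpha n) y.
  near: n; exact: (Kn_mixed_liminf k_gt0 p_gt0 p_sum1 Z_indep Z_normal Y_indep
    Y_poisson alpha_mixed alpha_cvg alpha0_optimal e0).
rewrite sub0r normrN ler0_norm// lerNl.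
by have [y Ay [-> _]] := kappa_min p PY Y n (alpha n) k_gt0; exact: hn.
Unshelve. all: end_near. Qed.
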